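(* A random vector $W\in\mathbb{R}^d$ is said to have distribution $EC(0,\Gamma,F)$ if $W=\Gamma^{1/2}E$ for a random vector $E$ such that $F(t)=\mathbb{P}(u^TE\le t\|u\|)$ does not depend on $u\in\mathbb{R}^d\setminus\{0\}$, and $F(t)=\int_{-\infty}^tf(s)\,ds$ for a density $f$ with $f(0)=1$. Let $p,m\ge1$, $\Sigma\in\mathbb{R}^{p\times p}$ a covariance matrix, and fix such $\Gamma\in\mathbb{R}^{m\times m}$, $F$, $f$. For $B\in\mathbb{R}^{p\times m}$ let $P_B$ be the law of $(X,Y)\in\mathbb{R}^p\times\mathbb{R}^m$ with $X\sim N(0,\Sigma)$ and $(Y-B^TX)\mid X\sim EC(0,\Gamma,F)$. For $\epsilon\in[0,1)$ and arbitrary $Q$, let $(X_1,Y_1),\dots,(X_n,Y_n)$ be i.i.d. from $\mathbb{P}_{(\epsilon,B,Q)}=(1-\epsilon)P_B+\epsilon Q$. Define $\mathcal{D}_{\mathcal{U}}(B,\mathbb{P})=\inf_{U\in\mathcal{U}}\mathbb{P}\{\langle U^TX,Y-B^TX\rangle\ge0\}$ and let $\widehat B$ be any maximizer over $B\in\mathbb{R}^{p\times m}$ of $\mathcal{D}_{\mathbb{R}^{p\times m}\setminus\{0\}}(B,\mathbb{P}_n)$, $\mathbb{P}_n$ the empirical measure. Assume there are constants $c_1,c_2>0$ with $\min_{|t|\le c_1}f(t)\ge c_2$. Let $\kappa=\inf_{v\ne0}\|\Sigma^{1/2}v\|/\|v\|$ and $\sigma^2=\|\Gamma\|_{\rm op}$.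 Then there exist constants $c_0,C,C'>0$ (depending only on $c_1,c_2$) such that whenever $\epsilon^2+\frac{pm}{n}\le c_0$, $$\mathrm{Tr}\big((\widehat B-B)^T\Sigma(\widehat B-B)\big)\le C\sigma^2\Big(\frac{pm}{n}\vee\epsilon^2\Big),\qquad \|\widehat B-B\|_{\rm F}^2\le C\frac{\sigma^2}{\kappa^2}\Big(\frac{pm}{n}\vee\epsilon^2\Big),$$ with $\mathbb{P}_{(\epsilon,B,Q)}$-probability at least $1-\exp(-C'(pm+n\epsilon^2))$, uniformly over all $Q$ and $B\in\mathbb{R}^{p\times m}$.
   Context: $\|\Gamma\|_{\rm op}$ is the operator (spectral) norm; $\|\cdot\|_{\rm F}$ the Frobenius norm; $a\vee b=\max(a,b)$. *)

(* Defs.v *)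
From HB Require Import structures.
From mathcomp Require Import all_boot all_order all_algebra.
From mathcomp Require Import all_classical all_reals all_analysis.
Set Implicit Arguments. Unset Strict Implicit. Unset Printing Implicit Defensive.
Import Order.TTheory GRing.Theory Num.Theory.
Import numFieldNormedType.Exports.
Local Open Scope classical_set_scope.
Local Open Scope ring_scope.

Section Defs.
Variable R : realType.

Definition vnorm (k : nat) (v : 'cV[R]_k) : R := Num.sqrt (\sum_i v i 0 ^+ 2).

Definition vdot (k : nat) (a b : 'cV[R]_k) : R := \sum_i a i 0 * b i 0.

Definition frob2 (a b : nat) (A : 'M[R]_(a, b)) : R := \sum_i \sum_j A i j ^+ 2.

Definition symmetric (k : nat) (A : 'M[R]_k) : Prop := A^T = A.
Definition psd (k : nat) (A : 'M[R]_k) : Prop :=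
  symmetric A /\ forall v : 'cV[R]_k, 0 <= vdot v (A *m v).

(* the (unique) symmetric positive semidefinite square root A^{1/2} *)
Definition psd_sqrt (k : nat) (A : 'M[R]_k) : 'M[R]_k :=
  xget 0 [set S : 'M[R]_k | psd S /\ S *m S = A].

Definition opnorm (k : nat) (A : 'M[R]_k) : R :=
  sup [set vnorm (A *m v) | v in [set v : 'cV[R]_k | vnorm v = 1]].

Definition kappa (k : nat) (Sigma : 'M[R]_k) : R :=
  inf [set vnorm (psd_sqrt Sigma *m v) / vnorm v | v in [set v : 'cV[R]_k | v != 0]].

Definition coord_borel (T I : Type) (c : I -> T -> R) : set (set T) :=
  smallest (sigma_algebra setT)
    [set A | exists i t, A = [set x | c i x <= t]].

Definition vec_borel (k : nat) : set (set 'cV[R]_k) :=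
  coord_borel (fun (i : 'I_k) (v : 'cV[R]_k) => v i 0).

Definition obs (p m : nat) := ('cV[R]_p * 'cV[R]_m)%type.

Definition obs_borel (p m : nat) : set (set (obs p m)) :=
  coord_borel (fun (i : 'I_p + 'I_m) (z : obs p m) =>
    match i with inl a => z.1 a 0 | inr b => z.2 b 0 end).

Definition rmeasurable (d : measure_display) (Omega : measurableType d) (T : Type)
  (Bor : set (set T)) (Z : Omega -> T) : Prop :=
  forall A, Bor A -> measurable (Z @^-1` A).

(* X ~ N(0, Sigma): every linear combination u^T X is N(0, u^T Sigma u)
   (degenerate at 0 when the variance vanishes) *)
Definition is_gaussian0 (d : measure_display) (Omega : measurableType d)
  (P : probability Omega R) (k : nat) (Sigma : 'M[R]_k) (X : Omega -> 'cV[R]_k) : Prop :=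
  rmeasurable (@vec_borel k) X /\
  forall u : 'cV[R]_k,
    let s2 := vdot u (Sigma *m u) in
    (s2 = 0 -> P [set w | vdot u (X w) = 0] = 1%E) /\
    (0 < s2 -> forall t : R,
       P [set w | vdot u (X w) <= t] =
       (\int[lebesgue_measure]_(s in `]-oo, t]) (normal_pdf 0 (Num.sqrt s2) s)%:E)%E).

Definition is_spherical (d : measure_display) (Omega : measurableType d)
  (P : probability Omega R) (k : nat) (f : R -> R) (E : Omega -> 'cV[R]_k) : Prop :=
  rmeasurable (@vec_borel k) E /\
  forall u : 'cV[R]_k, u != 0 -> forall t : R,
    P [set w | vdot u (E w) <= t * vnorm u] =
    (\int[lebesgue_measure]_(s in `]-oo, t]) (f s)%:E)%E.

Definition is_density (f : R -> R) : Prop :=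
  measurable_fun setT f /\ (forall x, 0 <= f x) /\
  (\int[lebesgue_measure]_x (f x)%:E = 1)%E.

Definition emp_depth (p m n : nat) (Z : 'I_n -> obs p m) (B : 'M[R]_(p, m)) : R :=
  inf [set (#|[set i : 'I_n | 0 <= vdot (U^T *m (Z i).1) ((Z i).2 - B^T *m (Z i).1)]|%:R
            / n%:R)
      | U in [set U : 'M[R]_(p, m) | U != 0]].

Definition is_depth_maximizer (p m n : nat) (Z : 'I_n -> obs p m) (Bh : 'M[R]_(p, m)) : Prop :=
  forall B' : 'M[R]_(p, m), emp_depth Z B' <= emp_depth Z Bh.

End Defs.

(* Main.v *)
Require Import Defs.
From HB Require Import structures.
From mathcomp Require Import all_boot all_order all_algebra.
From mathcomp Require Import all_classical all_reals all_analysis.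
From mathcomp Require Import measurable_realfun ring lra zify.
Import Order.TTheory GRing.Theory Num.Theory.
Import numFieldNormedType.Exports.

(* Fix B' with D = B' - B and tau^2 = tr (D^T Sigma D), and write v = D^T x and xi = y - B^T x.
   In the direction U = D an observation counts for B' iff |v|^2 <= <v, xi>, so the depth of B'
   is small as soon as P (<v, xi> < |v|^2) exceeds 1/2 by a multiple of the deviation
   eps + sqrt (p m / n). Conditionally on x, <v, xi> has a spherical marginal, whose density
   near 0 turns a typical |v| >= tau / 4 into a gain proportional to tau / sigma.

   The event <v, xi> < |v|^2 is quadratic in D. It is linearized by
   |v|^2 >= 2 <v, w> - |w|^2, where w = tau D0^T x and D0 is taken from a finite net of
   tr (D^T Sigma D) = 1 of cardinality exp (O(p m)): for D0 fixed, the events are half-spaces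
   in O(p m) features. Uniform deviation over these at the rate sqrt (p m / n), with no
   logarithm, comes from a ghost sample, random signs, and chaining with Dudley's packing
   bound; it is applied to rational parameters first, hence < 0 in the population and <= 0 in
   the sample. *)

Set Implicit Arguments. Unset Strict Implicit. Unset Printing Implicit Defensive.
Local Open Scope ring_scope.

(** * Vapnik-Chervonenkis bounds for half-spaces *)

(** The net is there because |D^T x|^2 is linear only in D D^T, that is in order p^2 unknowns, too
    many when m is small against p. The tangent plane at a fixed D0 is linear in D itself, and a net
    of constant relative precision is enough: an error of a small fraction of tau costs only a
    constant factor in the gain. Where the approximation is poor at x, the linearized event may have
    conditional probability below 1/2. It is therefore joined to <v, xi> < r for a small r > 0,
    which restores 1/2 at every x; this is why unions of two half-spaces appear throughout. In
    exchange an observation contradicts depth only if |v|^2 >= r, so a third event is counted, again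
    a union of two half-spaces: |u^T x| > r1 for a column u of D. The levels r and r1 may depend on
    B' and on the sample, since the deviation bound is uniform in all parameters. Contamination
    enters only through the lower bound (1 - eps) a >= a - eps for a probability a. *)

Lemma expR_le_quad (R : realType) (x : R) : x <= 2^-1 -> expR x <= 1 + x + 2 * x ^+ 2.
Proof.
move=> hx; have h1 : 0 < 1 - x by lra.
have h2 : expR x <= (1 - x)^-1.
  rewrite -[x in leLHS]opprK expRN lef_pV2 ?posrE ?expR_gt0//.
  by have := expR_ge1Dx (- x).
apply: (le_trans h2); rewrite -div1r ler_pdivrMr//.
have : 0 <= x ^+ 2 * (1 - 2 * x) by apply: mulr_ge0; [exact: sqr_ge0|lra].
rewrite !expr2; nra.
Qed.

(** The sharp exponent is x^2 / 2; the constant 2 allows an elementary proof. For |x| <= 1/2 the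
    linear terms of the two quadratic bounds cancel, and beyond that |x| <= 2 x^2. *)
Lemma cosh_le_expR (R : realType) (x : R) :
  (expR x + expR (- x)) / 2 <= expR (2 * x ^+ 2).
Proof.
have [h|h] := lerP `|x| 2^-1.
  have hx : x <= 2^-1 by exact: le_trans (ler_norm _) h.
  have hnx : - x <= 2^-1 by apply: le_trans h; rewrite -normrN ler_norm.
  apply: le_trans (expR_ge1Dx _).
  have := expR_le_quad hx; have := expR_le_quad hnx; rewrite sqrrN; lra.
have h2 : `|x| <= 2 * x ^+ 2.
  by rewrite -[x ^+ 2]real_normK ?num_real//; rewrite expr2; nra.
have a : expR x <= expR (2 * x ^+ 2).
  by rewrite ler_expR; apply: le_trans h2; rewrite ler_norm.
have b : expR (- x) <= expR (2 * x ^+ 2).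
  by rewrite ler_expR; apply: le_trans h2; rewrite -normrN ler_norm.
lra.
Qed.

Section Shattering.
Variable T : finType.
Implicit Types (F : {set {set T}}) (S A B : {set T}).

Definition shatters F S :=
  [forall A : {set T}, (A \subset S) ==> [exists B in F, B :&: S == A]].

Lemma shattersP F S :
  reflect (forall A, A \subset S -> exists2 B, B \in F & B :&: S = A) (shatters F S).
Proof.
apply: (iffP forallP) => [h A hA|h A].
  have /implyP/(_ hA)/existsP[B /andP[BF /eqP e]] := h A.
  by exists B.
apply/implyP => hA; have [B BF e] := h A hA.
by apply/existsP; exists B; rewrite BF e eqxx.
Qed.

Lemma shattersS F F' S : F \subset F' -> shatters F S -> shatters F' S.
Proof.
move=> FF' /shattersP h; apply/shattersP => A /h[B BF e].
by exists B => //; exact: (fintype.subsetP FF').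
Qed.

(* Pajor's strengthening of the Sauer-Shelah lemma. *)
Lemma card_le_shattered F : (#|F| <= #|[set S | shatters F S]|)%N.
Proof.
have [n] := ubnP #|F|; elim: n F => // n IH F /ltnSE hF.
have [F1|F2] := leqP #|F| 1.
  have [->|[B BF]] := set_0Vmem F; first by rewrite cards0.
  apply: (leq_trans F1); apply/card_gt0P; exists finset.set0; rewrite inE.
  apply/shattersP => A; rewrite finset.subset0 => /eqP ->; exists B => //.
  by rewrite finset.setI0.
have [x [[B0 B0F xB0] [B1 B1F xB1]]] :
    exists x, (exists2 B0, B0 \in F & x \notin B0) /\ (exists2 B1, B1 \in F & x \in B1).
  have /card_gt1P[A [B [AF BF AB]]] := F2.
  have [AsB|/subsetPn[x xA xB]] := boolP (A \subset B); last first.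
    by exists x; split; [exists B|exists A].
  have [BsA|/subsetPn[x xB xA]] := boolP (B \subset A); last first.
    by exists x; split; [exists A|exists B].
  by rewrite finset.eqEsubset AsB BsA in AB.
pose F0 := [set B in F | x \notin B]; pose F1 := [set B in F | x \in B].
have sF0 : F0 \subset F by apply/fintype.subsetP => B; rewrite inE => /andP[].
have sF1 : F1 \subset F by apply/fintype.subsetP => B; rewrite inE => /andP[].
have cF : (#|F0| + #|F1| = #|F|)%N.
  rewrite addnC -(cardsID [set B : {set T} | x \in B] F); congr (_ + _)%N;
  by apply: eq_card => B; rewrite !inE// andbC.
have c0 : (0 < #|F0|)%N by apply/card_gt0P; exists B0; rewrite inE B0F.
have c1 : (0 < #|F1|)%N by apply/card_gt0P; exists B1; rewrite inE B1F.
pose s0 := [set S | shatters F0 S]; pose s1 := [set S | shatters F1 S].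
have i0 : (#|F0| <= #|s0|)%N by apply: IH; lia.
have i1 : (#|F1| <= #|s1|)%N by apply: IH; lia.
rewrite -cF; apply: (leq_trans (leq_add i0 i1)).
have x0 S : S \in s0 -> x \notin S.
  rewrite inE => /shattersP h; apply/negP => xS.
  have [|B] := h [set x]; first by rewrite finset.sub1set.
  rewrite inE => /andP[_ xB] /setP/(_ x); rewrite !inE eqxx.
  by rewrite (negbTE xB).
have x1 S : S \in s1 -> x \notin S.
  rewrite inE => /shattersP h; apply/negP => xS.
  have [|B] := h finset.set0; first by rewrite finset.sub0set.
  by rewrite inE => /andP[_ xB] /setP/(_ x); rewrite !inE xS xB.
(* A set [S] shattered by both halves is counted twice. The second count is charged to [x |: S],
   which [F] shatters and which, containing [x], differs from every member of [s0] and [s1]. *)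
rewrite -cardsUI -(@card_in_imset _ _ (fun S => x |: S) (s0 :&: s1)); last first.
  move=> S S'; rewrite !inE => /andP[h _] /andP[h' _] e.
  have xS : x \notin S by apply: x0; rewrite inE.
  have xS' : x \notin S' by apply: x0; rewrite inE.
  by rewrite -(setU1K xS) e setU1K.
rewrite -(cardsID [set S : {set T} | x \in S] [set S | shatters F S]) addnC.
apply: leq_add; apply: subset_leq_card; apply/fintype.subsetP => S.
  move=> /imsetP[S' S's ->]; move: S's; rewrite !inE => /andP[h0 h1].
  have xS' : x \notin S' by apply: x0; rewrite inE.
  rewrite eqxx andbT; apply/shattersP => A hA.
  have hA' : A :\ x \subset S' by rewrite finset.subDset.
  have [xA|xA] := boolP (x \in A).
    have [B BF e] := shattersP _ _ h1 _ hA'.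
    exists B; first exact: (fintype.subsetP sF1).
    apply/setP => y; have /setP/(_ y) := e; rewrite !inE.
    move: BF; rewrite inE => /andP[_ xB].
    have [->|yx] := eqVneq y x; first by rewrite xA xB.
    by rewrite orFb.
  have [B BF e] := shattersP _ _ h0 _ hA'.
  exists B; first exact: (fintype.subsetP sF0).
  apply/setP => y; have /setP/(_ y) := e; rewrite !inE.
  move: BF; rewrite inE => /andP[_ xB].
  have [->|yx] := eqVneq y x; first by rewrite (negbTE xA) (negbTE xB).
  by rewrite orFb.
rewrite inE => /orP[] hS; rewrite !inE.
  by rewrite (x0 _ hS) (shattersS sF0)//; rewrite inE in hS.
by rewrite (x1 _ hS) (shattersS sF1)//; rewrite inE in hS.
Qed.

(* Compare each S with #|S| <= d to the weight x ^ (#|S| - d) at x = d / (#|T| + d). *)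
Lemma card_small_sets (R : realType) (d : nat) : (0 < d)%N ->
  #|[set S : {set T} | (#|S| <= d)%N]|%:R
    <= (expR 1 * (1 + #|T|%:R / d%:R)) ^+ d :> R.
Proof.
move=> d0; set n := #|T|.
have dR : 0 < d%:R :> R by rewrite ltr0n.
have nR : 0 <= n%:R :> R by [].
pose x : R := d%:R / (n%:R + d%:R).
have x0 : 0 < x by rewrite divr_gt0// ltr_wpDl.
have x1 : x <= 1 by rewrite ler_pdivrMr ?mul1r ?ltr_wpDl// lerDr.
have e1 : \sum_(S : {set T}) x ^+ #|S| = (1 + x) ^+ n.
  transitivity (\prod_(i : T) (x + 1)); last by rewrite prodr_const addrC.
  rewrite bigA_distr; apply: eq_bigr => S _.
  by rewrite (bigID (fun i => i \in S))/= [X in _ * X]big1 => [|i /negbTE->//];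
     rewrite mulr1 (eq_bigr (fun=> x)) => [|i ->//]; rewrite prodr_const.
have e2 : #|[set S : {set T} | (#|S| <= d)%N]|%:R * x ^+ d <= (1 + x) ^+ n.
  rewrite -e1 (bigID (fun S : {set T} => (#|S| <= d)%N))/=.
  apply: ler_wpDr; first by apply: sumr_ge0 => S _; exact: exprn_ge0 (ltW _).
  rewrite mulr_natl -sumr_const [leLHS](eq_bigl (fun S : {set T} => (#|S| <= d)%N)); last first.
    by move=> S; rewrite inE.
  by apply: ler_sum => S hS; rewrite ler_wiXn2l// ltW.
have e3 : (1 + x) ^+ n <= expR 1 ^+ d.
  apply: (@le_trans _ _ (expR x ^+ n)).
    by rewrite lerXn2r ?nnegrE ?expR_ge0 ?expR_ge1Dx// ltW// ltr_wpDl.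
  rewrite -!expRM_natl ler_expR mulr1 mulrA ler_pdivrMr ?ltr_wpDl//.
  by rewrite mulrC ler_wpM2l// lerDl.
have xE : 1 + n%:R / d%:R = x^-1 :> R by rewrite invf_div mulrDl divff ?gt_eqF// addrC.
rewrite xE exprMn exprVn ler_pdivlMr ?exprn_gt0//.
exact: le_trans e2 e3.
Qed.
End Shattering.

(** More than [d] points satisfy a linear relation with some positive coefficient. A half-space
    cutting out exactly the points with coefficient <= 0 would make every term of the relation,
    paired with its normal, nonnegative and one of them positive, although the sum is 0. *)
Lemma halfspaces_shatter (R : realType) (T K : finType) (d : nat)
    (z : T -> 'cV[R]_d) (th : K -> 'cV[R]_d) (S : {set T}) :
  shatters [set [set i | vdot (th k) (z i) <= 0] | k : K] S -> (#|S| <= d)%N.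
Proof.
move=> /shattersP sh; rewrite leqNgt; apply/negP => dS.
pose A : 'M[R]_(#|S|, d) := \matrix_(l, j) z (enum_val l) j 0.
have [c cA [l cl]] : exists2 c : 'rV[R]_#|S|, c *m A = 0 & exists l, 0 < c 0 l.
  have /rowV0Pn[c /sub_kermxP cA c0] : kermx A != 0.
    rewrite -mxrank_eq0 mxrank_ker subn_eq0 -ltnNge.
    exact: leq_ltn_trans (rank_leq_col A) dS.
  have /rV0Pn[l cl] := c0.
  have [cl0|cl0] := ltP 0 (c 0 l); first by exists c => //; exists l.
  exists (- c); first by rewrite mulNmx cA oppr0.
  by exists l; rewrite mxE oppr_gt0 lt_neqAle cl.
pose A' := [set i in S | [exists l, (enum_val l == i) && (c 0 l <= 0)]].
have [|_ /imsetP[k _ ->] e] := sh A'; first by apply/fintype.subsetP => i; rewrite inE => /andP[].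
have key l' : (vdot (th k) (z (enum_val l')) <= 0) = (c 0 l' <= 0).
  have /setP/(_ (enum_val l')) := e; rewrite !inE enum_valP andbT /= => ->.
  apply/existsP/idP => [[l2 /andP[/eqP/enum_val_inj ->]]//|h].
  by exists l'; rewrite eqxx.
have s0 : \sum_l' c 0 l' * vdot (th k) (z (enum_val l')) = 0.
  transitivity (\sum_j (c *m A) 0 j * th k j 0).
    rewrite /vdot; under eq_bigr do rewrite mulr_sumr.
    rewrite exchange_big/=; apply: eq_bigr => j _.
    rewrite mxE mulr_suml; apply: eq_bigr => l' _; rewrite mxE; ring.
  by rewrite cA; apply: big1 => j _; rewrite mxE mul0r.
have : 0 < \sum_l' c 0 l' * vdot (th k) (z (enum_val l')).
  rewrite (bigD1 l)//= ltr_pwDl//.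
    by rewrite mulr_gt0// ltNge key -ltNge.
  apply: sumr_ge0 => l' _; have := key l'.
  have [h1|h1] := leP (c 0 l') 0 => h2; first by rewrite mulr_le0// h2.
  by rewrite mulr_ge0 ?(ltW h1)// ltW// ltNge h2.
by rewrite s0 ltxx.
Qed.

Lemma card_halfspace_traces (R : realType) (T K : finType) (d : nat)
    (z : T -> 'cV[R]_d) (th : K -> 'cV[R]_d) : (0 < d)%N ->
  #|[set [set i | vdot (th k) (z i) <= 0] | k : K]|%:R
    <= (expR 1 * (1 + #|T|%:R / d%:R)) ^+ d :> R.
Proof.
move=> d0; apply: le_trans (card_small_sets T R d0); rewrite ler_nat.
apply: (leq_trans (card_le_shattered _)); apply: subset_leq_card.
by apply/fintype.subsetP => S; rewrite !inE => /halfspaces_shatter.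
Qed.

(** The pair of traces determines the trace of the union, so the two counts multiply; hence the
    exponent [2 * d] in all later growth bounds. *)
Lemma card_halfspace_union_traces (R : realType) (T K : finType) (d : nat)
    (z : T -> 'cV[R]_d) (th th' : K -> 'cV[R]_d) : (0 < d)%N ->
  #|[set [set i | (vdot (th k) (z i) <= 0) || (vdot (th' k) (z i) <= 0)] | k : K]|%:R
    <= (expR 1 * (1 + #|T|%:R / d%:R)) ^+ (2 * d) :> R.
Proof.
move=> d0; set B := _ ^+ _.
pose F (t : K -> 'cV[R]_d) := [set [set i | vdot (t k) (z i) <= 0] | k : K].
apply: (@le_trans _ _ (#|F th| * #|F th'|)%:R).
  rewrite ler_nat -cardsX.
  apply: leq_trans (leq_imset_card (fun u => u.1 :|: u.2) _).
  apply: subset_leq_card; apply/fintype.subsetP => S /imsetP[k _ ->].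
  apply/imsetP; exists ([set i | vdot (th k) (z i) <= 0], [set i | vdot (th' k) (z i) <= 0]).
    by rewrite !inE; apply/andP; split; apply/imsetP; exists k.
  by apply/setP => i; rewrite !inE.
rewrite natrM /B mul2n -addnn exprD.
by apply: ler_pM => //; exact: card_halfspace_traces.
Qed.

Section Packing.
Variables (R : realType) (T : finType) (d : nat).
Hypothesis d_gt0 : (0 < d)%N.

(** Points are taken along a sequence, repetitions allowed, because [packing_bound] draws them
    independently. *)
Definition growth_bounded (V : {set {set T}}) :=
  forall q (g : 'I_q -> T),
    #|(fun v : {set T} => g @^-1: v) @: V|%:R <= (expR 1 * (1 + q%:R / d%:R)) ^+ (2 * d) :> R.

Definition sdiff (A B : {set T}) := (A :\: B) :|: (B :\: A).

(* Dudley's argument: a few random points of T separate all members of W. *)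
Lemma packing_bound (W : {set {set T}}) (j : nat) : (0 < #|T|)%N ->
  growth_bounded W ->
  (forall v w, v \in W -> w \in W -> v != w -> (#|T| < 4 ^ j * #|sdiff v w|)%N) ->
  #|W|%:R <= expR (d%:R * (17 + 12 * j%:R)) :> R.
Proof.
move=> T0 gW sep.
have [W1|W1] := leqP #|W| 1.
  apply: (@le_trans _ _ 1); first by rewrite -[leRHS]/(1%:R) ler_nat.
  by rewrite -expR0 ler_expR mulr_ge0// addr_ge0// mulr_ge0.
have dR : 0 < d%:R :> R by rewrite ltr0n.
have WR : 1 < #|W|%:R :> R by rewrite ltr1n.
set x : R := 4 ^+ j.
have x1 : 1 <= x by rewrite exprn_ege1// ler1n.
have x0 : 0 < x by apply: lt_le_trans x1.
pose l := ln (#|W|%:R : R).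
have WE : #|W|%:R = expR l.
  by apply/esym/lnK; rewrite posrE; exact: lt_trans ltr01 WR.
have l0 : 0 < l by rewrite ln_gt0.
(* A random sequence of [q] points misses a given symmetric difference with probability at most exp
   (- q / x). With q > 2 x l this beats the number exp (2 l) of pairs, so some sequence separates
   all of [W]. *)
pose q := (Num.truncn (2 * x * l)).+1.
have q1 : 2 * x * l < q%:R by rewrite truncnS_gt.
have q2 : q%:R <= 2 * x * l + 1.
  by rewrite /q -natr1 lerD2r truncn_le// mulr_ge0 ?(ltW l0)// mulr_ge0// ltW.
have n0 : 0 < #|T|%:R :> R by rewrite ltr0n.
have [g gi] : exists g : {ffun 'I_q -> T}, {in W &, injective (fun v : {set T} => g @^-1: v)}.
  apply: contrapT => /forallNP H.
  pose bad (g : {ffun 'I_q -> T}) (u : {set T} * {set T}) := [forall i, g i \notin sdiff u.1 u.2].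
  pose Pr := [pred u : {set T} * {set T} | [&& u.1 \in W, u.2 \in W & u.1 != u.2]].
  have h1 : (#|{: {ffun 'I_q -> T}}|%:R : R) <= \sum_(u | Pr u) \sum_g (bad g u)%:R.
    rewrite exchange_big/= -sum1_card natr_sum; apply: ler_sum => g _.
    have [u Pu gu] : exists2 u, Pr u & bad g u.
      apply: contrapT => /forall2NP Hg; apply: (H g) => v w vW wW e.
      have [//|vw] := eqVneq v w; have [h|h] := Hg (v, w); case: h.
        by rewrite /Pr inE /= vW wW vw.
      apply/forallP => i; have /setP/(_ i) := e; rewrite !inE /= => ->.
      by case: (g i \in w).
    rewrite (bigD1 u)//= gu lerDl; apply: sumr_ge0 => u' _; exact: ler0n.
  have h2 u : Pr u -> \sum_g (bad g u)%:R <= (#|T|%:R * expR (- x^-1)) ^+ q :> R.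
    move=> /and3P[u1 u2 u12].
    set D := sdiff u.1 u.2.
    have -> : \sum_g (bad g u)%:R = (\sum_(t : T) (t \notin D)%:R) ^+ q :> R.
      have -> (X : R) : X ^+ q = \prod_(i < q) X by rewrite prodr_const card_ord.
      rewrite bigA_distr_bigA/=.
      apply: eq_bigr => g _; rewrite /bad -/D.
      have [/forallP h|/forallPn[i hi]] := boolP [forall i, g i \notin D].
        by rewrite big1// => i _; rewrite h.
      by rewrite (bigD1 i)//= (negbTE hi) mul0r.
    have -> : \sum_(t : T) (t \notin D)%:R = #|T|%:R - #|D|%:R :> R.
      have -> : #|T| = (#|D| + #|~: D|)%N by rewrite cardsC.
      rewrite natrD addrAC subrr add0r.
      transitivity (\sum_(t in ~: D) (1 : R)); last by rewrite sumr_const.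
      by rewrite [RHS]big_mkcond/=; apply: eq_bigr => t _; rewrite finset.in_setC; case: (t \in D).
    have Dx : #|T|%:R * x^-1 <= #|D|%:R.
      rewrite ler_pdivrMr// mulrC /x -natrX -natrM ler_nat ltnW//.
      exact: sep.
    rewrite lerXn2r ?nnegrE//.
    - by rewrite subr_ge0 ler_nat max_card.
    - apply: (@le_trans _ _ (#|T|%:R * (1 - x^-1))); first by rewrite mulrBr mulr1 lerB.
      by rewrite ler_wpM2l// expR_ge1Dx.
  have h3 : \sum_(u | Pr u) \sum_g (bad g u)%:R <= #|W|%:R ^+ 2 * (#|T|%:R * expR (- x^-1)) ^+ q :> R.
    apply: (le_trans (ler_sum _ h2)); rewrite sumr_const -[leLHS]mulr_natl.
    rewrite ler_wpM2r ?exprn_ge0 ?mulr_ge0 ?expR_ge0//.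
    rewrite -natrX ler_nat -mulnn -cardsX; apply: subset_leq_card.
    by apply/fintype.subsetP => u; rewrite !inE => /and3P[-> ->].
  have h4 := le_trans h1 h3; rewrite card_ffun card_ord natrX exprMn mulrCA in h4.
  have {h4} : 1 <= #|W|%:R ^+ 2 * expR (- x^-1) ^+ q by rewrite -(ler_pMr _ (exprn_gt0 q n0)).
  rewrite WE.
  rewrite -!expRM_natl -expRD -[X in X <= _]expR0 ler_expR leNgt => /negP; apply.
  rewrite mulrN subr_lt0 ltr_pdivlMr// mulrAC; exact: q1.
have cW : #|W|%:R <= (expR 1 * (1 + q%:R / d%:R)) ^+ (2 * d) :> R.
  by rewrite -(card_in_imset gi); exact: gW.
pose L := l / d%:R.
have L0 : 0 < L by rewrite divr_gt0.
have lnle (y : R) : 0 < y -> ln y <= y - 1.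
  by move=> y0; have := expR_ge1Dx (ln y); rewrite lnK ?posrE//; lra.
have y0 : 0 < 1 + q%:R / d%:R :> R by rewrite ltr_pwDl// divr_ge0.
have hL : L <= 2 * (1 + ln (1 + q%:R / d%:R)).
  rewrite ler_pdivrMr//.
  have -> : 2 * (1 + ln (1 + q%:R / d%:R)) * d%:R = ln ((expR 1 * (1 + q%:R / d%:R)) ^+ (2 * d)) :> R.
    rewrite lnXn ?mulr_gt0 ?expR_gt0// lnM ?posrE ?expR_gt0// expRK -[RHS]mulr_natr natrM; ring.
  by rewrite ler_ln ?posrE ?exprn_gt0 ?mulr_gt0 ?expR_gt0//; lra.
have hq : 1 + q%:R / d%:R <= 2 * x * (1 + L).
  have : q%:R / d%:R <= 2 * x * L + 1.
    have lE : L * d%:R = l by rewrite /L divfK ?gt_eqF.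
    have d1 : 1 <= d%:R :> R by rewrite ler1n.
    by rewrite ler_pdivrMr//; move: q2; rewrite -lE; nra.
  move: x1 L0; nra.
have hx : ln (2 * x * (1 + L)) <= 1 + 3 * j%:R + ((1 + L) / 4 + 2).
  have L1 : 0 < 1 + L by lra.
  rewrite !lnM ?posrE ?mulr_gt0// lnXn// -[ln 4 *+ j]mulr_natr.
  have h2 : ln 2 <= 2 - 1 :> R by exact: lnle.
  have h4 : ln 4 <= 4 - 1 :> R by exact: lnle.
  have : ln (1 + L) <= (1 + L) / 4 - 1 + ln 4.
    rewrite -[X in ln X <= _](@divfK _ (4 : R))// lnM ?posrE ?divr_gt0//.
    by rewrite lerD2r lnle// divr_gt0.
  have : ln 4 * j%:R <= 3 * j%:R :> R by rewrite ler_wpM2r//; lra.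
  lra.
have hl : ln (1 + q%:R / d%:R) <= ln (2 * x * (1 + L)).
  by rewrite ler_ln ?posrE// (lt_le_trans y0).
have hf : L <= 17 + 12 * j%:R by lra.
rewrite WE.
by rewrite ler_expR mulrC -ler_pdivrMr.
Qed.
End Packing.

(** * Chaining and symmetrization *)

Section Chaining.
Variables (R : realType) (T : finType).

Definition rademacher_sum (e : {ffun T -> bool}) (y : T -> R) : R :=
  \sum_i (-1) ^+ e i * y i.

Lemma rademacher_tail (y : T -> R) (h lam : R) : 0 < h -> 0 <= lam ->
  \sum_i y i ^+ 2 <= h ->
  #|[set e | lam < rademacher_sum e y]|%:R
    <= 2 ^+ #|T| * expR (- (lam ^+ 2 / (8 * h))) :> R.
Proof.
(* The minimizer of the Chernoff exponent 2 t^2 h - t lam. *)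
move=> h0 lam0 yh; pose t := lam / (4 * h).
have t0 : 0 <= t by rewrite divr_ge0// mulr_ge0// ltW.
apply: (@le_trans _ _ (\sum_e expR (t * (rademacher_sum e y - lam)))).
  rewrite -sum1_card natr_sum big_mkcond/=; apply: ler_sum => e _.
  rewrite inE; case: ifP => [h1|_]; last exact: expR_ge0.
  by rewrite -[leLHS]/(1 : R) -expR0 ler_expR mulr_ge0// subr_ge0 ltW.
have -> : \sum_e expR (t * (rademacher_sum e y - lam)) =
    expR (- (t * lam)) * \prod_i (expR (t * y i) + expR (- (t * y i))).
  under [in RHS]eq_bigr => i _.
    have -> : expR (t * y i) + expR (- (t * y i)) = \sum_(b : bool) expR (t * ((-1) ^+ b * y i)).
      by rewrite big_bool/= expr1 expr0 !mulN1r mul1r mulrN addrC.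
    over.
  rewrite bigA_distr_bigA/= mulr_sumr; apply: eq_bigr => e _.
  rewrite mulrBr expRD mulrC; congr (_ * _).
  by rewrite -expR_sum mulr_sumr.
apply: (@le_trans _ _ (expR (- (t * lam)) * \prod_i (2 * expR (2 * (t * y i) ^+ 2)))).
  rewrite ler_wpM2l ?expR_ge0//; apply: ler_prod => i _.
  rewrite addr_ge0 ?expR_ge0//=.
  by have := cosh_le_expR (t * y i); lra.
rewrite big_split/= prodr_const mulrCA ler_wpM2l ?exprn_ge0//.
rewrite -expR_sum -expRD ler_expR.
under eq_bigr do rewrite exprMn.
rewrite -!mulr_sumr.
have -> : lam ^+ 2 / (8 * h) = t * lam - 2 * (t ^+ 2 * h).
  rewrite /t; field; exact: lt0r_neq0.
have : 2 * (t ^+ 2 * (\sum_i y i ^+ 2)) <= 2 * (t ^+ 2 * h).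
  by rewrite ler_pM2l// ler_wpM2l// sqr_ge0.
rewrite mulrCA; lra.
Qed.

Definition separated (k : nat) (W : {set {set T}}) :=
  [forall v in W, forall w in W, (v != w) ==> (#|T| < k * #|sdiff v w|)%N].

Lemma separatedP k (W : {set {set T}}) : reflect
  (forall v w, v \in W -> w \in W -> v != w -> (#|T| < k * #|sdiff v w|)%N)
  (separated k W).
Proof.
apply: (iffP forallP) => [h v w vW wW vw|h v].
  have /implyP/(_ vW)/forallP/(_ w)/implyP/(_ wW)/implyP/(_ vw) := h v.
  by [].
apply/implyP => vW; apply/forallP => w; apply/implyP => wW; apply/implyP.
exact: h.
Qed.

Lemma sdiffC (v w : {set T}) : sdiff v w = sdiff w v.
Proof. exact: finset.setUC. Qed.

(** A maximal separated subfamily is a net: a member of [V] far from all of it could be added. *)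
Lemma separated_net (k : nat) (V : {set {set T}}) :
  exists W : {set {set T}}, [/\ W \subset V, separated k W &
    forall v, v \in V -> exists2 w, w \in W & (k * #|sdiff v w| <= #|T|)%N].
Proof.
pose P (W : {set {set T}}) := (W \subset V) && separated k W.
have [|W /maxsetP[/andP[WV sW] mW]] := @ex_maxset _ P.
  exists finset.set0; rewrite /P finset.sub0set; apply/separatedP => v w.
  by rewrite inE.
exists W; split => // v vV; apply: contrapT => /forall2NP H.
have far w : w \in W -> (#|T| < k * #|sdiff v w|)%N.
  by move=> wW; have [//|/negP] := H w; rewrite -ltnNge.
have vW : v \notin W.
  apply/negP => /far; rewrite /sdiff finset.setDv finset.setU0 cards0.
  by rewrite muln0.
have /mW : P (v |: W).
  apply/andP; split; first by rewrite finset.subUset finset.sub1set vV WV.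
  apply/separatedP => x y; rewrite !inE => /orP[/eqP->|xW] /orP[/eqP->|yW].
  - by rewrite eqxx.
  - by move=> _; exact: far.
  - by move=> _; rewrite sdiffC; exact: far.
  - exact: (separatedP _ _ sW).
move=> /(_ (finset.subsetUr _ _)) e.
by rewrite -e setU11 in vW.
Qed.

Lemma growth_boundedS (d : nat) (W V : {set {set T}}) :
  W \subset V -> growth_bounded R d V -> growth_bounded R d W.
Proof.
move=> WV gV q g; apply: le_trans (gV q g).
by rewrite ler_nat; apply/subset_leq_card/imsetS.
Qed.

Definition ind (v : {set T}) (i : T) : R := (i \in v)%:R.

Lemma sum_ind_sdiff (v w : {set T}) :
  \sum_i (ind v i - ind w i) ^+ 2 = #|sdiff v w|%:R.
Proof.
rewrite -sum1_card natr_sum [RHS]big_mkcond/=; apply: eq_bigr => i _.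
rewrite /ind !inE; case: (i \in v); case: (i \in w) => /=;
  by rewrite ?subrr ?subr0 ?sub0r ?sqrrN ?expr1n ?expr0n.
Qed.

(* Union bound over nets at scales #|T| / 4 ^ j, at level j the increments
   having (j + 1) / 2 ^ j of the total budget. *)
Lemma rademacher_sup (d : nat) (V : {set {set T}}) (Q s : R) :
  (0 < #|T|)%N -> (0 < d)%N -> growth_bounded R d V -> 1 <= s -> 0 <= Q ->
  544 * #|T|%:R * (d%:R + s) <= Q ^+ 2 ->
  #|[set e | [exists v in V, 4 * Q < rademacher_sum e (ind v)]]|%:R
    <= 2 * expR (- s) * 2 ^+ #|T| :> R.
Proof.
move=> T0 d0 gV s1 Q0 hQ.
have n0 : 0 < #|T|%:R :> R by rewrite ltr0n.
pose W j := projT1 (cid (separated_net (4 ^ j) V)).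
have WV j : W j \subset V by rewrite /W; case: cid => ? [].
have sW j : separated (4 ^ j) (W j) by rewrite /W; case: cid => ? [].
have cW j v : v \in V -> exists2 w, w \in W j & (4 ^ j * #|sdiff v w| <= #|T|)%N.
  by rewrite /W; case: cid => ? [_ _] /=; exact.
have es : expR (- s) <= 2^-1.
  rewrite expRN lef_pV2 ?posrE ?expR_gt0//.
  by have := expR_ge1Dx s; lra.
(* Closed form of [Q] for the coarsest level plus the increments [(i + 1) / 2 ^ i * Q] for 1 <= i <=
   j; it increases to [4 * Q]. *)
pose th j : R := Q * (4 - j.+3%:R / 2 ^+ j).
have claim j : #|[set e | [exists w in W j, th j < rademacher_sum e (ind w)]]|%:R
    <= (2 - (2 ^+ j)^-1) * expR (- s) * 2 ^+ #|T| :> R.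
  elim: j => [|j IH].
    have [->|[w wW]] := set_0Vmem (W 0).
      rewrite (_ : [set _ | _] = finset.set0) ?cards0.
        by rewrite !mulr_ge0 ?expR_ge0 ?exprn_ge0// expr0; lra.
      by apply/setP => e; rewrite !inE; apply/existsP => -[v /andP[]]; rewrite inE.
    (* At scale [#|T|] the net has at most one member, since no symmetric difference has more than
       [#|T|] elements. *)
    have W1 v : v \in W 0 -> v = w.
      move=> vW; apply/eqP; apply/negPn/negP => vw.
      have := separatedP _ _ (sW 0) _ _ vW wW vw.
      by rewrite expn0 mul1n ltnNge max_card.
    apply: (@le_trans _ _ (2 ^+ #|T| * expR (- (Q ^+ 2 / (8 * #|T|%:R))))).
      apply: le_trans (rademacher_tail n0 Q0 (_ : \sum_i (ind w i) ^+ 2 <= _)).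
        rewrite ler_nat; apply: subset_leq_card; apply/fintype.subsetP => e.
        rewrite !inE => /existsP[v /andP[/W1 ->]]; rewrite /th expr0.
        by rewrite divr1; have -> : Q * (4 - 3) = Q by lra.
      rewrite -sum1_card natr_sum; apply: ler_sum => i _; rewrite /ind.
      by case: (i \in w); rewrite ?expr1n ?expr0n.
    rewrite mulrC ler_wpM2r ?exprn_ge0// expr0 invr1.
    have -> : 2 - 1 = 1 :> R by lra.
    rewrite mul1r ler_expR lerN2 ler_pdivlMr ?mulr_gt0//.
    apply: le_trans hQ; have : 0 <= #|T|%:R * d%:R :> R by rewrite mulr_ge0.
    have : 0 <= #|T|%:R * s :> R by rewrite mulr_ge0//; lra.
    nra.
  have h0 : 0 < #|T|%:R / 4 ^+ j :> R by rewrite divr_gt0 ?exprn_gt0.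
  pose lam := j.+2%:R / 2 ^+ j.+1 * Q.
  have lam0 : 0 <= lam by rewrite mulr_ge0// divr_ge0 ?exprn_ge0.
  have p2 : 0 < 2 ^+ j :> R by rewrite exprn_gt0.
  have thE : th j.+1 = th j + lam.
    rewrite /th /lam exprS -[j.+4%:R]natr1 -[j.+3%:R]natr1; field.
    exact: lt0r_neq0.
  (* The parent of [w] in the coarser net; by [piP] the default is never taken on [W j.+1]. *)
  pose pi w := if [pick u in W j | (4 ^ j * #|sdiff w u| <= #|T|)%N] is Some u then u else w.
  have piP w : w \in W j.+1 -> pi w \in W j /\ (4 ^ j * #|sdiff w (pi w)| <= #|T|)%N.
    move=> wW; rewrite /pi; case: pickP => [u /andP[]//|H].
    have [u uW hu] := cW j w (fintype.subsetP (WV _) _ wW).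
    by have := H u; rewrite uW hu.
  pose y w i := ind w i - ind (pi w) i.
  apply: (@le_trans _ _ (#|[set e | [exists w in W j, th j < rademacher_sum e (ind w)]]|%:R
      + \sum_(w in W j.+1) #|[set e | lam < rademacher_sum e (y w)]|%:R)).
    rewrite -natr_sum -natrD ler_nat.
    apply: (@leq_trans (#|[set e | [exists w in W j, th j < rademacher_sum e (ind w)]] :|: \bigcup_(w in W j.+1) [set e | lam < rademacher_sum e (y w)]|)).
      apply: subset_leq_card; apply/fintype.subsetP => e.
      rewrite !inE => /existsP[w /andP[wW hw]].
      have [h1|h1] := boolP (lam < rademacher_sum e (y w)).
        by apply/orP; right; apply/bigcupP; exists w => //; rewrite inE.
      apply/orP; left; apply/existsP; exists (pi w).
      have [-> _] := piP w wW; rewrite /=.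
      have e1 : rademacher_sum e (y w) = rademacher_sum e (ind w) - rademacher_sum e (ind (pi w)).
        by rewrite /rademacher_sum -sumrB; apply: eq_bigr => i _; rewrite mulrBr.
      by move: h1 hw; rewrite thE e1 -leNgt; lra.
    apply: (leq_trans (leq_card_setU _ _)); rewrite leq_add2l.
    apply: (big_ind2 (fun (A : {set {ffun T -> bool}}) k => #|A| <= k)%N) => [|A k B k' hA hB|//].
      by rewrite cards0.
    exact: leq_trans (leq_card_setU _ _) (leq_add hA hB).
  (* With 544 = 32 * 17 the tail exponent is at least 17 (j + 2)^2 (d + s), enough to pay for the
     logarithm d (17 + 12 (j + 1)) of the size of [W j.+1]. *)
  have step w : w \in W j.+1 -> #|[set e | lam < rademacher_sum e (y w)]|%:R
      <= 2 ^+ #|T| * expR (- (17 * j.+2%:R ^+ 2 * (d%:R + s))) :> R.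
    move=> wW; apply: le_trans (rademacher_tail h0 lam0 (_ : \sum_i (y w i) ^+ 2 <= _)) _.
      rewrite sum_ind_sdiff ler_pdivlMr ?exprn_gt0// -natrX -natrM ler_nat mulnC.
      by have [] := piP w wW.
    rewrite ler_wpM2l ?exprn_ge0// ler_expR lerN2.
    have -> : lam ^+ 2 / (8 * (#|T|%:R / 4 ^+ j)) = j.+2%:R ^+ 2 * Q ^+ 2 / (32 * #|T|%:R).
      have -> : 4 ^+ j = (2 ^+ j) ^+ 2 :> R by rewrite -exprM mulnC exprM; congr (_ ^+ _); ring.
      rewrite /lam [2 ^+ j.+1]exprS; field.
      by rewrite !lt0r_neq0.
    rewrite ler_pdivlMr ?mulr_gt0//.
    have := ler_wpM2l (sqr_ge0 (j.+2%:R : R)) hQ; lra.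
  apply: (le_trans (lerD IH (ler_sum _ step))).
  have cWj : \sum_(w in W j.+1) 2 ^+ #|T| * expR (- (17 * j.+2%:R ^+ 2 * (d%:R + s)))
      <= (2 ^+ j.+1)^-1 * expR (- s) * 2 ^+ #|T|.
    rewrite sumr_const -[leLHS]mulr_natl mulrCA mulrC ler_wpM2r ?exprn_ge0//.
    apply: (@le_trans _ _ (expR (d%:R * (17 + 12 * j.+1%:R)) *
        expR (- (17 * j.+2%:R ^+ 2 * (d%:R + s))))).
      rewrite ler_wpM2r ?expR_ge0//.
      exact: (packing_bound d0 T0 (growth_boundedS (WV _) gV) (separatedP _ _ (sW _))).
    (* One of the [j.+2] factors is kept as exp (- s); the others are at most 1/2 by [es] and make
       the levels summable. *)
    apply: (@le_trans _ _ (expR (- s) ^+ j.+2)).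
      rewrite -expRD -expRM_natl ler_expR mulrN lerNr opprD opprK.
      have dR : 1 <= d%:R :> R by rewrite ler1n.
      have jR : 0 <= j%:R :> R by [].
      rewrite -[j.+2%:R]natr1 -[j.+1%:R]natr1.
      set J := j%:R in jR *; set D := d%:R in dR *.
      have : 0 <= J * D by rewrite mulr_ge0//; lra.
      have : 0 <= J * s by rewrite mulr_ge0//; lra.
      have : 0 <= J ^+ 2 * (D + s) by rewrite mulr_ge0 ?sqr_ge0//; lra.
      by rewrite !expr2; nra.
    rewrite exprS mulrC ler_wpM2r ?expR_ge0// -exprVn.
    by rewrite lerXn2r ?nnegrE ?expR_ge0 ?invr_ge0.
  apply: (le_trans (lerD (lexx _) cWj)); rewrite -!mulrDl ler_wpM2r ?exprn_ge0//.
  rewrite ler_wpM2r ?expR_ge0// exprS invfM; lra.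
(* At this level the net is all of [V]: since 4 ^ j > j, a set within distance j / 4 ^ j is the set
   itself. *)
have := claim #|T|; set j := #|T| => cl.
apply: (@le_trans _ _ ((2 - (2 ^+ j)^-1) * expR (- s) * 2 ^+ j)); last first.
  rewrite ler_wpM2r ?exprn_ge0// ler_wpM2r ?expR_ge0//.
  have : 0 <= (2 ^+ j)^-1 :> R by rewrite invr_ge0 exprn_ge0.
  lra.
apply: le_trans cl; rewrite ler_nat; apply: subset_leq_card; apply/fintype.subsetP => e.
rewrite !inE => /existsP[v /andP[vV hv]]; apply/existsP.
have [w wW hw] := cW j v vV.
have /eqP : #|sdiff v w| = 0%N.
  apply/eqP; rewrite -leqn0 leqNgt; apply/negP => h.
  have : (4 ^ j <= j)%N by apply: leq_trans hw; rewrite leq_pmulr.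
  by rewrite leqNgt ltn_expl.
rewrite cards_eq0 => /eqP/setP h0.
have vw : v = w.
  by apply/setP => i; have := h0 i; rewrite !inE; case: (i \in v); case: (i \in w).
exists w; rewrite wW /= -vw; apply: le_lt_trans hv; rewrite /th mulrC ler_wpM2r//.
have : 0 <= j.+3%:R / 2 ^+ j :> R by rewrite divr_ge0 ?exprn_ge0.
lra.
Qed.
End Chaining.

Section FiniteDeviation.
Variables (R : realType) (T K : finType) (mu : T -> R) (A : K -> {set T}) (n : nat).
Hypothesis mu_ge0 : forall x, 0 <= mu x.
Hypothesis mu_sum : \sum_x mu x = 1.
Hypothesis n_gt0 : (0 < n)%N.

Local Notation sample := {ffun 'I_n -> T}.
(** The product measure on a finite sample space, where ghost sample and random signs are finite
    sums. [countable_uniform_deviation] reduces to this case by recording only which sets an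
    observation belongs to. *)
Definition sample_weight (t : sample) : R := \prod_i mu (t i).
Definition hits (k : K) (t : sample) : R := \sum_i (t i \in A k)%:R.
Definition mass (k : K) : R := \sum_(x in A k) mu x.

Let w := sample_weight.

Lemma sample_weight_ge0 t : 0 <= w t.
Proof. by apply: prodr_ge0 => i _. Qed.

Lemma sample_weight_sum : \sum_t w t = 1.
Proof.
rewrite /w /sample_weight -(bigA_distr_bigA (fun (_ : 'I_n) x => mu x)).
by rewrite big1// => i _.
Qed.

Lemma mass_itv k : 0 <= mass k <= 1.
Proof.
rewrite /mass sumr_ge0//= -mu_sum [leRHS](bigID (fun x => x \in A k))/= lerDl.
exact: sumr_ge0.
Qed.

Lemma hits_itv k t : 0 <= hits k t <= n%:R.
Proof.
rewrite /hits sumr_ge0//= -[n in leRHS]card_ord -sum1_card natr_sum.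
by apply: ler_sum => i _; case: (t i \in A k).
Qed.

Lemma lower_deviation_one k (L : R) : 0 <= L ->
  \sum_(t | L < n%:R * mass k - hits k t) w t <= expR (- (L ^+ 2 / (8 * n%:R))).
Proof.
move=> L0; have n0 : 0 < n%:R :> R by rewrite ltr0n.
have /andP[m0 m1] := mass_itv k.
(* The quadratic bound on the exponential needs arguments up to 1/2, that is L <= 2 n; for larger
   [L] the event is empty. *)
have [L2|L2] := ltP (2 * n%:R) L.
  rewrite big_pred0 ?expR_ge0// => t; apply/negbTE; rewrite -leNgt.
  have /andP[h0 _] := hits_itv k t.
  by have : n%:R * mass k <= n%:R by [rewrite ler_piMr]; lra.
pose th := L / (4 * n%:R).
have th0 : 0 <= th by rewrite divr_ge0// mulr_ge0.
have th1 : th <= 2^-1 by rewrite ler_pdivrMr ?mulr_gt0//; lra.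
pose y x := th * (mass k - (x \in A k)%:R).
apply: (@le_trans _ _ (\sum_t w t * expR (th * (n%:R * mass k - hits k t - L)))).
  rewrite big_mkcond/=; apply: ler_sum => t _; case: ifP => [h|_].
    rewrite ler_peMr ?sample_weight_ge0// -[leLHS]expR0 ler_expR.
    by apply: mulr_ge0 => //; rewrite subr_ge0 ltW.
  by rewrite mulr_ge0 ?expR_ge0// sample_weight_ge0.
have -> : \sum_t w t * expR (th * (n%:R * mass k - hits k t - L)) =
    expR (- (th * L)) * \prod_(i < n) \sum_x mu x * expR (y x).
  rewrite bigA_distr_bigA [RHS]mulr_sumr; apply: eq_bigr => t _.
  rewrite big_split/= mulrCA; congr (_ * _); rewrite -expR_sum -expRD; congr expR.
  rewrite /y -mulr_sumr sumrB sumr_const card_ord -[mass k *+ n]mulr_natl /hits.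
  ring.
have one : \sum_x mu x * expR (y x) <= expR (2 * th ^+ 2).
  apply: (@le_trans _ _ (\sum_x (mu x + mu x * y x + 2 * th ^+ 2 * mu x))).
    apply: ler_sum => x _.
    have yb : `|mass k - (x \in A k)%:R| <= 1.
      by rewrite ler_norml; case: (x \in A k) => /=; lra.
    have y1 : y x <= 2^-1.
      apply: le_trans th1; rewrite /y ler_piMr//.
      exact: le_trans (ler_norm _) yb.
    have y2 : y x ^+ 2 <= th ^+ 2.
      rewrite /y exprMn ler_piMr ?sqr_ge0// -real_normK ?num_real//.
      by rewrite expr_le1.
    have := ler_wpM2l (mu_ge0 x) (expR_le_quad y1).
    have := ler_wpM2l (mu_ge0 x) y2; lra.
  rewrite !big_split/= mu_sum -mulr_sumr mu_sum.
  have -> : \sum_x mu x * y x = 0.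
    rewrite /y; under eq_bigr do rewrite mulrCA mulrBr.
    rewrite -mulr_sumr sumrB -mulr_suml mu_sum mul1r /mass.
    rewrite [in X in X - _]big_mkcond/= -sumrB big1 ?mulr0// => x _.
    by case: (x \in A k); rewrite ?mulr1 ?mulr0 subrr.
  by rewrite addr0 mulr1; exact: expR_ge1Dx.
apply: (@le_trans _ _ (expR (- (th * L)) * \prod_(i < n) expR (2 * th ^+ 2))).
  rewrite ler_wpM2l ?expR_ge0//; apply: ler_prod => i _; rewrite one andbT.
  by apply: sumr_ge0 => x _; rewrite mulr_ge0 ?expR_ge0.
rewrite prodr_const card_ord -expRM_natl -expRD ler_expR /th.
have -> : - (L / (4 * n%:R) * L) + n%:R * (2 * (L / (4 * n%:R)) ^+ 2) = - (L ^+ 2 / (8 * n%:R)).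
  by field; exact: lt0r_neq0.
by [].
Qed.

(** A [k] that is bad for [t] is chosen before the ghost sample [t'] is drawn, so the bound for a
    single set applies to it: with probability at least 1/2 the ghost sample falls short by at most
    [L], and then it beats [t] by more than [L]. *)
Lemma ghost_sample (L : R) : 0 <= L -> 8 * n%:R <= L ^+ 2 ->
  \sum_(t | [exists k, 2 * L < n%:R * mass k - hits k t]) w t <=
  2 * \sum_t \sum_(t' | [exists k, L < hits k t' - hits k t]) w t * w t'.
Proof.
move=> L0 L2; have n0 : 0 < n%:R :> R by rewrite ltr0n.
rewrite mulr_sumr [leLHS]big_mkcond/=; apply: ler_sum => t _.
have w0 := sample_weight_ge0; rewrite -mulr_sumr mulrCA.
case: ifP => [/existsP[k hk]|_]; last first.
  by rewrite !mulr_ge0// sumr_ge0.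
rewrite ler_peMr//.
have h1 : \sum_(t' | L < n%:R * mass k - hits k t') w t' <= 2^-1.
  apply: le_trans (lower_deviation_one k L0) _.
  rewrite expRN lef_pV2 ?posrE ?expR_gt0//.
  have : 1 <= L ^+ 2 / (8 * n%:R) by rewrite ler_pdivlMr ?mulr_gt0// mul1r.
  by have := expR_ge1Dx (L ^+ 2 / (8 * n%:R)); lra.
have h2 : 1 <= \sum_(t' | L < n%:R * mass k - hits k t') w t' +
    \sum_(t' | [exists k, L < hits k t' - hits k t]) w t'.
  rewrite -[leLHS]sample_weight_sum [leLHS](bigID (fun t' => L < n%:R * mass k - hits k t'))/=.
  rewrite lerD2l [leLHS]big_mkcond [leRHS]big_mkcond/=; apply: ler_sum => t' _.
  case: ifP => [|_]; last by case: ifP.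
  rewrite -leNgt => h3; rewrite ifT//; apply/existsP; exists k; lra.
lra.
Qed.

Definition signed_hits (e : {ffun 'I_n -> bool}) k (t : sample) : R :=
  rademacher_sum e (fun i => (t i \in A k)%:R).

(** Exchanging [t i] and [t' i] wherever [e i] holds is an involution that preserves the weight and
    flips the corresponding signs. The left side is thus the same for every [e], and it is summed
    over all of them. *)
Lemma symmetrization (L : R) :
  2 ^+ n * (\sum_t \sum_(t' | [exists k, L < hits k t' - hits k t]) w t * w t') =
  \sum_t \sum_t' w t * w t' *
    #|[set e | [exists k, L < signed_hits e k t' - signed_hits e k t]]|%:R.
Proof.
pose S (e : {ffun 'I_n -> bool}) := \sum_(u : sample * sample |
   [exists k, L < signed_hits e k u.2 - signed_hits e k u.1]) w u.1 * w u.2.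
pose sw (e : {ffun 'I_n -> bool}) (u : sample * sample) : sample * sample :=
  ([ffun i => if e i then u.2 i else u.1 i], [ffun i => if e i then u.1 i else u.2 i]).
have swK e : involutive (sw e).
  move=> [t t']; rewrite /sw /=.
  by congr pair; apply/ffunP => i; rewrite !ffunE /=; case: (e i).
have SE e : S e = \sum_t \sum_(t' | [exists k, L < hits k t' - hits k t]) w t * w t'.
  rewrite pair_big_dep/= /S (reindex_inj (inv_inj (swK e)))/=.
  apply: eq_big => [[t t']|[t t'] _] /=.
    apply: eq_existsb => k; congr (_ < _).
    rewrite /signed_hits /rademacher_sum /hits -!sumrB; apply: eq_bigr => i _.
    by rewrite !ffunE; case: (e i) => /=; rewrite ?expr1 ?expr0; ring.
  rewrite /w /sample_weight -!big_split/=; apply: eq_bigr => i _.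
  by rewrite !ffunE; case: (e i) => //; rewrite mulrC.
have -> : 2 ^+ n * (\sum_t \sum_(t' | [exists k, L < hits k t' - hits k t]) w t * w t') =
    \sum_(e : {ffun 'I_n -> bool}) S e.
  under [RHS]eq_bigr do rewrite SE.
  by rewrite sumr_const card_ffun card_bool card_ord -[RHS]mulr_natl natrX.
rewrite pair_big/= /S (exchange_big_dep predT)//=; apply: eq_bigr => -[t t'] _ /=.
rewrite -sum1_card natr_sum mulr_sumr; apply: eq_big => [e|e _]; last by rewrite mulr1.
by rewrite !inE.
Qed.

(** Growth is asked only at points of positive mass: in the application the points are membership
    patterns, and those of positive mass are realized by actual observations. The constant 8 is 2
    for the ghost sample, 2 for the two halves of the signed difference, and 2 from
    [rademacher_sup]. *)
Lemma finite_uniform_deviation (d : nat) (L s : R) : (0 < d)%N ->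
  (forall q (u : 'I_q -> T), (forall i, 0 < mu (u i)) ->
     #|[set [set i | u i \in A k] | k : K]|%:R
       <= (expR 1 * (1 + q%:R / d%:R)) ^+ (2 * d) :> R) ->
  1 <= s -> 0 <= L -> 64 * (544 * n%:R * (d%:R + s)) <= L ^+ 2 ->
  \sum_(t | [exists k, 2 * L < n%:R * mass k - hits k t]) w t <= 8 * expR (- s).
Proof.
move=> d0 gr s1 L0 hL; have n0 : 0 < n%:R :> R by rewrite ltr0n.
have d1 : 1 <= d%:R :> R by rewrite ler1n.
have w0 := sample_weight_ge0.
have hL8 : 8 * n%:R <= L ^+ 2.
  apply: le_trans hL; have : 0 <= n%:R * (d%:R - 1) :> R by rewrite mulr_ge0 ?subr_ge0// ltW.
  have : 0 <= n%:R * s by rewrite mulr_ge0 ?(ltW n0)//; lra.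
  nra.
apply: (le_trans (ghost_sample L0 hL8)).
have p2 : 0 < 2 ^+ n :> R by rewrite exprn_gt0.
rewrite -(ler_pM2l p2) mulrCA symmetrization.
(* A signed difference above [L] puts one sample above L / 2 = 4 (L / 8). Using [rademacher_sup]
   with [Q = L / 8] is the origin of the factor 64. *)
pose N (t : sample) : R :=
  #|[set e | [exists v in [set [set i | t i \in A k] | k : K],
      4 * (L / 8) < rademacher_sum e (ind R v)]]|%:R.
have N0 t : 0 <= N t by [].
have hN t : w t * N t <= w t * (2 * expR (- s) * 2 ^+ n).
  have [->|wt] := eqVneq (w t) 0; first by rewrite !mul0r.
  rewrite ler_wpM2l// -[n in leRHS]card_ord; apply: (@rademacher_sup _ _ d) => //.
  - by rewrite card_ord.
  - move=> q g; apply: le_trans (gr q (t \o g) _).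
      rewrite ler_nat -imset_comp; apply: subset_leq_card; apply/fintype.subsetP => v.
      move=> /imsetP[k _ ->]; apply/imsetP; exists k => //.
      by apply/setP => i; rewrite !inE.
    move=> i /=; rewrite lt_neqAle mu_ge0 andbT eq_sym.
    apply: contra wt => /eqP h; apply/eqP.
    by rewrite /w /sample_weight (bigD1 (g i))//= h mul0r.
  - by rewrite divr_ge0.
  - by rewrite card_ord expr_div_n; lra.
have indE k (t : sample) e : rademacher_sum e (ind R [set i | t i \in A k]) = signed_hits e k t.
  by apply: eq_bigr => i _; rewrite /ind inE.
(* Negating all signs is a bijection that turns the negative deviations of [t] into positive
   ones. *)
have split t t' : #|[set e | [exists k, L < signed_hits e k t' - signed_hits e k t]]|%:R
    <= N t' + N t.
  pose neg (e : {ffun 'I_n -> bool}) := [ffun i => ~~ e i].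
  have negK : involutive neg by move=> e; apply/ffunP => i; rewrite !ffunE negbK.
  have negE e k : signed_hits (neg e) k t = - signed_hits e k t.
    rewrite /signed_hits /rademacher_sum -sumrN; apply: eq_bigr => i _.
    by rewrite ffunE; case: (e i); rewrite /= ?expr0 ?expr1; ring.
  rewrite /N -[X in _ + X%:R](card_imset _ (inv_inj negK)) -natrD ler_nat.
  apply: leq_trans (leq_card_setU _ _); apply: subset_leq_card.
  apply/fintype.subsetP => e; rewrite !inE => /existsP[k hk].
  have [h1|h1] := ltP (4 * (L / 8)) (signed_hits e k t').
    apply/orP; left; apply/existsP; exists [set i | t' i \in A k].
    by rewrite indE h1 andbT; apply/imsetP; exists k.
  apply/orP; right; apply/imsetP; exists (neg e); last by rewrite negK.
  rewrite inE; apply/existsP; exists [set i | t i \in A k].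
  rewrite indE negE; apply/andP; split; first by apply/imsetP; exists k.
  lra.
have bnd t : \sum_t' w t * w t' * #|[set e | [exists k, L < signed_hits e k t' - signed_hits e k t]]|%:R
    <= w t * (2 * (2 * expR (- s) * 2 ^+ n)).
  apply: (@le_trans _ _ (\sum_t' (w t * (w t' * N t') + w t' * (w t * N t)))).
    apply: ler_sum => t' _; apply: le_trans (ler_wpM2l _ (split t t')) _.
      by rewrite mulr_ge0.
    by rewrite le_eqVlt; apply/orP; left; apply/eqP; ring.
  rewrite big_split/= -mulr_sumr -mulr_suml sample_weight_sum mul1r.
  apply: (@le_trans _ _ (w t * (2 * expR (- s) * 2 ^+ n) + w t * (2 * expR (- s) * 2 ^+ n))).
    apply: lerD => //; rewrite ler_wpM2l//.
    by apply: (le_trans (ler_sum _ (fun t' _ => hN t'))); rewrite -mulr_suml sample_weight_sum mul1r.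
  by rewrite -mulrDr ler_wpM2l//; lra.
rewrite mulrC -ler_pdivlMr//.
apply: (le_trans (ler_sum _ (fun t _ => bnd t))).
rewrite -mulr_suml sample_weight_sum mul1r; lra.
Qed.
End FiniteDeviation.

Local Open Scope classical_set_scope.
Local Open Scope ring_scope.

(** * Uniform deviation over pairs of half-spaces *)

Section RealProbability.
Variables (R : realType) (d : measure_display) (T : measurableType d) (P : probability T R).
Implicit Types A B : set T.

Definition prb A : R := fine (P A).

Lemma prbE A : measurable A -> P A = (prb A)%:E.
Proof. by move=> mA; rewrite /prb fineK// fin_num_measure. Qed.

Lemma prb_ge0 A : 0 <= prb A.
Proof. exact: fine_ge0. Qed.

Lemma prb_le1 A : measurable A -> prb A <= 1.
Proof. by move=> mA; rewrite -lee_fin -prbE// probability_le1. Qed.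

Lemma prb_le A B : measurable A -> measurable B -> A `<=` B -> prb A <= prb B.
Proof. by move=> mA mB AB; rewrite -lee_fin -!prbE// le_measure// inE. Qed.

Lemma prbC A : measurable A -> prb (~` A) = 1 - prb A.
Proof.
move=> mA; apply: EFin_inj.
by rewrite -prbE ?probability_setC//; [rewrite prbE//|exact: measurableC].
Qed.

Lemma prbT : prb setT = 1.
Proof. by rewrite /prb probability_setT. Qed.

Lemma prbU_disj A B : measurable A -> measurable B -> A `&` B = set0 ->
  prb (A `|` B) = prb A + prb B.
Proof.
move=> mA mB AB; apply: EFin_inj.
rewrite EFinD -!prbE//; last exact: measurableU.
exact: measureU.
Qed.

Lemma prbU_le A B : measurable A -> measurable B -> prb (A `|` B) <= prb A + prb B.
Proof.
move=> mA mB; rewrite -lee_fin EFinD -!prbE//; last exact: measurableU.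
exact: measureU2.
Qed.

Lemma prb_sub_le A B : measurable A -> measurable B -> prb A - prb B <= prb (A `\` B).
Proof.
move=> mA mB; have mD := measurableD mA mB.
rewrite lerBlDr; apply: le_trans (prbU_le mD mB); apply: prb_le => //.
  exact: measurableU.
by move=> x Ax; have [Bx|Bx] := pselect (B x); [right|left].
Qed.

Lemma prb_finite_fibers (F : finType) (g : T -> F) (p : pred F) :
  (forall f, measurable (g @^-1` [set f])) ->
  measurable [set x | p (g x)] /\
  prb [set x | p (g x)] = \sum_(f | p f) prb (g @^-1` [set f]).
Proof.
move=> mg.
have mb (r : seq F) : measurable [set x | (g x \in r) && p (g x)].
  rewrite (_ : [set x | _] = \big[setU/set0]_(f <- r | p f) (g @^-1` [set f])).
    by apply: bigsetU_measurable.
  rewrite -bigcup_seq_cond; apply/seteqP; split => [x /= /andP[xr px]|x].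
    by exists (g x) => //=; rewrite xr px.
  by move=> [f /= /andP[fr pf] ->]; rewrite fr pf.
have key (r : seq F) : uniq r ->
    prb [set x | (g x \in r) && p (g x)] = \sum_(f <- r | p f) prb (g @^-1` [set f]).
  elim: r => [_|f r IH /= /andP[fr ur]].
    by rewrite big_nil [X in prb X](_ : _ = set0) ?/prb ?measure0//; apply/seteqP; split.
  rewrite big_cons -IH//; case: ifP => pf; last first.
    congr prb; apply/seteqP; split => x /=; rewrite inE.
      by case: eqP => [->|//]; rewrite pf andbF.
    by move=> /andP[-> ->]; rewrite orbT.
  rewrite -prbU_disj//.
    congr prb; apply/seteqP; split => x /=; rewrite inE.
      by move=> /andP[/orP[/eqP|] h1 h2]; [left|right; rewrite h1].
    by move=> [->|/andP[-> ->]]; rewrite ?eqxx ?orbT.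
  apply/seteqP; split => x //= [-> /andP[h _]].
  by rewrite h in fr.
have e : [set x | p (g x)] = [set x | (g x \in index_enum F) && p (g x)].
  by apply/seteqP; split => x /=; rewrite mem_index_enum.
by rewrite e; split => //; rewrite key// index_enum_uniq.
Qed.

Lemma prb_bigcup_le (F : nat -> set T) (c : R) :
  (forall k, measurable (F k)) -> nondecreasing_seq F ->
  (forall k, prb (F k) <= c) -> prb (\bigcup_k F k) <= c.
Proof.
move=> mF ndF hF; have mU : measurable (\bigcup_k F k) by exact: bigcup_measurable.
rewrite -lee_fin -prbE//.
have h := nondecreasing_cvg_mu (mu := P) mF mU ndF.
rewrite -(cvg_lim _ h)//; apply: lime_le; first by apply/cvg_ex; eexists; exact: h.
by apply: nearW => k /=; rewrite prbE// lee_fin.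
Qed.

Lemma prb_bigcup_ge (F : nat -> set T) (c : R) :
  (forall k, measurable (F k)) -> nondecreasing_seq F ->
  c < prb (\bigcup_k F k) -> exists k, c < prb (F k).
Proof.
move=> mF ndF hc; apply: contrapT => /forallNP H; move: hc; rewrite ltNge => /negP; apply.
by apply: prb_bigcup_le => // k; rewrite leNgt; apply/negP; exact: H.
Qed.

End RealProbability.

Section UniformDeviation.
Variables (R : realType) (dO dT : measure_display) (Om : measurableType dO)
  (T : measurableType dT) (P : probability Om R) (mu : probability T R) (n : nat)
  (Z : 'I_n -> Om -> T).
Hypothesis n_gt0 : (0 < n)%N.
Hypothesis mZ : forall i A, measurable A -> measurable (Z i @^-1` A).
Hypothesis lawZ : forall i A, measurable A -> P (Z i @^-1` A) = mu A.
Hypothesis indepZ : forall A : 'I_n -> set T, (forall i, measurable (A i)) ->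
  P (\bigcap_(i in [set: 'I_n]) (Z i @^-1` A i)) = \big[*%E/1%E]_(i < n) P (Z i @^-1` A i).

(** The first [M] sets see an observation only through a pattern in a finite type, to which the
    finite bound applies. That bound does not depend on [M] and the bad events increase with [M], so
    it passes to their union. *)
Lemma countable_uniform_deviation (B : nat -> set T) (d : nat) (L s : R) :
  (forall k, measurable (B k)) -> (0 < d)%N ->
  (forall M q (u : 'I_q -> T),
     #|[set [set i | u i \in B k]%SET | k : 'I_M]%SET|%:R
       <= (expR 1 * (1 + q%:R / d%:R)) ^+ (2 * d) :> R) ->
  1 <= s -> 0 <= L -> 64 * (544 * n%:R * (d%:R + s)) <= L ^+ 2 ->
  exists E : set Om, [/\ measurable E, 1 - 8 * expR (- s) <= prb P E &
    forall w, E w -> forall k,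
      n%:R * prb mu (B k) - 2 * L <= \sum_i (Z i w \in B k)%:R].
Proof.
move=> mB d0 gr s1 L0 hL.
pose pat M (x : T) : {ffun 'I_M -> bool} := [ffun k : 'I_M => x \in B k].
have mpat M f : measurable (pat M @^-1` [set f]).
  rewrite (_ : _ @^-1` _ = \bigcap_(k in [set: 'I_M]) (if f k then B k else ~` B k)).
    apply: fin_bigcap_measurable; first exact: finite_finset.
    by move=> k _; case: (f k) => //; exact: measurableC.
  apply/seteqP; split => [x /= <- k _|x /= h].
    by rewrite ffunE; case: ifPn; rewrite ?inE// notin_setE.
  apply/ffunP => k; rewrite ffunE; have := h k I; case: (f k) => hk.
    by apply/mem_set.
  by apply/negbTE; rewrite notin_setE.
pose m M (f : {ffun 'I_M -> bool}) := prb mu (pat M @^-1` [set f]).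
pose A M (k : 'I_M) : {set {ffun 'I_M -> bool}} := [set f : {ffun 'I_M -> bool} | f k]%SET.
have m0 M f : 0 <= m M f by exact: prb_ge0.
have m1 M : \sum_f m M f = 1.
  have [_ <-] := prb_finite_fibers mu xpredT (mpat M).
  by rewrite -[RHS](prbT mu); congr prb; apply/seteqP; split.
have massE M (k : 'I_M) : mass (m M) (@A M) k = prb mu (B k).
  rewrite /mass; under eq_bigl do rewrite inE.
  have [_ <-] := prb_finite_fibers mu (fun f : {ffun 'I_M -> bool} => f k) (mpat M).
  by congr prb; apply/seteqP; split => x; rewrite /= ffunE inE.
pose pt M (w : Om) : {ffun 'I_n -> {ffun 'I_M -> bool}} := [ffun i => pat M (Z i w)].
have ptE M t : pt M @^-1` [set t] = \bigcap_(i in [set: 'I_n]) (Z i @^-1` (pat M @^-1` [set t i])).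
  apply/seteqP; split => [w /= <- i _|w h]; first by rewrite /= ffunE.
  by apply/ffunP => i; rewrite ffunE; exact: (h i I).
have mpt M t : measurable (pt M @^-1` [set t]).
  rewrite ptE; apply: fin_bigcap_measurable; first exact: finite_finset.
  by move=> i _; apply: mZ.
have prpt M t : prb P (pt M @^-1` [set t]) = sample_weight (m M) t.
  apply: EFin_inj; rewrite -prbE// ptE indepZ// /sample_weight.
  elim/big_rec2: _ => // i y1 y2 _ ->.
  by rewrite lawZ// prbE.
have hitsE M (k : 'I_M) w : hits R (@A M) k (pt M w) = \sum_i (Z i w \in B k)%:R.
  by apply: eq_bigr => i _; rewrite inE !ffunE.
pose bad M (t : {ffun 'I_n -> {ffun 'I_M -> bool}}) := [exists k, 2 * L < n%:R * mass (m M) (@A M) k - hits R (@A M) k t].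
have badP M : measurable [set w | bad M (pt M w)] /\ prb P [set w | bad M (pt M w)] <= 8 * expR (- s).
  have [mb ->] := prb_finite_fibers P (bad M) (mpt M); split => //.
  under eq_bigr do rewrite prpt.
  apply: (finite_uniform_deviation (m0 M) (m1 M) n_gt0 d0 _ s1 L0 hL).
  move=> q u hu.
  have /choice[x hx] : forall i, exists x, pat M x = u i.
    move=> i; have /set0P[x hx] : pat M @^-1` [set u i] != set0; last by exists x.
    by apply: contraTneq (hu i) => h; rewrite /m h /prb measure0 ltxx.
  apply: le_trans (gr M q x); rewrite ler_nat; apply: subset_leq_card.
  apply/fintype.subsetP => v /imsetP[k _ ->]; apply/imsetP; exists k => //.
  by apply/setP => i; rewrite !inE -hx ffunE.
have badE M w : bad M (pt M w) = [exists k : 'I_M, 2 * L < n%:R * prb mu (B k) - \sum_i (Z i w \in B k)%:R].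
  by apply: eq_existsb => k; rewrite massE hitsE.
have mU : measurable (\bigcup_M [set w | bad M (pt M w)]).
  by apply: bigcup_measurable => M _; exact: (badP M).1.
exists (~` \bigcup_M [set w | bad M (pt M w)]); split; first exact: measurableC.
  rewrite prbC// lerD2l lerN2; apply: prb_bigcup_le => [M|M M' MM'|M].
  - exact: (badP M).1.
  - apply/subsetPset => w /=; rewrite !badE => /existsP[k hk]; apply/existsP.
    by exists (widen_ord MM' k).
  - exact: (badP M).2.
move=> w hw k; rewrite leNgt; apply/negP => h; apply: hw; exists k.+1 => //=.
rewrite badE; apply/existsP; exists ord_max => /=; lra.
Qed.
End UniformDeviation.

(** The witness 1 / (1 + sum of 1 / a i) also covers an empty [I], which has no minimum. *)
Lemma positive_lower_bound (R : realType) (I : finType) (a : I -> R) :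
  (forall i, 0 < a i) -> exists2 e, 0 < e & forall i, e <= a i.
Proof.
move=> a0; have s0 : 0 <= \sum_i (a i)^-1 by apply: sumr_ge0 => i _; rewrite invr_ge0 ltW.
exists (1 + \sum_i (a i)^-1)^-1 => [|i]; first by rewrite invr_gt0; lra.
rewrite -[leRHS]invrK lef_pV2 ?posrE ?invr_gt0//; last by lra.
rewrite (bigD1 i)//= addrCA lerDl addr_ge0// sumr_ge0// => j _.
by rewrite invr_ge0 ltW.
Qed.

Lemma rational_vector_approx (R : realType) (d : nat) (x : 'cV[R]_d) (e : R) : 0 < e ->
  exists q : 'cV[rat]_d, forall j, `|ratr (q j 0) - x j 0| <= e.
Proof.
move=> e0.
have /choice[q hq] : forall j, exists q : rat, `|ratr q - x j 0| <= e.
  move=> j; have [|q] := @rat_in_itvoo _ (x j 0 - e) (x j 0 + e); first by lra.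
  by rewrite in_itv/= => /andP[h1 h2]; exists q; rewrite ler_distl; lra.
by exists (\col_j q j) => j; rewrite mxE.
Qed.

Section SublevelSets.
Variables (R : realType) (d : measure_display) (T : measurableType d).

Lemma measurable_le_set (f : T -> R) (c : R) :
  measurable_fun setT f -> measurable [set x | f x <= c].
Proof.
move=> mf; rewrite (_ : [set _ | _] = f @^-1` `]-oo, c]%classic).
  by rewrite -[X in measurable X]setTI; exact: mf.
by apply/seteqP; split => x /=; rewrite in_itv.
Qed.

Lemma measurable_lt_set (f : T -> R) (c : R) :
  measurable_fun setT f -> measurable [set x | f x < c].
Proof.
move=> mf; rewrite (_ : [set _ | _] = f @^-1` `]-oo, c[%classic).
  by rewrite -[X in measurable X]setTI; exact: mf.
by apply/seteqP; split => x /=; rewrite in_itv.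
Qed.

Lemma measurable_vdot (k : nat) (th : 'cV[R]_k) (phi : T -> 'cV[R]_k) :
  (forall j, measurable_fun setT (fun x => phi x j 0)) ->
  measurable_fun setT (fun x => vdot th (phi x)).
Proof.
move=> mphi; rewrite /vdot; apply: measurable_sum => j.
exact: measurable_funM.
Qed.
End SublevelSets.

Section HalfspaceDeviation.
Variables (R : realType) (dO dT : measure_display) (Om : measurableType dO)
  (T : measurableType dT) (P : probability Om R) (mu : probability T R) (n : nat)
  (Z : 'I_n -> Om -> T) (d : nat) (phi : T -> 'cV[R]_d).
Hypothesis n_gt0 : (0 < n)%N.
Hypothesis d_gt0 : (0 < d)%N.
Hypothesis mZ : forall i A, measurable A -> measurable (Z i @^-1` A).
Hypothesis lawZ : forall i A, measurable A -> P (Z i @^-1` A) = mu A.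
Hypothesis indepZ : forall A : 'I_n -> set T, (forall i, measurable (A i)) ->
  P (\bigcap_(i in [set: 'I_n]) (Z i @^-1` A i)) = \big[*%E/1%E]_(i < n) P (Z i @^-1` A i).
Hypothesis mphi : forall j, measurable_fun setT (fun x => phi x j 0).

Let closed_pair (th th' : 'cV[R]_d) :=
  [set x | vdot th (phi x) <= 0] `|` [set x | vdot th' (phi x) <= 0].
Let open_pair (th th' : 'cV[R]_d) :=
  [set x | vdot th (phi x) < 0] `|` [set x | vdot th' (phi x) < 0].

(** A violation at real parameters is transported to rational ones. The gap between open and closed
    half-spaces leaves room to approximate so that the population probability stays too large and no
    new sample point is hit. *)
Lemma halfspace_uniform_deviation (L s : R) :
  1 <= s -> 0 <= L -> 64 * (544 * n%:R * (d%:R + s)) <= L ^+ 2 ->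
  exists E : set Om, [/\ measurable E, 1 - 8 * expR (- s) <= prb P E &
    forall w, E w -> forall th th',
      n%:R * prb mu (open_pair th th') - 2 * L <= \sum_i (Z i w \in closed_pair th th')%:R].
Proof.
move=> s1 L0 hL; have n0 : 0 < n%:R :> R by rewrite ltr0n.
have mle th : measurable [set x | vdot th (phi x) <= 0].
  exact/measurable_le_set/measurable_vdot.
have mC th th' : measurable (closed_pair th th') by exact: measurableU.
pose par (k : nat) : 'cV[rat]_d * 'cV[rat]_d := odflt (0, 0) (unpickle k).
pose toR (q : 'cV[rat]_d) : 'cV[R]_d := map_mx ratr q.
pose B k := closed_pair (toR (par k).1) (toR (par k).2).
have [||E [mE pE hE]] := @countable_uniform_deviation _ _ _ _ _ P mu n Z n_gt0 mZ lawZ indepZ B d L s _ d_gt0 _ s1 L0 hL.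
- by move=> k; exact: mC.
- move=> M q u; rewrite -[q in leRHS]card_ord.
  apply: le_trans (card_halfspace_union_traces (fun i => phi (u i))
    (fun k : 'I_M => toR (par k).1) (fun k : 'I_M => toR (par k).2) d_gt0).
  rewrite ler_nat; apply: subset_leq_card.
  apply/fintype.subsetP => v /imsetP[k _ ->]; apply/imsetP; exists k => //.
  apply/setP => i; rewrite !inE; apply/idP/orP.
    by rewrite inE => -[]; [left|right].
  by rewrite inE; case=> ?; [left|right].
exists E; split => // w Ew th th'; rewrite leNgt; apply/negP => h.
set c := \sum_i _ in h.
(* A Lipschitz constant of t |-> vdot t (phi x) for the largest entry; the 1 makes it positive. *)
pose l1 x := \sum_j `|phi x j 0| + 1.
have l1p x : 0 < l1 x by rewrite ltr_wpDl// sumr_ge0.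
have ml1 : measurable_fun setT l1.
  apply: measurable_funD => //; apply: measurable_sum => j.
  exact: measurableT_comp.
(* The condition [lin k t x < 0] tolerates changes of the entries of [t] up to 1 / (k + 1). These
   events increase to the open half-space, so the violation already holds for some [k]. *)
pose lin k (t : 'cV[R]_d) x := vdot t (phi x) + k.+1%:R^-1 * l1 x.
have mlin k t : measurable [set x | lin k t x < 0].
  apply: measurable_lt_set; apply: measurable_funD; first exact: measurable_vdot.
  exact: measurable_funM.
pose O k := [set x | lin k th x < 0] `|` [set x | lin k th' x < 0].
have OE : open_pair th th' = \bigcup_k O k.
  have aux t x : vdot t (phi x) < 0 -> exists k, lin k t x < 0.
    move=> hx; exists (Num.truncn (l1 x / - vdot t (phi x))).
    rewrite /lin -ltrBrDl sub0r mulrC ltr_pdivrMr// mulrC -ltr_pdivrMr ?oppr_gt0//.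
    exact: truncnS_gt.
  have aux2 t x k : lin k t x < 0 -> vdot t (phi x) < 0.
    move=> hx; apply: le_lt_trans hx; rewrite /lin lerDl mulr_ge0// ltW//.
  apply/seteqP; split => x.
    by move=> [] /aux[k hk]; exists k => //; [left|right].
  by move=> [k _ []] /aux2 ?; [left|right].
have [k hk] : exists k, (c + 2 * L) / n%:R < prb mu (O k).
  apply: prb_bigcup_ge.
  - by move=> k; exact: measurableU.
  - move=> k k' kk'; apply/subsetPset => x.
    have aux t : lin k t x < 0 -> lin k' t x < 0.
      apply: le_lt_trans; rewrite /lin lerD2l ler_wpM2r ?(ltW (l1p x))//.
      by rewrite lef_pV2 ?posrE// ler_nat ltnS.
    by move=> [/aux|/aux] ?; [left|right].
  - by rewrite -OE ltr_pdivrMr// mulrC; lra.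
(* The second demand on the approximation: a sample point with a positive value must keep it
   positive. Other points impose nothing, hence the value 1. *)
pose a (u : 'I_n * bool) : R := let v := vdot (if u.2 then th else th') (phi (Z u.1 w)) in
  if 0 < v then v / (2 * l1 (Z u.1 w)) else 1.
have [|e1 e10 he1] := @positive_lower_bound _ _ a.
  by move=> u; rewrite /a /=; case: ifP => // v0; rewrite divr_gt0// mulr_gt0.
have [|e e0 he] := @positive_lower_bound _ _ (fun b : bool => if b then e1 else k.+1%:R^-1 / 2).
  by case=> //; rewrite divr_gt0.
have ee1 : e <= e1 by exact: (he true).
have ek : e <= k.+1%:R^-1 / 2 by exact: (he false).
have [q hq] := rational_vector_approx th e0.
have [q' hq'] := rational_vector_approx th' e0.
have close (t : 'cV[R]_d) (r : 'cV[rat]_d) x :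
    (forall j, `|ratr (r j 0) - t j 0| <= e) -> `|vdot (toR r) (phi x) - vdot t (phi x)| <= e * l1 x.
  move=> hr; rewrite /vdot -sumrB.
  apply: (le_trans (ler_norm_sum _ _ _)); rewrite /l1 mulrDr mulr1.
  apply: ler_wpDr; first exact: ltW.
  rewrite mulr_sumr; apply: ler_sum => j _; rewrite -mulrBl normrM mxE.
  by rewrite ler_wpM2r.
have := hE w Ew (pickle (q, q')); rewrite /B /par pickleK /=; apply/negP; rewrite -ltNge.
have h1 : prb mu (O k) <= prb mu (closed_pair (toR q) (toR q')).
  apply: prb_le => //; first exact: measurableU.
  have aux (t : 'cV[R]_d) (r : 'cV[rat]_d) x : (forall j, `|ratr (r j 0) - t j 0| <= e) -> lin k t x < 0 ->
      vdot (toR r) (phi x) <= 0.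
    move=> hr hx; have := close t r x hr; rewrite ler_distl => /andP[_ h2].
    apply: (le_trans h2); apply: le_trans (ltW hx); rewrite /lin lerD2l ler_wpM2r ?(ltW (l1p x))//.
    by apply: (le_trans ek); rewrite ler_pdivrMr// ler_peMr// ?ler1n// ltW.
  by move=> x [/(aux _ _ _ hq)|/(aux _ _ _ hq')] ?; [left|right].
have h2 : \sum_i (Z i w \in closed_pair (toR q) (toR q'))%:R <= c.
  apply: ler_sum => i _; rewrite ler_nat.
  have aux (b : bool) (r : 'cV[rat]_d) : (forall j, `|ratr (r j 0) - (if b then th else th') j 0| <= e) ->
      vdot (toR r) (phi (Z i w)) <= 0 -> vdot (if b then th else th') (phi (Z i w)) <= 0.
    move=> hr hx; rewrite leNgt; apply/negP => v0.
    have := close _ r (Z i w) hr; rewrite ler_distl => /andP[h3 _].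
    have := he1 (i, b); rewrite /a /= v0 => h4.
    have : e * l1 (Z i w) <= vdot (if b then th else th') (phi (Z i w)) / 2.
      rewrite -ler_pdivlMr// -mulrA -invfM; exact: le_trans ee1 h4.
    lra.
  have [hin|_] := boolP (Z i w \in closed_pair (toR q) (toR q')); last by [].
  rewrite (_ : (Z i w \in _) = true)//; apply/mem_set; move: hin; rewrite inE.
  by move=> [/(aux true q hq)|/(aux false q' hq')] ?; [left|right].
apply: (le_lt_trans h2); rewrite ltrBrDr [ltRHS]mulrC -ltr_pdivrMr//.
exact: lt_le_trans hk h1.
Qed.
End HalfspaceDeviation.

(** * Gaussian and spherical vectors *)

Lemma image_probability (R : realType) (d d' : measure_display) (Om : measurableType d)
    (T : measurableType d') (P : probability Om R) (f : Om -> T) :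
  measurable_fun setT f ->
  exists nu : probability T R, forall A, nu A = P (f @^-1` A).
Proof.
move=> mf.
pose X : {mfun Om >-> T} := HB.pack f (isMeasurableFun.Build _ _ _ _ f mf).
by exists (distribution P X).
Qed.

Section GaussianVariable.
Variables (R : realType) (d : measure_display) (Om : measurableType d) (P : probability Om R)
  (Y : Om -> R) (s : R).
Hypothesis mY : measurable_fun setT Y.
Hypothesis s_gt0 : 0 < s.
Hypothesis cdfY : forall t : R, P [set w | Y w <= t] =
  (\int[lebesgue_measure]_(x in `]-oo, t]) (normal_pdf 0 s x)%:E)%E.

Lemma gaussian_law (A : set R) : measurable A -> P (Y @^-1` A) = normal_prob 0 s A.
Proof.
move=> mA.
have [nu hnu] := image_probability P (mY : measurable_fun setT (Y : Om -> measurableTypeR R)).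
rewrite -hnu.
apply: (@measure_unique _ R (measurableTypeR R) (@RGenOInfty.G R)
  (fun k => `]- k%:R, +oo[%classic) _ _ _ _ nu (normal_prob 0 s)) => //.
- exact: RGenOInfty.measurableE.
- move=> _ _ [x ->] [y ->]; exists (Num.max x y).
  by apply/seteqP; split => z /=; rewrite !in_itv/= !andbT gt_max => /andP.
- by move=> k; exists (- k%:R).
- apply/seteqP; split => x // _; exists (Num.truncn `|x|).+1 => //=.
  rewrite in_itv/= andbT; have := truncnS_gt `|x|; have := ler_norm (- x).
  by rewrite normrN; lra.
- move=> _ [x ->].
  have mI : measurable (`]-oo, x]%classic : set (measurableTypeR R)) by exact: measurable_itv.
  have e1 : `]x, +oo[%classic = ~` `]-oo, x]%classic by rewrite setCitvl.
  rewrite e1; apply: (@eq_trans _ _ (1 - nu `]-oo, x]%classic)%E); first exact: probability_setC.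
  transitivity (1 - normal_prob 0 s `]-oo, x]%classic)%E; last first.
    by symmetry; exact: (probability_setC (normal_prob 0 s)).
  by rewrite hnu /normal_prob -cdfY.
- by move=> k; rewrite ltey_eq fin_num_measure.
Qed.

(** The complementary interval has length [s], and the density is at most 1 / (s sqrt (2 pi)), which
    is at most 1 / (2 s) because pi >= 2. *)
Lemma gaussian_anticoncentration : 2^-1 <= prb P [set w | s / 2 <= `|Y w|].
Proof.
pose I : set (measurableTypeR R) := `]- (s / 2), s / 2[%classic.
have mI : measurable I by exact: measurable_itv.
have mYI : measurable (Y @^-1` I) by rewrite -[X in measurable X]setTI; exact: mY.
have e : [set w | s / 2 <= `|Y w|] = ~` (Y @^-1` I).
  apply/seteqP; split => w; rewrite /I /setC /preimage /= in_itv/=.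
    by rewrite leNgt ltr_norml => /negP.
  by move=> /negP; rewrite -ltr_norml -leNgt.
rewrite e prbC//.
suff : prb P (Y @^-1` I) <= 2^-1 by lra.
rewrite -lee_fin -prbE// gaussian_law// /normal_prob.
apply: (@le_trans _ _ (\int[lebesgue_measure]_(x in I) (normal_peak s)%:E)%E).
  apply: ge0_le_integral => //.
  - by move=> x _; rewrite lee_fin normal_pdf_ge0.
  - by apply/measurable_EFinP/measurable_funTS; exact: measurable_normal_pdf.
  - by move=> x _; rewrite lee_fin normal_pdf_ub// gt_eqF.
have lI : @lebesgue_measure R I = s%:E.
  have := @lebesgue_measure_itv R `]- (s / 2), s / 2[; rewrite /= lte_fin ifT; last by have := s_gt0; lra.
  by move=> h; apply: (etrans h); rewrite -EFinB; congr EFin; lra.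
rewrite integral_cst// [X in (_ * X <= _)%E]lI -EFinM lee_fin.
rewrite /normal_peak ler_pdivrMl ?sqrtr_gt0 ?pmulrn_lgt0 ?mulr_gt0 ?pi_gt0 ?exprn_gt0//.
have -> : s ^+ 2 * pi *+ 2 = (2 * s) ^+ 2 * (pi / 2) by field.
rewrite sqrtrM ?sqr_ge0// sqrtr_sqr gtr0_norm ?mulr_gt0//.
have : 1 <= Num.sqrt (pi / 2 : R).
  rewrite -[leLHS](@sqrtr1 R) ler_wsqrtr// ler_pdivlMr// mul1r; exact: pi_ge2.
have := s_gt0; nra.
Qed.

(* On [k s^2 <= x^2 < (k + 1) s^2] the density is at most sqrt 2 exp (- k / 4) times
   the density of standard deviation [sqrt 2 * s]. *)
Lemma gaussian_second_moment : (\int[P]_w (Y w ^+ 2)%:E <= (6 * s ^+ 2)%:E)%E.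
Proof.
pose shell k : set R := [set x | Num.truncn (x ^+ 2 / s ^+ 2) = k].
have s20 : 0 < s ^+ 2 by rewrite exprn_gt0.
have shellE k x : shell k x -> k%:R * s ^+ 2 <= x ^+ 2 < k.+1%:R * s ^+ 2.
  move=> <-; rewrite -ler_pdivlMr// -ltr_pdivrMr//.
  by apply: truncn_itv; rewrite divr_ge0 ?sqr_ge0.
have mshell k : measurable (shell k).
  have -> : shell k = [set x | x ^+ 2 < k.+1%:R * s ^+ 2] `\` [set x | x ^+ 2 < k%:R * s ^+ 2].
    apply/seteqP; split => x.
      by move=> /shellE/andP[h1 h2]; split => //=; apply/negP; rewrite -leNgt.
    move=> [/= h1 /negP]; rewrite -leNgt => h2; apply/eqP; rewrite truncn_eq ?divr_ge0 ?sqr_ge0//.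
    by rewrite ler_pdivlMr// ltr_pdivrMr// h1 h2.
  by apply: measurableD; apply: measurable_lt_set; apply: measurable_funX.
pose t : R := Num.sqrt 2 * s.
have t0 : 0 < t by rewrite mulr_gt0// sqrtr_gt0.
have t2 : t ^+ 2 = 2 * s ^+ 2 by rewrite exprMn sqr_sqrtr.
have mYs k : measurable (Y @^-1` shell k) by rewrite -[X in measurable X]setTI; exact: mY.
have pdf_le k x : shell k x -> normal_pdf 0 s x <= Num.sqrt 2 * expR (- (k%:R / 4)) * normal_pdf 0 t x.
  move=> /shellE/andP[h1 _]; rewrite !normal_pdfE ?gt_eqF// /normal_fun !subr0 t2.
  have -> : normal_peak s = Num.sqrt 2 * normal_peak t.
    rewrite /normal_peak t2.
    have -> : 2 * s ^+ 2 * pi *+ 2 = 2 * (s ^+ 2 * pi *+ 2) by ring.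
    by rewrite sqrtrM// invfM mulrA divff ?mul1r// gt_eqF ?sqrtr_gt0.
  rewrite -!mulrA ler_wpM2l ?sqrtr_ge0// [leRHS]mulrCA ler_wpM2l ?normal_peak_ge0//.
  rewrite -expRD ler_expR -subr_ge0.
  have -> : - (k%:R / 4) + - x ^+ 2 / ((2 * s ^+ 2) *+ 2) - - x ^+ 2 / (s ^+ 2 *+ 2) =
      (x ^+ 2 - k%:R * s ^+ 2) / (4 * s ^+ 2).
    by field; rewrite gt_eqF.
  by apply: divr_ge0; rewrite ?subr_ge0// mulr_ge0// ltW.
have mI (k : nat) : (\int[P]_(w in Y @^-1` shell k) (Y w ^+ 2)%:E <=
    (6 * s ^+ 2)%:E * normal_prob 0 t (shell k))%E.
  apply: (@le_trans _ _ (\int[P]_(w in Y @^-1` shell k) (k.+1%:R * s ^+ 2)%:E)%E).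
    apply: ge0_le_integral => //.
    - by move=> w _; rewrite lee_fin sqr_ge0.
    - by apply/measurable_EFinP/measurable_funTS; exact: measurable_funX.
    - by move=> w /shellE/andP[_ /ltW]; rewrite lee_fin.
  rewrite integral_cst// [X in (_ * X <= _)%E](gaussian_law (mshell k)) /normal_prob.
  apply: (@le_trans _ _ ((k.+1%:R * s ^+ 2)%:E * \int[lebesgue_measure]_(x in shell k)
      (Num.sqrt 2 * expR (- (k%:R / 4)) * normal_pdf 0 t x)%:E)%E).
    rewrite lee_pmul2l ?lte_fin ?mulr_gt0//; apply: ge0_le_integral => //.
    - exact: mshell.
    - by move=> x _; rewrite lee_fin normal_pdf_ge0.
    - by apply/measurable_EFinP/measurable_funTS; exact: measurable_normal_pdf.
    - by apply/measurable_EFinP/measurable_funTS/measurable_funM => //; exact: measurable_normal_pdf.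
    - by move=> x /pdf_le; rewrite lee_fin.
  under eq_integral do rewrite EFinM.
  rewrite ge0_integralZl//; last 3 first.
  - exact: mshell.
  - by apply/measurable_EFinP/measurable_funTS; exact: measurable_normal_pdf.
  - by move=> x _; rewrite lee_fin normal_pdf_ge0.
  rewrite muleA -EFinM lee_wpmul2r//; first by apply: integral_ge0 => x _; rewrite lee_fin normal_pdf_ge0.
  rewrite lee_fin mulrAC ler_wpM2r ?(ltW s20)//.
  (* The constant 6 is this 4 times the bound 3/2 for sqrt 2. *)
  have h4 : k.+1%:R * expR (- (k%:R / 4)) <= 4 :> R.
    rewrite expRN ler_pdivrMr ?expR_gt0//.
    by have := expR_ge1Dx (k%:R / 4 : R); rewrite -[k.+1%:R]natr1; lra.
  have hs : Num.sqrt 2 <= 3 / 2 :> R.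
    rewrite -[leRHS]ger0_norm// -sqrtr_sqr ler_wsqrtr// expr2; lra.
  by have := ler_wpM2r (sqrtr_ge0 (2 : R)) h4; lra.
have cover : \bigcup_k (Y @^-1` shell k) = setT.
  by apply/seteqP; split => // w _; exists (Num.truncn (Y w ^+ 2 / s ^+ 2)).
rewrite -cover ge0_integral_bigcup//; last 3 first.
- by apply/measurable_EFinP/measurable_funTS; exact: measurable_funX.
- by move=> w _; rewrite lee_fin sqr_ge0.
- by apply/trivIsetP => i j _ _ ij; apply/seteqP; split => // w [h1 h2]; move: ij; rewrite -h1 -h2 eqxx.
apply: (@le_trans _ _ (\sum_(0 <= k <oo) ((6 * s ^+ 2)%:E * normal_prob 0 t (shell k)))%E).
  apply: lee_nneseries => [k *|k *]; last exact: mI.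
  by apply: integral_ge0 => w _; rewrite lee_fin sqr_ge0.
rewrite nneseriesZl// -[leRHS]mule1 lee_pmul2l ?lte_fin ?mulr_gt0//.
apply: (@le_trans _ _ (normal_prob 0 t (\bigcup_k shell k))); last first.
  by apply: probability_le1; apply: bigcup_measurable => k _; exact: mshell.
rewrite measure_bigcup//; last 2 first.
- by move=> k _; exact: mshell.
- by apply/trivIsetP => i j _ _ ij; apply/seteqP; split => // w [h1 h2]; move: ij; rewrite -h1 -h2 eqxx.
by rewrite le_eqVlt; apply/orP; left; apply/eqP/eq_eseriesl => k; rewrite in_setT.
Qed.
End GaussianVariable.

Section CoordinateBorel.
Variable R : realType.

Definition rays (T I : Type) (c : I -> T -> R) : set (set T) :=
  [set A | exists i t, A = [set x | c i x <= t]].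

(** Its measurable sets are those of [coord_borel c], so that [rmeasurable] becomes [measurable_fun]
    and product measures are available for the laws of [X] and [E]. *)
Definition borel_space (T : pointedType) (I : Type) (c : I -> T -> R) :=
  g_sigma_algebraType (rays c).

Lemma measurable_fun_of_le (d : measure_display) (T : measurableType d) (f : T -> R) :
  (forall t, measurable [set x | f x <= t]) -> measurable_fun setT f.
Proof.
move=> mf; apply: (measurability (@RGenOInfty.G R)).
  exact: RGenOInfty.measurableE.
move=> _ [_ [t ->] <-]; rewrite setTI.
rewrite (_ : f @^-1` _ = ~` [set x | f x <= t]); first exact: measurableC.
apply/seteqP; split => x /=; rewrite in_itv/= andbT ltNge; first by move/negP.
by move=> h; apply/negP.
Qed.

Lemma measurable_coord (T : pointedType) (I : Type) (c : I -> T -> R) (i : I) :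
  measurable_fun setT (c i : borel_space c -> R).
Proof.
apply: measurable_fun_of_le => t; apply: sub_sigma_algebra.
by exists i, t.
Qed.

Lemma measurable_fun_coords (d : measure_display) (Om : measurableType d) (T : pointedType)
    (I : Type) (c : I -> T -> R) (X : Om -> T) :
  (forall i, measurable_fun setT (fun w => c i (X w))) ->
  measurable_fun setT (X : Om -> borel_space c).
Proof.
move=> mX; apply: (@measurability _ _ Om (borel_space c) setT X (rays c)) => //.
move=> _ [_ [i [t ->]] <-]; rewrite setTI.
exact: measurable_le_set.
Qed.

Lemma rmeasurable_fun (d : measure_display) (Om : measurableType d) (T : pointedType)
    (I : Type) (c : I -> T -> R) (X : Om -> T) :
  rmeasurable (coord_borel c) X -> measurable_fun setT (X : Om -> borel_space c).
Proof. by move=> mX _ A mA; rewrite setTI; exact: mX. Qed.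

Lemma rmeasurable_coord (d : measure_display) (Om : measurableType d) (T : pointedType)
    (I : Type) (c : I -> T -> R) (X : Om -> T) (i : I) :
  rmeasurable (coord_borel c) X -> measurable_fun setT (fun w => c i (X w)).
Proof.
move=> mX; apply: measurable_fun_of_le => t.
apply: (mX [set x | c i x <= t]); apply: sub_sigma_algebra.
by exists i, t.
Qed.

End CoordinateBorel.

(* Conditioning on X: the section bounds hold for every value of X. *)
Lemma prb_sections_ge (R : realType) (d dX dE : measure_display) (Om : measurableType d)
    (TX : measurableType dX) (TE : measurableType dE) (P : probability Om R)
    (X : Om -> TX) (E : Om -> TE) (A : set (TX * TE)) (G : set TX) (a b : R) :
  measurable_fun setT X -> measurable_fun setT E ->
  (forall A1 A2, measurable A1 -> measurable A2 ->
     P (X @^-1` A1 `&` E @^-1` A2) = (P (X @^-1` A1) * P (E @^-1` A2))%E) ->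
  measurable A -> measurable G -> 0 <= a -> 0 <= b ->
  (forall x, a + b * \1_G x <= prb P [set w | A (x, E w)]) ->
  a + b * prb P (X @^-1` G) <= prb P [set w | A (X w, E w)].
Proof.
move=> mX mE ind mA mG a0 b0 sec.
have mXE : measurable_fun setT (fun w => (X w, E w)) by exact: measurable_fun_pair.
have [nuX hX] := image_probability P mX.
have [nuE hE] := image_probability P mE.
have [nu hnu] := image_probability P mXE.
have mAXE : measurable [set w | A (X w, E w)].
  by rewrite -[X in measurable X]setTI; exact: mXE.
have mXG : measurable (X @^-1` G) by rewrite -[X in measurable X]setTI; exact: mX.
have rect A1 A2 : measurable A1 -> measurable A2 -> nu (A1 `*` A2) = (nuX A1 * nuE A2)%E.
  by move=> m1 m2; rewrite hnu hX hE -ind.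
have e : P [set w | A (X w, E w)] = (nuX \x nuE)%E A.
  by rewrite (product_measure_unique rect mA) -hnu.
rewrite -lee_fin -[leRHS]prbE// e /product_measure1.
apply: (@le_trans _ _ (\int[nuX]_x (a + b * \1_G x)%:E)%E).
  under eq_integral do rewrite EFinD EFinM.
  rewrite ge0_integralD//; last 2 first.
  - by move=> x _; rewrite -EFinM lee_fin mulr_ge0.
  - by apply/measurable_EFinP; apply: measurable_funM => //; exact: measurable_indic.
  rewrite integral_cst// [X in (_ * X + _)%E](probability_setT nuX) mule1.
  rewrite ge0_integralZl//; last first.
    by apply/measurable_EFinP; exact: measurable_indic.
  by rewrite integral_indic// setIT [X in (_ <= _ + _ * X)%E]hX EFinD EFinM -prbE.
apply: ge0_le_integral => //.
- by move=> x _; rewrite lee_fin addr_ge0// mulr_ge0.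
- by apply/measurable_EFinP; apply: measurable_funD => //; apply: measurable_funM => //; exact: measurable_indic.
- exact: measurable_fun_xsection.
- move=> x _ /=; have mS := measurable_xsection x mA.
  have mES : measurable (E @^-1` xsection A x) by rewrite -[X in measurable X]setTI; exact: mE.
  rewrite hE prbE// lee_fin; apply: (le_trans (sec x)).
  rewrite (_ : [set w | A (x, E w)] = E @^-1` xsection A x)//.
  by apply/seteqP; split => w /=; rewrite /xsection/= inE.
Qed.

(* Reverse Markov inequality: the average of the indicators is at most 1 on G and c off G. *)
Lemma prb_weighted_events (R : realType) (d : measure_display) (Om : measurableType d)
    (P : probability Om R) (I : finType) (wt : I -> R) (A : I -> set Om) (G : set Om) (c q : R) :
  (forall i, 0 <= wt i) -> \sum_i wt i = 1 -> (forall i, measurable (A i)) -> measurable G ->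
  0 <= c -> (forall i, q <= prb P (A i)) ->
  (forall w, c < \sum_i wt i * \1_(A i) w -> G w) ->
  q - c <= prb P G.
Proof.
move=> wt0 wt1 mA mG c0 qA hG; rewrite lerBlDr -lee_fin EFinD -prbE//.
have -> : (P G + c%:E)%E = (\int[P]_w ((\1_G w)%:E + c%:E))%E.
  rewrite ge0_integralD//; last by apply/measurable_EFinP; exact: measurable_indic.
  by rewrite integral_indic// setIT integral_cst// [X in (_ = _ + _ * X)%E](probability_setT P) mule1.
apply: (@le_trans _ _ (\int[P]_w (\sum_i (wt i * \1_(A i) w)%:E))%E).
  have mF i : measurable_fun setT (fun w => (wt i * \1_(A i) w)%:E).
    by apply/measurable_EFinP; apply: measurable_funM => //; exact: measurable_indic.
  have F0 i w : setT w -> (0 <= (wt i * \1_(A i) w)%:E)%E by rewrite lee_fin mulr_ge0.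
  rewrite (ge0_integral_sum P measurableT mF F0).
  have -> : (\sum_i \int[P]_w (wt i * \1_(A i) w)%:E)%E = (\sum_i wt i * prb P (A i))%:E.
    rewrite -sumEFin; apply: eq_bigr => i _.
    under eq_integral do rewrite EFinM.
    rewrite ge0_integralZl//; last by rewrite lee_fin.
      by rewrite integral_indic// setIT EFinM -prbE.
    by apply/measurable_EFinP; exact: measurable_indic.
  rewrite lee_fin -[leLHS]mul1r -wt1 mulr_suml; apply: ler_sum => i _.
  exact: ler_wpM2l.
apply: ge0_le_integral => //.
- by move=> w _; rewrite sumEFin lee_fin sumr_ge0// => i _; rewrite mulr_ge0.
- under eq_fun do rewrite sumEFin.
  apply/measurable_EFinP; apply: measurable_sum => i; apply: measurable_funM => //.
- by apply/measurable_EFinP; apply: measurable_funD => //; exact: measurable_indic.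
- move=> w _; rewrite sumEFin -EFinD lee_fin.
  have [/hG h|h] := ltP c (\sum_i wt i * \1_(A i) w); last first.
    by rewrite (le_trans h)// lerDr.
  rewrite [\1_G w]indicE mem_set//= -wt1.
  by apply: ler_wpDr => //; apply: ler_sum => i _; rewrite ler_piMr.
Qed.

Lemma prb_markov_sum (R : realType) (d : measure_display) (Om : measurableType d)
    (P : probability Om R) (I : finType) (Y : I -> Om -> R) (s2 : I -> R) (c : R) :
  (forall i, measurable_fun setT (Y i)) -> 0 < c ->
  (forall i, (\int[P]_w (Y i w ^+ 2)%:E <= (s2 i)%:E)%E) ->
  prb P [set w | c <= \sum_i Y i w ^+ 2] <= (\sum_i s2 i) / c.
Proof.
move=> mY c0 hY.
have mS : measurable_fun setT (fun w => \sum_i Y i w ^+ 2).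
  by apply: measurable_sum => i; exact: measurable_funX.
have mG : measurable [set w | c <= \sum_i Y i w ^+ 2].
  rewrite (_ : [set w | _] = ~` [set w | \sum_i Y i w ^+ 2 < c]).
    by apply: measurableC; exact: measurable_lt_set.
  by apply/seteqP; split => w /=; [rewrite leNgt => /negP|move=> /negP; rewrite -leNgt].
rewrite ler_pdivlMr// -lee_fin mulrC EFinM -prbE//.
apply: (@le_trans _ _ (\int[P]_w (\sum_i (Y i w ^+ 2)%:E))%E); last first.
  have mF i : measurable_fun setT (fun w => (Y i w ^+ 2)%:E).
    by apply/measurable_EFinP; exact: measurable_funX.
  have F0 i w : setT w -> (0 <= (Y i w ^+ 2)%:E)%E by rewrite lee_fin sqr_ge0.
  rewrite (ge0_integral_sum P measurableT mF F0).
  by rewrite -sumEFin; apply: lee_sum => i _.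
set G := [set w | _] in mG *.
have -> : P G = (\int[P]_w (\1_G w)%:E)%E by rewrite integral_indic// setIT.
rewrite -ge0_integralZl//; last 2 first.
- by apply/measurable_EFinP; exact: measurable_indic.
- by rewrite lee_fin ltW.
apply: ge0_le_integral => //.
- by move=> w _; rewrite -EFinM lee_fin mulr_ge0// ltW.
- by apply/measurable_EFinP; apply: measurable_funM => //; exact: measurable_indic.
- by under eq_fun do rewrite sumEFin; exact/measurable_EFinP.
- move=> w _; rewrite sumEFin -EFinM lee_fin indicE.
  case: (boolP (w \in G)); rewrite ?inE /= ?mulr1 ?mulr0// => _.
  by rewrite sumr_ge0// => i _; rewrite sqr_ge0.
Qed.

Definition qform (R : realType) (k : nat) (Sigma : 'M[R]_k) (u : 'cV[R]_k) : R :=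
  vdot u (Sigma *m u).

(** The mean of |D^T X|^2 for X ~ N(0, Sigma), written by columns because [is_gaussian0] describes X
    through its one-dimensional projections. *)
Definition trform (R : realType) (k m : nat) (Sigma : 'M[R]_k) (D : 'M[R]_(k, m)) : R :=
  \sum_j qform Sigma (col j D).

Lemma trformE (R : realType) (k m : nat) (Sigma : 'M[R]_k) (D : 'M[R]_(k, m)) :
  \tr (D^T *m Sigma *m D) = trform Sigma D.
Proof.
rewrite /mxtrace /trform; apply: eq_bigr => j _.
rewrite -mulmxA mxE /qform /vdot; apply: eq_bigr => i _.
by rewrite !mxE; congr (_ * _); apply: eq_bigr => l _; rewrite !mxE.
Qed.

Lemma trmx_mul_coord (R : realType) (k m : nat) (D : 'M[R]_(k, m)) (x : 'cV[R]_k) j :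
  (D^T *m x) j 0 = vdot (col j D) x.
Proof. by rewrite mxE /vdot; apply: eq_bigr => i _; rewrite !mxE. Qed.

Section GaussianVector.
Variables (R : realType) (d : measure_display) (Om : measurableType d) (P : probability Om R)
  (k : nat) (Sigma : 'M[R]_k) (X : Om -> 'cV[R]_k).
Hypothesis psdS : psd Sigma.
Hypothesis gX : is_gaussian0 P Sigma X.

Lemma gaussian_measurable u : measurable_fun setT (fun w => vdot u (X w)).
Proof.
apply: measurable_sum => i; apply: measurable_funM => //.
exact: (@rmeasurable_coord _ _ _ _ _ (fun (i : 'I_k) (v : 'cV[R]_k) => v i 0) X i gX.1).
Qed.

Let mYX := gaussian_measurable.

Lemma gaussian_cdf u : 0 < qform Sigma u -> forall t : R,
  P [set w | vdot u (X w) <= t] =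
  (\int[lebesgue_measure]_(x in `]-oo, t]) (normal_pdf 0 (Num.sqrt (qform Sigma u)) x)%:E)%E.
Proof. by move=> s0; case: (gX.2 u) => _ /(_ s0). Qed.

Lemma gaussian_zero_set u : measurable [set w | vdot u (X w) = 0].
Proof.
rewrite (_ : [set w | _] = [set w | vdot u (X w) <= 0] `\` [set w | vdot u (X w) < 0]).
  by apply: measurableD; [exact: measurable_le_set|exact: measurable_lt_set].
apply/seteqP; split => w /=; first by move=> ->; rewrite ltxx lexx.
by move=> [h1 /negP]; rewrite -leNgt => h2; apply/eqP; rewrite eq_le h1.
Qed.

Lemma gaussian_vector_second_moment u :
  (\int[P]_w (vdot u (X w) ^+ 2)%:E <= (6 * qform Sigma u)%:E)%E.
Proof.
have := psdS.2 u; rewrite -/(qform Sigma u) le_eqVlt => /orP[/eqP q0|q0]; last first.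
  have s0 : 0 < Num.sqrt (qform Sigma u) by rewrite sqrtr_gt0.
  by have := gaussian_second_moment (mYX u) s0 (gaussian_cdf q0); rewrite sqr_sqrtr// ltW.
have P1 : P [set w | vdot u (X w) = 0] = 1%E by apply: (gX.2 u).1.
rewrite -q0 mulr0 (ae_eq_integral (cst 0%E))//; last 2 first.
- by apply/measurable_EFinP; exact: measurable_funX.
- exists (~` [set w | vdot u (X w) = 0]); split.
  + exact/measurableC/gaussian_zero_set.
  + by apply: (eq_trans (probability_setC P (gaussian_zero_set u))); rewrite P1 subee.
  + by move=> w /= h h0; apply: h => _; rewrite h0 expr0n.
by rewrite integral0.
Qed.

Lemma gaussian_vector_anticoncentration u : 0 < qform Sigma u ->
  2^-1 <= prb P [set w | qform Sigma u / 4 <= vdot u (X w) ^+ 2].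
Proof.
move=> q0; have s0 : 0 < Num.sqrt (qform Sigma u) by rewrite sqrtr_gt0.
have := gaussian_anticoncentration (mYX u) s0 (gaussian_cdf q0).
rewrite (_ : [set w | _ <= `|_|] = [set w | qform Sigma u / 4 <= vdot u (X w) ^+ 2])//.
have e w : (Num.sqrt (qform Sigma u) / 2 <= `|vdot u (X w)|) = (qform Sigma u / 4 <= vdot u (X w) ^+ 2).
  rewrite -(@ler_pXn2r _ 2) ?nnegrE ?divr_ge0// real_normK ?num_real// expr_div_n sqr_sqrtr; last exact: ltW.
  by have -> : 2 ^+ 2 = 4 :> R by ring.
by apply/seteqP; split => w /=; rewrite e.
Qed.

(** Applied to a column of [D], it keeps |D^T X| away from 0 up to an arbitrarily small probability;
    [r ^+ 2] then serves as the slack in [depth_maximizer_error]. *)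
Lemma gaussian_nonzero u (e : R) : 0 < qform Sigma u -> 0 < e ->
  exists2 r, 0 < r & 1 - e < prb P [set w | r < `|vdot u (X w)|].
Proof.
move=> q0 e0; have s0 : 0 < Num.sqrt (qform Sigma u) by rewrite sqrtr_gt0.
pose F n := [set w | n.+1%:R^-1 < `|vdot u (X w)|].
have mF n : measurable (F n).
  rewrite (_ : F n = ~` [set w | `|vdot u (X w)| <= n.+1%:R^-1]).
    by apply/measurableC/measurable_le_set/measurableT_comp.
  by apply/seteqP; split => w /=; rewrite /F/= ltNge; [move/negP|move=> h; apply/negP].
have UF : \bigcup_n F n = ~` [set w | vdot u (X w) = 0].
  apply/seteqP; split => w /=.
    move=> [n _]; rewrite /F /= => h h0; move: h.
    by rewrite h0 normr0 ltNge invr_ge0 ler0n.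
  move=> /eqP h; exists (Num.truncn (`|vdot u (X w)|^-1)) => //=.
  rewrite /F /= -[ltRHS]invrK ltf_pV2 ?posrE ?invr_gt0 ?normr_gt0//.
  exact: truncnS_gt.
have [|||n hn] := @prb_bigcup_ge _ _ _ P F (1 - e).
- exact: mF.
- move=> n n' nn'; apply/subsetPset => w; rewrite /F /=; apply: le_lt_trans.
  by rewrite lef_pV2 ?posrE// ler_nat ltnS.
- rewrite UF prbC; last exact: gaussian_zero_set.
  have -> : prb P [set w | vdot u (X w) = 0] = 0.
    rewrite /prb (gaussian_law (mYX u) (gaussian_cdf q0) (A := [set 0])); last exact: measurable_set1.
    by rewrite /normal_prob integral_set1.
  lra.
- by exists n.+1%:R^-1.
Qed.

Lemma gaussian_matrix_upper m (D : 'M[R]_(k, m)) (c : R) : 0 < c ->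
  prb P [set w | c <= \sum_j (D^T *m X w) j 0 ^+ 2] <= 6 * trform Sigma D / c.
Proof.
move=> c0.
have := @prb_markov_sum _ _ _ P _ (fun j w => vdot (col j D) (X w))
  (fun j => 6 * qform Sigma (col j D)) c (fun j => mYX (col j D)) c0
  (fun j => gaussian_vector_second_moment (col j D)).
rewrite -mulr_sumr (_ : [set w | _ <= \sum_j vdot _ _ ^+ 2] = [set w | c <= \sum_j (D^T *m X w) j 0 ^+ 2])//.
have e w : \sum_j vdot (col j D) (X w) ^+ 2 = \sum_j (D^T *m X w) j 0 ^+ 2.
  by apply: eq_bigr => j _; rewrite trmx_mul_coord.
by apply/seteqP; split => w /=; rewrite e.
Qed.

(** The coordinates of D^T X are correlated, so reverse Markov is applied to the indicators of the
    one-dimensional events, weighted by variance. Their average has mean at least 1/2, hence exceeds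
    1/4 with probability at least 1/4, and then |D^T X|^2 is at least a quarter of t / 4. *)
Lemma gaussian_matrix_lower m (D : 'M[R]_(k, m)) : 0 < trform Sigma D ->
  4^-1 <= prb P [set w | trform Sigma D / 16 <= \sum_j (D^T *m X w) j 0 ^+ 2].
Proof.
move=> t0; set t := trform Sigma D in t0 *.
have q0 j : 0 <= qform Sigma (col j D) by exact: psdS.2.
have mle (f : Om -> R) (c : R) : measurable_fun setT f -> measurable [set w | c <= f w].
  move=> mf; rewrite (_ : [set w | _] = ~` [set w | f w < c]).
    by apply: measurableC; exact: measurable_lt_set.
  by apply/seteqP; split => w /=; rewrite leNgt; [move/negP|move=> h; apply/negP].
have -> : 4^-1 = 2^-1 - 4^-1 :> R by lra.
apply: (@prb_weighted_events _ _ _ P _ (fun j => qform Sigma (col j D) / t)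
  (fun j => [set w | qform Sigma (col j D) / 4 <= vdot (col j D) (X w) ^+ 2])) => //.
- by move=> j; apply: divr_ge0 => //; exact: ltW.
- by rewrite -mulr_suml -/(trform Sigma D) -/t divff// gt_eqF.
- by move=> j; apply: mle; exact: measurable_funX.
- apply: mle; apply: measurable_sum => j; apply: measurable_funX.
  by under eq_fun do rewrite trmx_mul_coord; exact: mYX.
- move=> j; have := q0 j; rewrite le_eqVlt => /orP[/eqP <-|]; last first.
    exact: gaussian_vector_anticoncentration.
  rewrite (_ : [set w | _] = setT) ?prbT; first by lra.
  by apply/seteqP; split => // w _ /=; rewrite mul0r sqr_ge0.
- move=> w h.
  have h1 : t * \sum_j (qform Sigma (col j D) / t * \1_[set w | qform Sigma (col j D) / 4 <= vdot (col j D) (X w) ^+ 2] w)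
      <= 4 * \sum_j (D^T *m X w) j 0 ^+ 2.
    rewrite !mulr_sumr; apply: ler_sum => j _; rewrite trmx_mul_coord indicE.
    rewrite mulrA mulrCA mulfV ?gt_eqF// mulr1.
    case: (boolP (w \in _)); rewrite ?inE /= ?mulr1 ?mulr0; first by lra.
    by move=> _; rewrite mulr_ge0// sqr_ge0.
  have : t * 4^-1 < t * \sum_j (qform Sigma (col j D) / t * \1_[set w | qform Sigma (col j D) / 4 <= vdot (col j D) (X w) ^+ 2] w).
    by rewrite ltr_pM2l.
  rewrite /=; lra.
Qed.
End GaussianVector.

Lemma vnorm_sqr (R : realType) (k : nat) (v : 'cV[R]_k) : vnorm v ^+ 2 = \sum_i v i 0 ^+ 2.
Proof. by rewrite sqr_sqrtr// sumr_ge0// => i _; rewrite sqr_ge0. Qed.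

Lemma vnorm_ge0 (R : realType) (k : nat) (v : 'cV[R]_k) : 0 <= vnorm v.
Proof. exact: sqrtr_ge0. Qed.

Lemma vnorm_gt0 (R : realType) (k : nat) (v : 'cV[R]_k) : v != 0 -> 0 < vnorm v.
Proof.
move=> v0; rewrite sqrtr_gt0 lt_neqAle sumr_ge0 ?andbT//; last by move=> i _; rewrite sqr_ge0.
apply: contra v0 => /eqP/esym h; apply/eqP/matrixP => i j; rewrite ord1 mxE.
apply/eqP; rewrite -sqrf_eq0; apply/eqP.
have := psumr_eq0P (fun (i : 'I_k) _ => sqr_ge0 (v i 0)) h.
exact.
Qed.

Lemma vnormN (R : realType) (k : nat) (v : 'cV[R]_k) : vnorm (- v) = vnorm v.
Proof. by congr Num.sqrt; apply: eq_bigr => i _; rewrite mxE sqrrN. Qed.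

Lemma vdotNl (R : realType) (k : nat) (u v : 'cV[R]_k) : vdot (- u) v = - vdot u v.
Proof. by rewrite /vdot -sumrN; apply: eq_bigr => i _; rewrite mxE mulNr. Qed.

Lemma vdot0l (R : realType) (k : nat) (v : 'cV[R]_k) : vdot 0 v = 0.
Proof. by apply: big1 => i _; rewrite mxE mul0r. Qed.

Section Spherical.
Variables (R : realType) (d : measure_display) (Om : measurableType d) (P : probability Om R)
  (m : nat) (f : R -> R) (E : Om -> 'cV[R]_m) (c1 c2 : R).
Hypothesis m_gt0 : (0 < m)%N.
Hypothesis df : is_density f.
Hypothesis fge : forall t : R, `|t| <= c1 -> c2 <= f t.
Hypothesis c2_ge0 : 0 <= c2.
Hypothesis sE : is_spherical P f E.

Lemma spherical_measurable u : measurable_fun setT (fun w => vdot u (E w)).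
Proof.
apply: measurable_sum => i; apply: measurable_funM => //.
exact: (@rmeasurable_coord _ _ _ _ _ (fun (i : 'I_m) (v : 'cV[R]_m) => v i 0) E i sE.1).
Qed.

(** The half-spaces of [u] and [- u] cover the space, and they have equal probability because the
    marginal law does not depend on the direction. *)
Lemma spherical_halfspace u : u != 0 -> 2^-1 <= prb P [set w | vdot u (E w) <= 0].
Proof.
move=> u0; pose A u := [set w | vdot u (E w) <= 0].
have mA v : measurable (A v) by exact: measurable_le_set (spherical_measurable v).
have PA v : v != 0 -> P (A v) = (\int[lebesgue_measure]_(s in `]-oo, 0%R]) (f s)%:E)%E.
  move=> v0; rewrite -(sE.2 v v0 0) /A; congr (P _).
  by apply/seteqP; split => w /=; rewrite mul0r.
have : prb P (A u `|` A (- u)) <= prb P (A u) + prb P (A (- u)) by exact: prbU_le.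
have -> : A u `|` A (- u) = setT.
  apply/seteqP; split => // w _; rewrite /A /= vdotNl oppr_le0.
  by have [h|/ltW h] := leP (vdot u (E w)) 0; [left|right].
have -> : prb P (A (- u)) = prb P (A u) by rewrite /prb !PA ?oppr_eq0.
rewrite prbT /A; lra.
Qed.

Let spherical_gain_neq0 u (h : R) : u != 0 -> 0 <= h <= c1 ->
  2^-1 + c2 * h <= prb P [set w | vdot u (E w) <= h * vnorm u].
Proof.
move=> u0 /andP[h0 hc].
have [mf [f0 _]] := df.
have mfE (D : set R) : measurable_fun D (fun s => (f s)%:E).
  by apply/measurable_EFinP; exact: measurable_funTS.
rewrite -lee_fin -prbE; last exact: measurable_le_set (spherical_measurable u).
rewrite (sE.2 u u0 h).
have -> : `]-oo, h]%classic = `]-oo, 0%R]%classic `|` `]0%R, h]%classic.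
  apply/seteqP; split => x /=; rewrite !in_itv/=.
    by move=> xh; have [x0|x0] := leP x 0; [left|right; rewrite xh].
  by move=> [x0|/andP[]//]; exact: le_trans x0 h0.
rewrite ge0_integral_setU//; last 3 first.
- exact: mfE.
- by move=> x _; rewrite lee_fin.
- rewrite disj_set2E; apply/eqP/seteqP; split => x //=; rewrite !in_itv/=.
  by move=> [h1 /andP[h2 _]]; move: h2; rewrite ltNge h1.
rewrite EFinD; apply: leeD.
  have <- : P [set w | vdot u (E w) <= 0 * vnorm u] =
      (\int[lebesgue_measure]_(s in `]-oo, 0%R]) (f s)%:E)%E by exact: sE.2.
  rewrite (_ : [set w | _] = [set w | vdot u (E w) <= 0]).
    rewrite prbE; last exact: measurable_le_set (spherical_measurable u).
    by rewrite lee_fin spherical_halfspace.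
  by apply/seteqP; split => w /=; rewrite mul0r.
apply: (@le_trans _ _ (\int[lebesgue_measure]_(s in `]0%R, h]) c2%:E)%E).
  have lI : @lebesgue_measure R `]0%R, h]%classic = h%:E.
    rewrite lebesgue_measure_itv/= lte_fin.
    have [h1|h1] := ltP 0 h; first by rewrite sube0.
    by congr EFin; apply/eqP; rewrite eq_le h0 h1.
  by rewrite integral_cst// [X in (_ <= _ * X)%E]lI -EFinM.
apply: ge0_le_integral => //; first exact: mfE.
move=> x /=; rewrite in_itv/= => /andP[x0 xh]; rewrite lee_fin fge//.
by rewrite ger0_norm ?(ltW x0)//; exact: le_trans xh hc.
Qed.

Lemma spherical_gain u (h th : R) : 0 <= h <= c1 -> 0 < th -> h * vnorm u < th ->
  2^-1 + c2 * h <= prb P [set w | vdot u (E w) < th].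
Proof.
move=> hh th0 hu; have [->|u0] := eqVneq u 0; last first.
  apply: (le_trans (spherical_gain_neq0 u0 hh)); apply: prb_le.
  - exact: measurable_le_set (spherical_measurable u).
  - exact: measurable_lt_set (spherical_measurable u).
  - by move=> w /= h1; exact: le_lt_trans h1 hu.
(* For [u = 0] the event is sure; a nonzero vector is used only to see that the left side is at most
   1. *)
pose v : 'cV[R]_m := const_mx 1.
have v0 : v != 0.
  apply/eqP => /matrixP/(_ (Ordinal m_gt0) 0); rewrite !mxE => /eqP.
  by rewrite oner_eq0.
have -> : [set w | vdot 0 (E w) < th] = setT.
  by apply/seteqP; split => // w _ /=; rewrite vdot0l.
rewrite prbT; apply: (le_trans (spherical_gain_neq0 v0 hh)); apply: prb_le1.
exact: measurable_le_set (spherical_measurable v).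
Qed.
End Spherical.

(** * Population margins *)

Lemma vdotC (R : realType) (k : nat) (u v : 'cV[R]_k) : vdot u v = vdot v u.
Proof. by apply: eq_bigr => i _; rewrite mulrC. Qed.

Lemma vdotE (R : realType) (k : nat) (u v : 'cV[R]_k) : vdot u v = (u^T *m v) 0 0.
Proof. by rewrite mxE; apply: eq_bigr => i _; rewrite mxE. Qed.

Lemma vdot_mulmx (R : realType) (k l : nat) (M : 'M[R]_(k, l)) u v :
  vdot u (M *m v) = vdot (M^T *m u) v.
Proof. by rewrite !vdotE trmx_mul trmxK mulmxA. Qed.

Lemma vnorm_sqr_vdot (R : realType) (k : nat) (v : 'cV[R]_k) : vnorm v ^+ 2 = vdot v v.
Proof. by rewrite vnorm_sqr; apply: eq_bigr => i _; rewrite expr2. Qed.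

Lemma vdotBr (R : realType) (k : nat) (u v w : 'cV[R]_k) : vdot u (v - w) = vdot u v - vdot u w.
Proof. by rewrite !vdotE mulmxBr !mxE. Qed.

Lemma vdotBl (R : realType) (k : nat) (u v w : 'cV[R]_k) : vdot (v - w) u = vdot v u - vdot w u.
Proof. by rewrite vdotC vdotBr !(vdotC u). Qed.

Lemma vdotZr (R : realType) (k : nat) (a : R) (u v : 'cV[R]_k) : vdot u (a *: v) = a * vdot u v.
Proof. by rewrite !vdotE -scalemxAr mxE. Qed.

Lemma vdotZl (R : realType) (k : nat) (a : R) (u v : 'cV[R]_k) : vdot (a *: u) v = a * vdot u v.
Proof. by rewrite vdotC vdotZr vdotC. Qed.

Lemma vdot_le_vnorm (R : realType) (k : nat) (u v : 'cV[R]_k) : vdot u v <= vnorm u * vnorm v.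
Proof.
have [->|u0] := eqVneq u 0.
  by rewrite vdot0l mulr_ge0 ?vnorm_ge0.
have [->|v0] := eqVneq v 0.
  by rewrite vdotC vdot0l mulr_ge0 ?vnorm_ge0.
have a0 := vnorm_gt0 u0; have b0 := vnorm_gt0 v0.
have := sqr_ge0 (vnorm (vnorm v *: u - vnorm u *: v)).
rewrite vnorm_sqr_vdot vdotBr !vdotBl !vdotZr !vdotZl -!vnorm_sqr_vdot (vdotC v u).
set a := vnorm u in a0 *; set b := vnorm v in b0 *; set s := vdot u v => h.
have : 0 <= 2 * (a * b) * (a * b - s) by nra.
by rewrite pmulr_rge0 ?mulr_gt0// subr_ge0.
Qed.

Lemma opnorm_bound (R : realType) (k : nat) (A : 'M[R]_k) (v : 'cV[R]_k) :
  vnorm (A *m v) <= opnorm A * vnorm v.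
Proof.
(* The Frobenius bound shows that the set in [opnorm] is bounded, so that its [sup] is an upper
   bound. *)
have Avle (w : 'cV[R]_k) : vnorm (A *m w) <= Num.sqrt (frob2 A) * vnorm w.
  rewrite -(@ler_pXn2r _ 2) ?nnegrE ?mulr_ge0 ?vnorm_ge0 ?sqrtr_ge0//.
  rewrite exprMn [Num.sqrt (frob2 A) ^+ 2]sqr_sqrtr; last first.
    by apply: sumr_ge0 => i _; apply: sumr_ge0 => j _; exact: sqr_ge0.
  rewrite vnorm_sqr /frob2 mulr_suml; apply: ler_sum => i _.
  have -> : (A *m w) i 0 = vdot (row i A)^T w.
    by rewrite mxE; apply: eq_bigr => j _; rewrite !mxE.
  have -> : \sum_j A i j ^+ 2 = vnorm (row i A)^T ^+ 2.
    by rewrite vnorm_sqr; apply: eq_bigr => j _; rewrite !mxE.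
  rewrite -exprMn -[_ ^+ 2]real_normK ?num_real//.
  rewrite ler_pXn2r ?nnegrE ?mulr_ge0 ?vnorm_ge0//.
  rewrite ler_norml vdot_le_vnorm andbT lerNl -vdotNl -(vnormN (row i A)^T).
  exact: vdot_le_vnorm.
have [->|v0] := eqVneq v 0.
  have n0 l : vnorm (0 : 'cV[R]_l) = 0.
    by rewrite /vnorm big1 ?sqrtr0// => i _; rewrite mxE expr0n.
  by rewrite mulmx0 !n0 mulr0.
have a0 := vnorm_gt0 v0.
pose w := (vnorm v)^-1 *: v.
have nZ l (c : R) (x : 'cV[R]_l) : 0 <= c -> vnorm (c *: x) = c * vnorm x.
  move=> c0; apply/eqP; rewrite -(@eqrXn2 _ 2) ?mulr_ge0 ?vnorm_ge0//.
  by rewrite exprMn !vnorm_sqr_vdot vdotZr vdotZl mulrA expr2.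
have w1 : vnorm w = 1 by rewrite nZ ?invr_ge0 ?vnorm_ge0// mulVf// gt_eqF.
have : vnorm (A *m w) <= opnorm A.
  apply: ub_le_sup; last by exists w.
  exists (Num.sqrt (frob2 A)) => _ [x /= x1 <-].
  by have := Avle x; rewrite x1 mulr1.
by rewrite -scalemxAr nZ ?invr_ge0 ?vnorm_ge0// mulrC ler_pdivrMr.
Qed.

Lemma opnorm_ge0 (R : realType) (k : nat) (A : 'M[R]_k) : (0 < k)%N -> 0 <= opnorm A.
Proof.
move=> k0; pose v : 'cV[R]_k := const_mx 1.
have v0 : v != 0.
  apply/eqP => /matrixP/(_ (Ordinal k0) 0); rewrite !mxE => /eqP.
  by rewrite oner_eq0.
have := opnorm_bound A v; rewrite -ler_pdivrMr ?vnorm_gt0//.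
by apply: le_trans; rewrite divr_ge0 ?vnorm_ge0.
Qed.

(* psd_sqrt is 0 when no square root exists, so no spectral theorem is needed. *)
Lemma psd_sqrt_cases (R : realType) (k : nat) (A : 'M[R]_k) :
  psd_sqrt A = 0 \/ (psd (psd_sqrt A) /\ psd_sqrt A *m psd_sqrt A = A).
Proof.
rewrite /psd_sqrt; case: xgetP => [S _ /= hS|_]; first by right.
by left.
Qed.

Lemma psd_sqrt_sym (R : realType) (k : nat) (A : 'M[R]_k) : (psd_sqrt A)^T = psd_sqrt A.
Proof. by have [->|[[h _] _]] := psd_sqrt_cases A; first exact: trmx0. Qed.

Lemma vnorm_psd_sqrt (R : realType) (k : nat) (A : 'M[R]_k) (v : 'cV[R]_k) : (0 < k)%N ->
  vnorm (psd_sqrt A *m v) <= Num.sqrt (opnorm A) * vnorm v.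
Proof.
move=> k0; have o0 := opnorm_ge0 A k0.
rewrite -(@ler_pXn2r _ 2) ?nnegrE ?mulr_ge0 ?vnorm_ge0 ?sqrtr_ge0//.
rewrite exprMn [Num.sqrt (opnorm A) ^+ 2]sqr_sqrtr// [leLHS]vnorm_sqr_vdot.
have [->|[[_ _] h]] := psd_sqrt_cases A.
  by rewrite mul0mx vdot0l mulr_ge0// sqr_ge0.
rewrite vdot_mulmx psd_sqrt_sym mulmxA h vdotC.
apply: (le_trans (vdot_le_vnorm _ _)); rewrite mulrC expr2 mulrA.
by rewrite ler_wpM2r ?vnorm_ge0// opnorm_bound.
Qed.

Section Population.
Variables (R : realType) (d : measure_display) (Om : measurableType d) (P : probability Om R)
  (p m : nat) (Sigma : 'M[R]_p) (Gamma : 'M[R]_m) (f : R -> R)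
  (X : Om -> 'cV[R]_p) (E : Om -> 'cV[R]_m) (c1 c2 : R).
Hypothesis m_gt0 : (0 < m)%N.
Hypothesis psdS : psd Sigma.
Hypothesis df : is_density f.
Hypothesis fge : forall t : R, `|t| <= c1 -> c2 <= f t.
Hypothesis c1_ge0 : 0 <= c1.
Hypothesis c2_ge0 : 0 <= c2.
Hypothesis gX : is_gaussian0 P Sigma X.
Hypothesis sE : is_spherical P f E.
Hypothesis indXE : forall (A1 : set 'cV[R]_p) (A2 : set 'cV[R]_m),
  vec_borel A1 -> vec_borel A2 ->
  P (X @^-1` A1 `&` E @^-1` A2) = (P (X @^-1` A1) * P (E @^-1` A2))%E.

Local Notation xi := (fun w => psd_sqrt Gamma *m E w).
Let cX (i : 'I_p) (v : 'cV[R]_p) : R := v i 0.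
Let cE (i : 'I_m) (v : 'cV[R]_m) : R := v i 0.
Let TX := borel_space cX.
Let TE := borel_space cE.

Let mX : measurable_fun setT (X : Om -> TX).
Proof. exact: (@rmeasurable_fun _ _ _ _ _ cX X gX.1). Qed.

Let mE : measurable_fun setT (E : Om -> TE).
Proof. exact: (@rmeasurable_fun _ _ _ _ _ cE E sE.1). Qed.

Let msnd i : measurable_fun setT (fun z : TX * TE => cE i z.2).
Proof. exact: (measurableT_comp (@measurable_coord _ _ _ cE i) measurable_snd). Qed.

Let mlin (l : nat) (M : 'M[R]_(l, p)) j : measurable_fun setT (fun x : TX => (M *m x) j 0).
Proof.
under eq_fun do rewrite mxE; apply: measurable_sum => i; apply: measurable_funM => //.
exact: (@measurable_coord _ _ _ cX i).
Qed.

Let mnoise (U : 'M[R]_(p, m)) :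
  measurable_fun setT (fun z : TX * TE => vdot (psd_sqrt Gamma *m (U^T *m z.1)) z.2).
Proof.
apply: measurable_sum => i; apply: measurable_funM => //; last exact: msnd.
by under eq_fun do rewrite mulmxA; exact: (measurableT_comp (mlin _ i) measurable_fst).
Qed.

Lemma noiseE (v : 'cV[R]_m) w : vdot v (xi w) = vdot (psd_sqrt Gamma *m v) (E w).
Proof. by rewrite vdot_mulmx psd_sqrt_sym. Qed.

(** This bounds the depth of the true [B] from below. The slack [r] makes the event open, as the
    deviation bound requires, and covers the degenerate directions where the noise term vanishes. *)
Lemma population_halfspace (U : 'M[R]_(p, m)) (r : R) : 0 < r ->
  2^-1 <= prb P [set w | vdot (U^T *m X w) (xi w) < r].
Proof.
move=> r0.
have := @prb_sections_ge _ _ _ _ Om TX TE P X E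
  [set z | vdot (psd_sqrt Gamma *m (U^T *m z.1)) z.2 < r] set0 2^-1 0 mX mE indXE.
rewrite mul0r addr0 /=.
have -> : [set w | vdot (U^T *m X w) (xi w) < r] =
    [set w | vdot (psd_sqrt Gamma *m (U^T *m X w)) (E w) < r].
  by apply/seteqP; split => w /=; rewrite noiseE.
apply => //; first exact: measurable_lt_set (mnoise U).
move=> x; rewrite mul0r addr0.
have h0 : 0 <= (0 : R) <= c1 by rewrite lexx.
have := spherical_gain m_gt0 df fge c2_ge0 sE (u := psd_sqrt Gamma *m (U^T *m x)) h0 r0.
by rewrite mulr0 addr0 mul0r; apply.
Qed.

(** The tangent plane at [D0] of D |-> |D^T x|^2; [marginE] gives its defect exactly. *)
Definition margin (D D0 : 'M[R]_(p, m)) (x : 'cV[R]_p) : R :=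
  2 * vdot (D^T *m x) (D0^T *m x) - vnorm (D0^T *m x) ^+ 2.

Lemma marginE D D0 x :
  margin D D0 x = vnorm (D^T *m x) ^+ 2 - vnorm ((D - D0)^T *m x) ^+ 2.
Proof.
rewrite /margin linearB/= mulmxBl !vnorm_sqr_vdot vdotBr !vdotBl.
by rewrite (vdotC (D0^T *m x) (D^T *m x)); ring.
Qed.

Let mmargin D D0 : measurable_fun setT (fun x : TX => margin D D0 x).
Proof.
under eq_fun do rewrite marginE !vnorm_sqr.
apply: measurable_funB; apply: measurable_sum => j; apply: measurable_funX; exact: mlin.
Qed.

(** On [G] one has |v| >= tau / 4 and a defect below half of |v|^2, so the threshold for <v, xi>
    exceeds |v|^2 / 4 >= tau |v| / 16, which is at least h times the norm of Gamma^{1/2} v. Off [G]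
    the second event keeps the conditional probability at 1/2. *)
Lemma population_gain (D D0 : 'M[R]_(p, m)) (tau h r : R) :
  0 < tau -> trform Sigma D = tau ^+ 2 -> trform Sigma (D - D0) <= tau ^+ 2 / 1600 ->
  0 <= h <= c1 -> 16 * h * Num.sqrt (opnorm Gamma) <= tau -> 0 < r ->
  2^-1 + c2 * h / 8 <=
  prb P [set w | 2 * vdot (D^T *m X w) (xi w) < margin D D0 (X w) \/
                 2 * vdot (D^T *m X w) (xi w) < r].
Proof.
move=> tau0 trD trD0 hh hs r0.
have t20 : 0 < tau ^+ 2 by rewrite exprn_gt0.
pose Glow : set TX := [set x | \sum_j ((D^T *m x) j 0) ^+ 2 < tau ^+ 2 / 16].
pose Gup : set TX := [set x | \sum_j (((D - D0)^T *m x) j 0) ^+ 2 < tau ^+ 2 / 32].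
have mlow : measurable Glow.
  by apply: measurable_lt_set; apply: measurable_sum => j; apply: measurable_funX; exact: mlin.
have mup : measurable Gup.
  by apply: measurable_lt_set; apply: measurable_sum => j; apply: measurable_funX; exact: mlin.
pose G := ~` Glow `&` Gup.
have mG : measurable G by apply: measurableI => //; exact: measurableC.
(* Markov's inequality loses 6 * 32 / 1600 = 0.12 out of 1/4; the net precision 1600 is fine enough
   to leave 1/8. *)
have pG : 8^-1 <= prb P (X @^-1` G).
  have mp (A : set TX) : measurable A -> measurable (X @^-1` A).
    by move=> mA; rewrite -[X in measurable X]setTI; exact: mX.
  have h1 : 4^-1 <= prb P (X @^-1` (~` Glow)).
    have t0 : 0 < trform Sigma D by rewrite trD.
    have := gaussian_matrix_lower psdS gX t0; rewrite trD.
    congr (_ <= prb P _); apply/seteqP; split => w /=; rewrite /Glow /setC/= leNgt => /negP//.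
  have h2 : prb P (X @^-1` (~` Gup)) <= 192 / 1600.
    have := gaussian_matrix_upper psdS gX (D - D0) (_ : 0 < tau ^+ 2 / 32).
    have -> : [set w | tau ^+ 2 / 32 <= \sum_j ((D - D0)^T *m X w) j 0 ^+ 2] = X @^-1` (~` Gup).
      by apply/seteqP; split => w /=; rewrite /Gup /setC/= leNgt => /negP.
    move=> hg; apply: (le_trans (hg _)); first by rewrite divr_gt0.
    by rewrite ler_pdivrMr ?divr_gt0//; lra.
  have := prb_sub_le P (mp _ (measurableC mlow)) (mp _ (measurableC mup)).
  have -> : X @^-1` (~` Glow) `\` X @^-1` (~` Gup) = X @^-1` G.
    apply/seteqP; split => w.
      by move=> [h3 h4]; split; [exact: h3|apply: contrapT => h5; apply: h4].
    by move=> [h3 h4]; split; [exact: h3|move=> h5; exact: (h5 h4)].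
  lra.
pose A : set (TX * TE) := [set z | 2 * vdot (psd_sqrt Gamma *m (D^T *m z.1)) z.2 < margin D D0 z.1]
  `|` [set z | 2 * vdot (psd_sqrt Gamma *m (D^T *m z.1)) z.2 < r].
have mA : measurable A.
  apply: measurableU; last by apply: measurable_lt_set; apply: measurable_funM => //; exact: mnoise.
  rewrite (_ : [set z | _] = [set z : TX * TE | 2 * vdot (psd_sqrt Gamma *m (D^T *m z.1)) z.2 - margin D D0 z.1 < 0]).
    apply: measurable_lt_set; apply: measurable_funB.
      by apply: measurable_funM => //; exact: mnoise.
    exact: (measurableT_comp (mmargin D D0) measurable_fst).
  by apply/seteqP; split => z /=; rewrite subr_lt0.
have /andP[h0 hc] := hh.
apply: (@le_trans _ _ (2^-1 + c2 * h * prb P (X @^-1` G))).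
  by rewrite lerD2l ler_wpM2l// mulr_ge0.
have -> : [set w | 2 * vdot (D^T *m X w) (xi w) < margin D D0 (X w) \/
    2 * vdot (D^T *m X w) (xi w) < r] = [set w | A (X w, E w)].
  by apply/seteqP; split => w; rewrite /A /= noiseE.
apply: (prb_sections_ge (TX := TX) (TE := TE) mX mE indXE mA mG) => //.
  by rewrite mulr_ge0.
move=> x; set u := psd_sqrt Gamma *m (D^T *m x).
have mS : measurable [set w | A (x, E w)].
  rewrite (_ : [set w | _] = [set w | vdot u (E w) < margin D D0 x / 2] `|` [set w | vdot u (E w) < r / 2]).
    by apply: measurableU; apply: measurable_lt_set; exact: spherical_measurable sE u.
  by apply/seteqP; split => w; rewrite /A /= !ltr_pdivlMr// ![_ * 2]mulrC.
have sub (q : R) : (q = margin D D0 x \/ q = r) ->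
    prb P [set w | vdot u (E w) < q / 2] <= prb P [set w | A (x, E w)].
  move=> hq; apply: prb_le => //; first by apply: measurable_lt_set; exact: spherical_measurable sE u.
  by move=> w /=; rewrite ltr_pdivlMr// mulrC /A /=; case: hq => <-; [left|right].
rewrite indicE; case: (boolP (x \in G)); rewrite ?inE /=; last first.
  move=> _; rewrite mulr0 addr0; apply: le_trans (sub r _); last by right.
  have h00 : 0 <= (0 : R) <= c1 by rewrite lexx.
  have r2 : 0 < r / 2 by rewrite divr_gt0.
  have := spherical_gain m_gt0 df fge c2_ge0 sE (u := u) h00 r2.
  by rewrite mulr0 addr0 mul0r; apply.
move=> [gl gu]; rewrite mulr1; apply: le_trans (sub (margin D D0 x) _); last by left.
set v := D^T *m x.
have v16 : tau ^+ 2 / 16 <= vnorm v ^+ 2.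
  by rewrite vnorm_sqr leNgt; apply/negP.
have v32 : vnorm ((D - D0)^T *m x) ^+ 2 < tau ^+ 2 / 32 by rewrite vnorm_sqr.
have v4 : tau / 4 <= vnorm v.
  rewrite -(@ler_pXn2r _ 2) ?nnegrE ?vnorm_ge0 ?divr_ge0 ?(ltW tau0)// expr_div_n.
  by have -> : 4 ^+ 2 = 16 :> R by ring.
have q2 : vnorm v ^+ 2 / 4 < margin D D0 x / 2 by rewrite marginE -/v; lra.
apply: (spherical_gain m_gt0 df fge c2_ge0 sE hh).
  by apply: le_lt_trans q2; rewrite divr_ge0 ?sqr_ge0.
apply: le_lt_trans q2.
have := ler_wpM2l h0 (vnorm_psd_sqrt Gamma v m_gt0); rewrite -/u => h1.
apply: (le_trans h1); have vn0 := vnorm_ge0 v; rewrite expr2; nra.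
Qed.
End Population.

(** * Nets for the Sigma-norm *)

Lemma vdotDr (R : realType) (k : nat) (u v w : 'cV[R]_k) : vdot u (v + w) = vdot u v + vdot u w.
Proof. by rewrite !vdotE mulmxDr !mxE. Qed.

Lemma vdot_col_mx (R : realType) (k l : nat) (x x' : 'cV[R]_k) (y y' : 'cV[R]_l) :
  vdot (col_mx x y) (col_mx x' y') = vdot x x' + vdot y y'.
Proof.
rewrite /vdot big_split_ord/=; congr (_ + _); apply: eq_bigr => i _.
  by rewrite !col_mxEu.
by rewrite !col_mxEd.
Qed.

(* Cholesky factorization, allowing a zero pivot. *)
Lemma psd_factor (R : realType) (k : nat) (Sigma : 'M[R]_k) : psd Sigma ->
  exists L : 'M[R]_k, forall u, qform Sigma u = vnorm (L *m u) ^+ 2.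
Proof.
elim: k Sigma => [|k IH] Sigma [symS posS].
  by exists 0 => u; rewrite vnorm_sqr /qform /vdot !big_ord0.
pose S : 'M[R]_(1 + k) := Sigma.
pose a := S 0 0; pose b : 'cV[R]_k := dlsubmx S; pose C : 'M[R]_k := drsubmx S.
have symS' : S^T = S by exact: symS.
have bT : ursubmx S = b^T by rewrite /b trmx_dlsub symS'.
have symC : C^T = C by rewrite /C trmx_drsub symS'.
have SE : S = block_mx a%:M b^T b C.
  rewrite -[LHS]submxK bT; congr block_mx.
  by apply/matrixP => i j; rewrite !ord1 !mxE eqxx mulr1n; congr (S _ _); apply/val_inj.
have bx (x : 'cV[R]_1) : b *m x = x 0 0 *: b.
  by rewrite [x in LHS]mx11_scalar mul_mx_scalar.
have qE (x : 'cV[R]_1) (y : 'cV[R]_k) :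
    qform S (col_mx x y) = a * x 0 0 ^+ 2 + 2 * x 0 0 * vdot b y + qform C y.
  rewrite /qform SE mul_block_col vdot_col_mx !vdotDr bx vdotZr mul_scalar_mx vdotZr.
  rewrite (vdotC y b) -vnorm_sqr_vdot vnorm_sqr big_ord1.
  have -> : vdot x (b^T *m y) = x 0 0 * vdot b y by rewrite {1}/vdot big_ord1 vdotE.
  ring.
have posS' x y : 0 <= a * x ^+ 2 + 2 * x * vdot b y + qform C y.
  by have := posS (col_mx (x%:M : 'cV[R]_1) y); rewrite -/(qform S _) qE mxE eqxx mulr1n.
have a0 : 0 <= a.
  have := posS' 1 0; rewrite /qform (vdotC b) !vdot0l; lra.
(* The Schur complement. At a zero pivot [a^-1] is 0 and [C'] is [C]; the form is then affine in the
   first coordinate, so its positivity forces [b] to vanish. *)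
pose C' := C - a^-1 *: (b *m b^T).
have qC' y : qform C' y = qform C y - a^-1 * vdot b y ^+ 2.
  rewrite /qform /C' mulmxBl vdotBr -scalemxAl vdotZr; congr (_ - _ * _).
  by rewrite -mulmxA bx vdotZr -vdotE (vdotC y b) expr2.
have key : psd C' /\ (a = 0 -> forall y, vdot b y = 0).
  have b0 : a = 0 -> forall y, vdot b y = 0.
    move=> az y; apply/eqP/negPn/negP => h.
    have := posS' (- (qform C y + 1) / (2 * vdot b y)) y; rewrite az mul0r add0r.
    have -> : 2 * (- (qform C y + 1) / (2 * vdot b y)) * vdot b y = - (qform C y + 1) by field.
    lra.
  split=> //; split.
    by rewrite /Defs.symmetric /C' linearB/= linearZ/= trmx_mul trmxK symC.
  move=> y; rewrite -/(qform C' y) qC'.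
  have [az|an] := eqVneq a 0.
    by rewrite az invr0 mul0r subr0; have := posS' 0 y; rewrite az; lra.
  have := posS' (- (vdot b y / a)) y.
  have -> : a * (- (vdot b y / a)) ^+ 2 + 2 * - (vdot b y / a) * vdot b y = - (a^-1 * vdot b y ^+ 2).
    by field.
  lra.
have [L' hL'] := IH C' key.1.
pose s := Num.sqrt a.
pose LL : 'M[R]_(1 + k) := block_mx s%:M (s^-1 *: b^T) 0 L'.
have LLE x y : qform S (col_mx x y) = vnorm (LL *m col_mx x y) ^+ 2.
  rewrite qE /LL mul_block_col vnorm_sqr_vdot vdot_col_mx mul0mx add0r.
  rewrite -!vnorm_sqr_vdot -hL' qC' vnorm_sqr big_ord1 mxE mul_scalar_mx mxE -scalemxAl mxE -vdotE.
  have [az|an] := eqVneq a 0.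
    by rewrite (key.2 az) /s az sqrtr0 expr0n /= !(mul0r, mulr0, addr0, add0r, subr0) expr0n /= add0r.
  have s2 : s ^+ 2 = a by rewrite sqr_sqrtr.
  have sn : s != 0 by rewrite gt_eqF// sqrtr_gt0 lt_neqAle eq_sym an.
  by rewrite -s2; field.
exists LL => u.
by have := LLE (usubmx (u : 'cV[R]_(1 + k))) (dsubmx (u : 'cV[R]_(1 + k))); rewrite vsubmxK.
Qed.

(** Give [g] the weight 2 ^ - (sum of g). The total weight factorizes into geometric sums and is at
    most 2 ^ #|I|, while each counted [g] weighs at least 2 ^ - S. *)
Lemma card_bounded_sum (I : finType) (S : nat) :
  (#|[set g : {ffun I -> 'I_S.+1} | (\sum_i g i <= S)%N]%SET| <= 2 ^ (S + #|I|))%N.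
Proof.
rewrite -(ler_nat rat) natrX exprD.
have e : \sum_(g : {ffun I -> 'I_S.+1}) \prod_i (2 ^- g i : rat) <= 2 ^+ #|I|.
  rewrite -(bigA_distr_bigA (fun (_ : I) (v : 'I_S.+1) => 2 ^- v : rat)).
  rewrite prodr_const; apply: lerXn2r; rewrite ?nnegrE//.
    by apply: sumr_ge0 => v _; rewrite invr_ge0 exprn_ge0.
  have -> : \sum_(v < S.+1) (2 ^- v : rat) = 2 - 2 ^- S.
    elim: S => [|S' IH]; first by rewrite big_ord1 expr0 invr1; lra.
    rewrite big_ord_recr/= IH exprS invfM; lra.
  by rewrite gerBl invr_ge0 exprn_ge0.
rewrite mulrC -ler_pdivrMr ?exprn_gt0//; apply: le_trans e.
rewrite [leRHS](bigID (fun g : {ffun I -> 'I_S.+1} => (\sum_i g i <= S)%N))/=.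
apply: ler_wpDr.
  by apply: sumr_ge0 => g _; apply: prodr_ge0 => i _; rewrite invr_ge0 exprn_ge0.
rewrite mulr_natl -sumr_const [leLHS](eq_bigl (fun g : {ffun I -> 'I_S.+1} => (\sum_i g i <= S)%N)); last first.
  by move=> g; rewrite inE.
apply: ler_sum => g hg; rewrite prodfV prodrXr lef_pV2 ?posrE ?exprn_gt0//.
by rewrite ler_eXn2l// ltr1n.
Qed.

Section Net.
Variables (R : realType) (p m : nat) (Sigma : 'M[R]_p).
Hypothesis psdS : psd Sigma.

Lemma trformZ (c : R) (D : 'M[R]_(p, m)) : trform Sigma (c *: D) = c ^+ 2 * trform Sigma D.
Proof.
rewrite /trform mulr_sumr; apply: eq_bigr => j _.
have -> : col j (c *: D) = c *: col j D by apply/matrixP => i l; rewrite !mxE.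
by rewrite /qform -scalemxAr vdotZr vdotZl mulrA expr2.
Qed.

(* Round the coordinates of L D, in absolute value and towards 0, to multiples of 1 / c with
   c = 80 sqrt (p m); positive and negative parts are recorded separately. *)
Lemma trform_net : (0 < p)%N -> (0 < m)%N ->
  exists (K : finType) (rep : K -> 'M[R]_(p, m)),
    (#|K| <= 2 ^ (80 * 80 * (p * m) + 2 * (p * m)))%N /\
    forall D, trform Sigma D = 1 -> exists k, trform Sigma (D - rep k) <= 1600^-1.
Proof.
move=> p0 m0; have [L hL] := psd_factor psdS.
set N := (p * m)%N; set S := (80 * 80 * N)%N.
have N0 : 0 < N%:R :> R by rewrite ltr0n muln_gt0 p0.
have trE D : trform Sigma D = \sum_(u : 'I_p * 'I_m) (L *m D) u.1 u.2 ^+ 2.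
  rewrite -(pair_bigA _ (fun i j => (L *m D) i j ^+ 2))/= exchange_big/=.
  apply: eq_bigr => j _; rewrite hL vnorm_sqr; apply: eq_bigr => i _.
  by congr (_ ^+ 2); rewrite !mxE; apply: eq_bigr => l _; rewrite !mxE.
pose c : R := 80 * Num.sqrt N%:R.
have c0 : 0 < c by rewrite mulr_gt0// sqrtr_gt0.
have c2 : c ^+ 2 = 80 * 80 * N%:R by rewrite exprMn sqr_sqrtr ?ltW//; ring.
pose I := (('I_p * 'I_m) * bool)%type.
have cI : #|{: I}| = (2 * N)%N by rewrite !card_prod card_bool !card_ord mulnC.
pose K := {g : {ffun I -> 'I_S.+1} | (\sum_i g i <= S)%N}.
pose y (D : 'M[R]_(p, m)) (i : I) : R := c * (if i.2 then (L *m D) i.1.1 i.1.2 else - (L *m D) i.1.1 i.1.2).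
pose code (D : 'M[R]_(p, m)) (i : I) : nat := Num.truncn (y D i).
pose good (k : K) (D : 'M[R]_(p, m)) := trform Sigma D = 1 /\ forall i, code D i = (val k i : nat).
(* Any matrix with this code represents it; the default 0 occurs only for codes that no normalized
   matrix has. *)
pose rep (k : K) : 'M[R]_(p, m) := xget 0 [set D | good k D].
exists K, rep; split.
  rewrite card_sig -cI; apply: leq_trans (card_bounded_sum I S).
  by rewrite cardsE.
move=> D D1.
(* An integer part is at most the square of its argument, and only one of the two signs contributes.
   Hence the codes sum to at most c^2 = [S] on the normalized matrices, which makes them few. *)
have codele (i : 'I_p * 'I_m) : (code D (i, true) + code D (i, false))%:R <= c ^+ 2 * (L *m D) i.1 i.2 ^+ 2.
  rewrite /code /y /=; set z := (L *m D) i.1 i.2.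
  have aux (t : R) : 0 <= t -> (Num.truncn t)%:R <= t ^+ 2.
    move=> t0; case E : (Num.truncn t) => [|n]; first by rewrite sqr_ge0.
    have h : n.+1%:R <= t by rewrite -E truncn_le.
    have : 1 <= n.+1%:R :> R by rewrite ler1n.
    rewrite expr2; nra.
  have z0 (t : R) : t <= 0 -> Num.truncn t = 0%N.
    by move=> t0; apply/truncn0Pn; rewrite -ltNge; lra.
  rewrite -exprMn; have [zp|/ltW zn] := leP 0 z.
    rewrite (z0 (c * - z)) ?addn0; first by apply: aux; rewrite mulr_ge0// ltW.
    by rewrite mulrN oppr_le0 mulr_ge0// ltW.
  rewrite (z0 (c * z)) ?add0n; last by rewrite mulr_ge0_le0// ltW.
  rewrite -[(c * z) ^+ 2]sqrrN -mulrN; apply: aux.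
  by rewrite mulr_ge0 ?oppr_ge0// ltW.
have codesum : (\sum_(i : I) code D i <= S)%N.
  have SR : S%:R = c ^+ 2 :> R by rewrite c2 /S natrM [X in X * _]natrM.
  rewrite -(ler_nat R) SR natr_sum.
  have -> : c ^+ 2 = \sum_(u : 'I_p * 'I_m) c ^+ 2 * (L *m D) u.1 u.2 ^+ 2.
    by rewrite -mulr_sumr -trE D1 mulr1.
  have -> : \sum_(i : I) (code D i)%:R = \sum_u \sum_b (code D (u, b))%:R :> R.
    by rewrite pair_bigA; apply: eq_bigr => -[].
  by apply: ler_sum => u _; rewrite big_bool/= -natrD codele.
have codeS i : (code D i < S.+1)%N.
  by rewrite ltnS; apply: leq_trans codesum; rewrite (bigD1 i)//= leq_addr.
pose g : {ffun I -> 'I_S.+1} := [ffun i => Ordinal (codeS i)].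
have hg : (\sum_i g i <= S)%N by under eq_bigr do rewrite ffunE.
pose k : K := exist _ g hg.
exists k.
have gD : good k D by split => // i; rewrite /= ffunE.
have [_ gr] : good k (rep k) by rewrite /rep; case: xgetP => [D' _ //|/(_ D)].
(* Equal codes leave an error of at most 2 / c per entry of L D, and p m (2 / c)^2 = 4 / 80^2 = 1 /
   1600. *)
rewrite trE; apply: (@le_trans _ _ (\sum_(u : 'I_p * 'I_m) (2 / c) ^+ 2)).
  apply: ler_sum => -[i j] _.
  have -> : (L *m (D - rep k)) i j = (L *m D) i j - (L *m rep k) i j by rewrite mulmxBr !mxE.
  have near b : code D ((i, j), b) = code (rep k) ((i, j), b) by rewrite gr /= ffunE.
  have := near true; have := near false; rewrite /code /y /=.
  set z := (L *m D) i j; set z' := (L *m rep k) i j => e1 e2.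
  have bnd (t t' : R) : Num.truncn t = Num.truncn t' -> t - t' < 1 \/ t < 1.
    move=> e; have [t0|t0] := ltP t 0; first by right; lra.
    have [t0'|t0'] := ltP t' 0.
      right; rewrite ltNge -truncn_gt0 e truncn_gt0 -ltNge; lra.
    left; have /andP[_ h] := truncn_itv t0; have /andP[h' _] := truncn_itv t0'.
    by move: h h'; rewrite e -natr1; lra.
  have h1 := bnd _ _ e1; have h2 := bnd _ _ (esym e1).
  have h3 := bnd _ _ e2; have h4 := bnd _ _ (esym e2).
  have h : `|c * (z - z')| <= 2 by rewrite ler_norml mulrBr; move: h1 h2 h3 h4; rewrite !mulrN; lra.
  rewrite -[leLHS]real_normK ?num_real// lerXn2r ?nnegrE ?divr_ge0 ?(ltW c0)//.
  by rewrite ler_pdivlMr//; move: h; rewrite normrM (gtr0_norm c0) mulrC.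
have Nn : N%:R != 0 :> R by rewrite gt_eqF.
have -> : (2 / c) ^+ 2 = (1600 * N%:R)^-1 by rewrite expr_div_n c2; field.
rewrite sumr_const card_prod !card_ord -/N -[leLHS]mulr_natl.
by rewrite invfM mulrCA mulfV// mulr1.
Qed.
End Net.

(** * Empirical depth *)

Lemma vdot_mxvec (R : realType) (p m : nat) (A B : 'M[R]_(p, m)) :
  vdot (mxvec A)^T (mxvec B)^T = \sum_i \sum_j A i j * B i j.
Proof.
rewrite /vdot (reindex _ (curry_mxvec_bij _ _))/= pair_bigA/=.
by apply: eq_bigr => -[i j] _ /=; rewrite !mxE !mxvecE.
Qed.

Lemma vdot_trmx_mul (R : realType) (p m : nat) (D : 'M[R]_(p, m)) (x : 'cV[R]_p) (y : 'cV[R]_m) :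
  vdot (D^T *m x) y = \sum_i \sum_j D i j * (x *m y^T) i j.
Proof.
rewrite /vdot exchange_big/=; apply: eq_bigr => j _; rewrite mxE mulr_suml.
by apply: eq_bigr => i _; rewrite !mxE big_ord1 !mxE mulrA.
Qed.

Section Scores.
Variables (R : realType) (p m : nat) (B D0 : 'M[R]_(p, m)).

(* Quadratic in the observation but linear in (D, D', r, u, c), so that the sublevel sets
   are half-spaces in O(p m) features; D0 stays fixed. *)
Definition score (D D' : 'M[R]_(p, m)) (r : R) (u : 'cV[R]_p) (c : R) (z : obs R p m) : R :=
  vdot (D^T *m z.1) (z.2 - B^T *m z.1) + vdot (D'^T *m z.1) (D0^T *m z.1)
  + r * vnorm (D0^T *m z.1) ^+ 2 + vdot u z.1 + c.

(** The last entry 1 carries the constant term, so that half-spaces through the origin suffice. *)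
Definition features (z : obs R p m) : 'cV[R]_(p * m + (p * m + (1 + (p + 1)))) :=
  col_mx (mxvec (z.1 *m (z.2 - B^T *m z.1)^T))^T
  (col_mx (mxvec (z.1 *m (D0^T *m z.1)^T))^T
  (col_mx (vnorm (D0^T *m z.1) ^+ 2)%:M (col_mx z.1 1%:M))).

Lemma score_linear D D' r u c : exists th, forall z, score D D' r u c z = vdot th (features z).
Proof.
exists (col_mx (mxvec D)^T (col_mx (mxvec D')^T (col_mx r%:M (col_mx u c%:M)))) => z.
rewrite /features !vdot_col_mx !vdot_mxvec /score !vdot_trmx_mul.
have s1 (a b : R) : vdot (a%:M : 'cV_1) b%:M = a * b.
  by rewrite /vdot big_ord1 !mxE eqxx !mulr1n.
by rewrite !s1 mulr1 !addrA.
Qed.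

Definition obs_coord (i : 'I_p + 'I_m) (z : obs R p m) : R :=
  match i with inl a => z.1 a 0 | inr b => z.2 b 0 end.

Let TO := borel_space obs_coord.

Let mx i : measurable_fun setT (fun z : TO => z.1 i 0).
Proof. exact: (@measurable_coord _ _ _ obs_coord (inl i)). Qed.

Let my i : measurable_fun setT (fun z : TO => z.2 i 0).
Proof. exact: (@measurable_coord _ _ _ obs_coord (inr i)). Qed.

Let mlin (M : 'M[R]_(m, p)) i : measurable_fun setT (fun z : TO => (M *m z.1) i 0).
Proof.
under eq_fun do rewrite mxE; apply: measurable_sum => j; apply: measurable_funM => //.
Qed.

Lemma measurable_col_mx (d : measure_display) (T : measurableType d) (k l : nat)
    (f : T -> 'cV[R]_k) (g : T -> 'cV[R]_l) :
  (forall i, measurable_fun setT (fun z => f z i 0)) ->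
  (forall i, measurable_fun setT (fun z => g z i 0)) ->
  forall i, measurable_fun setT (fun z => col_mx (f z) (g z) i 0).
Proof.
move=> mf mg i; rewrite -(splitK i); case: (fintype.split i) => j /=.
  by under eq_fun do rewrite col_mxEu; exact: mf.
by under eq_fun do rewrite col_mxEd; exact: mg.
Qed.

Let mouter (g : TO -> 'cV[R]_m) : (forall i, measurable_fun setT (fun z => g z i 0)) ->
  forall i, measurable_fun setT (fun z : TO => (mxvec (z.1 *m (g z)^T))^T i 0).
Proof.
move=> mg i; case/mxvec_indexP: i => i j.
under eq_fun do rewrite mxE mxvecE mxE big_ord1 mxE.
by apply: measurable_funM.
Qed.

Lemma measurable_features i : measurable_fun setT (fun z : TO => features z i 0).
Proof.
apply: measurable_col_mx => {}i.
  apply: (mouter (g := fun z => z.2 - B^T *m z.1)) => j.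
  under eq_fun do rewrite mxE [X in _ + X]mxE.
  by apply: measurable_funB => //; exact: mlin.
move: i; apply: measurable_col_mx => i.
  by apply: (mouter (g := fun z => D0^T *m z.1)) => j; exact: mlin.
move: i; apply: measurable_col_mx => i.
  rewrite ord1; under eq_fun do rewrite mxE eqxx mulr1n vnorm_sqr.
  by apply: measurable_sum => j; apply: measurable_funX; exact: mlin.
move: i; apply: measurable_col_mx => i; first exact: mx.
exact: measurable_cst.
Qed.
End Scores.

Section EmpiricalDepth.
Variables (R : realType) (d : measure_display) (Om : measurableType d) (P : probability Om R)
  (p m n : nat) (Sigma : 'M[R]_p) (Gamma : 'M[R]_m) (f : R -> R) (B : 'M[R]_(p, m))
  (X : Om -> 'cV[R]_p) (E : Om -> 'cV[R]_m) (c1 c2 : R).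
Hypothesis p_gt0 : (0 < p)%N.
Hypothesis m_gt0 : (0 < m)%N.
Hypothesis n_gt0 : (0 < n)%N.
Hypothesis psdS : psd Sigma.
Hypothesis df : is_density f.
Hypothesis fge : forall t : R, `|t| <= c1 -> c2 <= f t.
Hypothesis c1_gt0 : 0 < c1.
Hypothesis c2_gt0 : 0 < c2.
Hypothesis gX : is_gaussian0 P Sigma X.
Hypothesis sE : is_spherical P f E.
Hypothesis indXE : forall (A1 : set 'cV[R]_p) (A2 : set 'cV[R]_m),
  vec_borel A1 -> vec_borel A2 ->
  P (X @^-1` A1 `&` E @^-1` A2) = (P (X @^-1` A1) * P (E @^-1` A2))%E.

Definition clean_obs (w : Om) : obs R p m := (X w, B^T *m X w + psd_sqrt Gamma *m E w).

(** The probability is under the uncontaminated law, so [gap] has to absorb contamination as well as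
    sampling error. All parameters except [D0] are quantified inside and may later be chosen after
    seeing the sample. *)
Definition uniformly_close (z : 'I_n -> obs R p m) (gap : R) (D0 : 'M[R]_(p, m)) :=
  forall D1 D1' r1 u1 k1 D2 D2' r2 u2 k2,
    n%:R * (prb P [set w | score B D0 D1 D1' r1 u1 k1 (clean_obs w) < 0 \/
                           score B D0 D2 D2' r2 u2 k2 (clean_obs w) < 0] - gap)
    <= \sum_i ((score B D0 D1 D1' r1 u1 k1 (z i) <= 0)
               || (score B D0 D2 D2' r2 u2 k2 (z i) <= 0))%:R.

Definition residual (z : obs R p m) : 'cV[R]_m := z.2 - B^T *m z.1.

Lemma residual_clean w : residual (clean_obs w) = psd_sqrt Gamma *m E w.
Proof. by rewrite /residual /= addrC addKr. Qed.

Lemma score_simple D0 D c z : score B D0 D 0 0 0 c z = vdot (D^T *m z.1) (residual z) + c.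
Proof. by rewrite /score trmx0 mul0mx !vdot0l mul0r !addr0. Qed.

Lemma score_direction D0 u c z : score B D0 0 0 0 u c z = vdot u z.1 + c.
Proof. by rewrite /score trmx0 !mul0mx !vdot0l mul0r !addr0 add0r. Qed.

Lemma emp_depth_truth (z : 'I_n -> obs R p m) gap D0 :
  uniformly_close z gap D0 -> 2^-1 - gap <= emp_depth z B.
Proof.
move=> uc; have n0 : 0 < n%:R :> R by rewrite ltr0n.
apply: lb_le_inf.
  exists (#|[set i : 'I_n | 0 <= vdot ((const_mx 1 : 'M[R]_(p, m))^T *m (z i).1) ((z i).2 - B^T *m (z i).1)]|%:R / n%:R).
  exists (const_mx 1) => //=; apply/eqP => /matrixP/(_ (Ordinal p_gt0) (Ordinal m_gt0)).
  by rewrite !mxE => /eqP; rewrite oner_eq0.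
move=> _ [U /= U0 <-].
pose a i := vdot (U^T *m (z i).1) (residual (z i)).
(* The slack is chosen from the sample, below every |a i| with a i < 0, so that on the sample
   [- r <= a i] already means [0 <= a i]. *)
have [|r r0 hr] := @positive_lower_bound _ _ (fun i => if a i < 0 then - a i / 2 else 1).
  by move=> i; case: ifP => // h; rewrite divr_gt0// oppr_gt0.
have := uc (- U) 0 0 0 (- r) (- U) 0 0 0 (- r).
have aE w : vdot ((- U)^T *m w.1) (residual w) = - vdot (U^T *m w.1) (residual w).
  by rewrite linearN/= mulNmx vdotNl.
have h1 : 2^-1 <= prb P [set w | score B D0 (- U) 0 0 0 (- r) (clean_obs w) < 0 \/
    score B D0 (- U) 0 0 0 (- r) (clean_obs w) < 0].
  have := population_halfspace Gamma m_gt0 df fge (ltW c1_gt0) (ltW c2_gt0) gX sE indXE (- U) r0.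
  rewrite (_ : [set w | _ < r] = [set w | score B D0 (- U) 0 0 0 (- r) (clean_obs w) < 0 \/
    score B D0 (- U) 0 0 0 (- r) (clean_obs w) < 0])//.
  apply/seteqP; split => w /=; rewrite score_simple residual_clean /= subr_lt0; first by left.
  by case.
move=> h2.
have h3 : n%:R * (2^-1 - gap) <= \sum_i (0 <= a i)%R%:R.
  apply: le_trans (_ : n%:R * (prb P _ - gap) <= _); first by rewrite ler_pM2l// lerD2r; exact: h1.
  apply: (le_trans h2); apply: ler_sum => i _; rewrite ler_nat orbb score_simple aE.
  rewrite -/(a i); have := hr i; have [ai hri|_ _] := ltP (a i) 0; last by case: (_ <= _).
  by rewrite [X in nat_of_bool X](_ : _ = false)//; apply/negbTE; rewrite -ltNge; lra.
rewrite ler_pdivlMr// mulrC; apply: (le_trans h3).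
rewrite -natr_sum ler_nat -sum1_card [leqRHS]big_mkcond/=; apply: leq_sum => i _.
rewrite (_ : (i \in _) = (0 <= a i)); first by case: (0 <= a i).
by apply/idP/idP; rewrite inE.
Qed.

Lemma score_margin D0 D tau z :
  score B D0 (2 *: D) (- (2 * tau) *: D) (tau ^+ 2) 0 0 z =
  2 * vdot (D^T *m z.1) (residual z) - margin D (tau *: D0) z.1.
Proof.
have tZ c (D' : 'M[R]_(p, m)) x : (c *: D')^T *m x = c *: (D'^T *m x).
  by rewrite linearZ/= -scalemxAl.
rewrite /score /margin -/(residual z) vdot0l !addr0 !tZ !vnorm_sqr_vdot !vdotZl !vdotZr.
by ring.
Qed.

Lemma margin_le (D D' : 'M[R]_(p, m)) x : margin D D' x <= vnorm (D^T *m x) ^+ 2.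
Proof. by rewrite marginE gerBl sqr_ge0. Qed.

Lemma emp_depth_le (z : 'I_n -> obs R p m) (Bh U : 'M[R]_(p, m)) : U != 0 ->
  n%:R * emp_depth z Bh <= \sum_i (0 <= vdot (U^T *m (z i).1) ((z i).2 - Bh^T *m (z i).1))%R%:R.
Proof.
move=> U0; have n0 : 0 < n%:R :> R by rewrite ltr0n.
rewrite mulrC -ler_pdivlMr//; apply: (@le_trans _ _ (#|[set i : 'I_n |
    0 <= vdot (U^T *m (z i).1) ((z i).2 - Bh^T *m (z i).1)]|%:R / n%:R)).
  apply: ge_inf; last by exists U.
  by exists 0 => _ [U' _ <-]; rewrite divr_ge0.
rewrite ler_pM2r ?invr_gt0// -natr_sum ler_nat -sum1_card [leqLHS]big_mkcond/=.
apply: leq_sum => i _.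
rewrite (_ : (i \in _) = (0 <= vdot (U^T *m (z i).1) ((z i).2 - Bh^T *m (z i).1))).
  by case: (0 <= _).
by apply/idP/idP; rewrite inE.
Qed.

(** With h = 33 gap / c2 the gain c2 h / 8 = 33 gap / 8 just exceeds the total loss 4 gap: one gap
    for each of the three counts, and one for the probability given up in the third event. The
    factor 16 of [population_gain] turns 33 into 528. *)
Lemma depth_maximizer_error (K : Type) (rep : K -> 'M[R]_(p, m)) (z : 'I_n -> obs R p m)
    (gap : R) (Bh : 'M[R]_(p, m)) :
  (forall D, trform Sigma D = 1 -> exists k, trform Sigma (D - rep k) <= 1600^-1) ->
  (forall k, uniformly_close z gap (rep k)) -> is_depth_maximizer z Bh ->
  0 < gap -> 33 * gap / c2 <= c1 ->
  trform Sigma (Bh - B) <= (528 * gap / c2) ^+ 2 * opnorm Gamma.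
Proof.
(* To be used with |v|^2, <v, residual>, the margin and [r1 ^+ 2] for [V], [s], [g] and [r]. *)
have incompatible (V s g r : R) : 0 < r -> r <= V -> V <= s -> g <= V ->
    (2 * s - g <= 0) || (2 * s - r <= 0) -> False.
  by move=> r0 rV Vs gV /orP[]; lra.
have counts (N g : R) : N * (2^-1 - g) + N * (2^-1 + 33 * g / 8 - g) + N * (1 - g - g) <= 2 * N ->
    N * g <= 0.
  lra.
move=> net uc maxBh gap0 hc1; have n0 : 0 < n%:R :> R by rewrite ltr0n.
set D := Bh - B; set t := trform Sigma D.
have o0 := opnorm_ge0 Gamma m_gt0.
have q0 j : 0 <= qform Sigma (col j D) by exact: psdS.2.
have t_ge0 : 0 <= t by apply: sumr_ge0 => j _; exact: q0.
rewrite leNgt; apply/negP => tlt.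
have t0 : 0 < t by apply: le_lt_trans tlt; apply: mulr_ge0; [exact: sqr_ge0|exact: o0].
pose tau := Num.sqrt t; have tau0 : 0 < tau by rewrite sqrtr_gt0.
have tau2 : tau ^+ 2 = t by rewrite sqr_sqrtr.
pose h := 33 * gap / c2.
have h0 : 0 <= h by rewrite divr_ge0 ?mulr_ge0// ltW.
have hs : 16 * h * Num.sqrt (opnorm Gamma) <= tau.
  have s0 : 0 <= 16 * h * Num.sqrt (opnorm Gamma) by apply: mulr_ge0; [exact: mulr_ge0|exact: sqrtr_ge0].
  rewrite -(@ler_pXn2r _ 2) ?nnegrE//; last exact: ltW.
  rewrite exprMn [Num.sqrt (opnorm Gamma) ^+ 2]sqr_sqrtr// tau2; apply: ltW.
  by rewrite (_ : 16 * h = 528 * gap / c2)// /h; lra.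
have [k hk] : exists k, trform Sigma (tau^-1 *: D - rep k) <= 1600^-1.
  by apply: net; rewrite trformZ -/t -tau2 -exprMn mulVf ?expr1n// gt_eqF.
have trD0 : trform Sigma (D - tau *: rep k) <= tau ^+ 2 / 1600.
  have -> : D - tau *: rep k = tau *: (tau^-1 *: D - rep k).
    by rewrite scalerBr scalerA mulfV ?gt_eqF// scale1r.
  by rewrite trformZ ler_wpM2l// sqr_ge0.
have [j qj] : exists j, 0 < qform Sigma (col j D).
  apply: contrapT => /forallNP H; move: t0; rewrite /t /trform big1 ?ltxx// => j _.
  by apply/eqP; rewrite eq_le q0 andbT leNgt; apply/negP; exact: H.
(* [r1] links the second and third events: where a column of [D] gives |v| >= r1, the slack
   [r1 ^+ 2] in the second event is at most |v|^2. *)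
have [r1 r10 hr1] := gaussian_nonzero gX qj gap0.
have r00 : 0 < r1 ^+ 2 by rewrite exprn_gt0.
have cnt1 : n%:R * (2^-1 - gap) <=
    \sum_i (0 <= vdot (D^T *m (z i).1) ((z i).2 - Bh^T *m (z i).1))%R%:R.
  apply: le_trans (emp_depth_le z Bh _); last first.
    by apply/eqP => DE; move: t0; rewrite /t DE -(scale0r (0 : 'M[R]_(p, m))) trformZ expr0n mul0r ltxx.
  rewrite ler_pM2l//; apply: le_trans (maxBh B).
  exact: emp_depth_truth (uc k).
have cnt2 := uc k (2 *: D) (- (2 * tau) *: D) (tau ^+ 2) 0 0 (2 *: D) 0 0 0 (- r1 ^+ 2).
have pop2 : 2^-1 + c2 * h / 8 <=
    prb P [set w | score B (rep k) (2 *: D) (- (2 * tau) *: D) (tau ^+ 2) 0 0 (clean_obs w) < 0 \/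
                   score B (rep k) (2 *: D) 0 0 0 (- r1 ^+ 2) (clean_obs w) < 0].
  have hh : 0 <= h <= c1 by rewrite h0.
  have := population_gain m_gt0 psdS df fge (ltW c1_gt0) (ltW c2_gt0) gX sE indXE tau0
    (esym tau2) trD0 hh hs r00.
  rewrite (_ : [set w | _ \/ 2 * vdot _ _ < _] = [set w |
      score B (rep k) (2 *: D) (- (2 * tau) *: D) (tau ^+ 2) 0 0 (clean_obs w) < 0 \/
      score B (rep k) (2 *: D) 0 0 0 (- r1 ^+ 2) (clean_obs w) < 0])//.
  have e w : score B (rep k) (2 *: D) 0 0 0 (- r1 ^+ 2) (clean_obs w) =
      2 * vdot (D^T *m X w) (psd_sqrt Gamma *m E w) - r1 ^+ 2.
    by rewrite score_simple residual_clean linearZ/= -scalemxAl vdotZl.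
  by apply/seteqP; split => w /=; rewrite score_margin e residual_clean !subr_lt0.
have cnt3 := uc k 0 0 0 (- col j D) r1 0 0 0 (col j D) r1.
have pop3 : 1 - gap <= prb P [set w | score B (rep k) 0 0 0 (- col j D) r1 (clean_obs w) < 0 \/
    score B (rep k) 0 0 0 (col j D) r1 (clean_obs w) < 0].
  apply/ltW; move: hr1.
  rewrite (_ : [set w | r1 < _] = [set w | score B (rep k) 0 0 0 (- col j D) r1 (clean_obs w) < 0 \/
    score B (rep k) 0 0 0 (col j D) r1 (clean_obs w) < 0])//.
  by apply/seteqP; split => w /=;
     rewrite !score_direction vdotNl addrC subr_lt0 -ltrBrDl sub0r ltr_normr => /orP.
pose b1 i := 0 <= vdot (D^T *m (z i).1) ((z i).2 - Bh^T *m (z i).1).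
pose b2 i := (score B (rep k) (2 *: D) (- (2 * tau) *: D) (tau ^+ 2) 0 0 (z i) <= 0)
  || (score B (rep k) (2 *: D) 0 0 0 (- r1 ^+ 2) (z i) <= 0).
pose b3 i := (score B (rep k) 0 0 0 (- col j D) r1 (z i) <= 0)
  || (score B (rep k) 0 0 0 (col j D) r1 (z i) <= 0).
(* The b1, b2, b3 counts add up to more than 2 n, although no observation has all three. *)
have nall i : ~~ [&& b1 i, b2 i & b3 i].
  apply/negP => /and3P[h1 h2 h3].
  set v := D^T *m (z i).1.
  have vr : r1 ^+ 2 <= vnorm v ^+ 2.
    have vj : r1 <= `|v j 0|.
      move: h3; rewrite /b3 !score_direction vdotNl addrC subr_le0 -lerBrDl sub0r.
      by rewrite -ler_normr -trmx_mul_coord.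
    rewrite vnorm_sqr (bigD1 j)//=; apply: ler_wpDr; first by apply: sumr_ge0 => ? _; exact: sqr_ge0.
    by rewrite -[leRHS]real_normK ?num_real// lerXn2r ?nnegrE// ltW.
  have a1 : vnorm v ^+ 2 <= vdot v (residual (z i)).
    move: h1; rewrite /b1 -/v (_ : Bh = B + D); last by rewrite /D addrC subrK.
    rewrite linearD/= mulmxDl opprD addrA -/v -/(residual (z i)) vdotBr -vnorm_sqr_vdot.
    by rewrite subr_ge0.
  have mv := margin_le D (tau *: rep k) (z i).1; rewrite -/v in mv.
  have e2 : score B (rep k) (2 *: D) 0 0 0 (- r1 ^+ 2) (z i) = 2 * vdot v (residual (z i)) - r1 ^+ 2.
    by rewrite score_simple linearZ/= -scalemxAl vdotZl.
  by move: h2; rewrite /b2 score_margin e2; exact: incompatible r00 vr a1 mv.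
have tot : \sum_i ((b1 i)%:R + (b2 i)%:R + (b3 i)%:R) <= 2 * n%:R :> R.
  apply: (@le_trans _ _ (\sum_(i < n) 2)); last by rewrite sumr_const card_ord -[leLHS]mulr_natr.
  apply: ler_sum => i _; rewrite -!natrD ler_nat.
  by move: (nall i); case: (b1 i); case: (b2 i); case: (b3 i).
rewrite !big_split/= in tot.
have l2 := le_trans (ler_wpM2l (ltW n0) (lerB pop2 (lexx gap))) cnt2.
have l3 := le_trans (ler_wpM2l (ltW n0) (lerB pop3 (lexx gap))) cnt3.
have c2h : c2 * h = 33 * gap by rewrite /h mulrC divfK// gt_eqF.
have fin : n%:R * (2^-1 - gap) + n%:R * (2^-1 + c2 * h / 8 - gap) + n%:R * (1 - gap - gap) <= 2 * n%:R.
  by apply: le_trans tot; apply: lerD => //; apply: lerD.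
rewrite c2h in fin.
by have := counts _ _ fin; rewrite leNgt mulr_gt0.
Qed.

End EmpiricalDepth.

(** * Contamination, union over the net and choice of constants *)

Lemma prb_union_bound (R : realType) (d : measure_display) (Om : measurableType d)
    (P : probability Om R) (K : finType) (F : K -> set Om) (c : R) :
  (forall k, measurable (F k)) -> (forall k, prb P (F k) <= c) ->
  measurable (\big[setU/set0]_k F k) /\ prb P (\big[setU/set0]_k F k) <= #|K|%:R * c.
Proof.
move=> mF hF; have -> : #|K|%:R * c = \sum_(k : K) c by rewrite sumr_const mulr_natl.
elim/big_rec2: _ => [|k y A _ [mA hA]].
  by split; [exact: measurable0|rewrite /prb measure0].
split; first exact: measurableU.
by apply: le_trans (prbU_le _ _ _) (lerD _ _).
Qed.

Lemma kappa_trform (R : realType) (p m : nat) (Sigma : 'M[R]_p) (D : 'M[R]_(p, m)) :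
  (0 < p)%N -> psd Sigma -> kappa Sigma ^+ 2 * frob2 D <= trform Sigma D.
Proof.
move=> p0 psdS; rewrite /frob2 exchange_big mulr_sumr; apply: ler_sum => j _.
set u := col j D.
have -> : \sum_i D i j ^+ 2 = vnorm u ^+ 2.
  by rewrite vnorm_sqr; apply: eq_bigr => i _; rewrite mxE.
have q0 : 0 <= qform Sigma u by exact: psdS.2.
have [->|u0] := eqVneq u 0.
  rewrite /qform vdot0l vnorm_sqr big1 ?mulr0// => i _.
  by rewrite mxE expr0n.
have un := vnorm_gt0 u0.
have S2 : vnorm (psd_sqrt Sigma *m u) ^+ 2 <= qform Sigma u.
  rewrite vnorm_sqr_vdot; have [->|[[_ _] h]] := psd_sqrt_cases Sigma.
    by rewrite mul0mx vdot0l.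
  by rewrite vdot_mulmx psd_sqrt_sym mulmxA h vdotC.
have lb : lbound [set vnorm (psd_sqrt Sigma *m v) / vnorm v | v in [set v : 'cV[R]_p | v != 0]] 0.
  by move=> _ [v _ <-]; rewrite divr_ge0 ?vnorm_ge0.
have k0 : 0 <= kappa Sigma by apply: lb_le_inf => //; eexists; exists u.
have ku : kappa Sigma * vnorm u <= vnorm (psd_sqrt Sigma *m u).
  rewrite -ler_pdivlMr//; apply: ge_inf; last by exists u.
  by exists 0.
apply: le_trans S2; rewrite -exprMn lerXn2r ?nnegrE ?vnorm_ge0//.
by rewrite mulr_ge0// ltW.
Qed.

Section ScoreEvent.
Variables (R : realType) (p m n : nat) (B : 'M[R]_(p, m)) (Gamma : 'M[R]_m) (eps : R)
  (d0 : measure_display) (Om0 : measurableType d0) (P0 : probability Om0 R)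
  (X0 : Om0 -> 'cV[R]_p) (E0 : Om0 -> 'cV[R]_m)
  (d1 : measure_display) (Om1 : measurableType d1) (P1 : probability Om1 R)
  (W : Om1 -> obs R p m)
  (d : measure_display) (Om : measurableType d) (P : probability Om R)
  (Z : 'I_n -> Om -> obs R p m).
Hypothesis p_gt0 : (0 < p)%N.
Hypothesis m_gt0 : (0 < m)%N.
Hypothesis n_gt0 : (0 < n)%N.
Hypothesis eps_itv : 0 <= eps < 1.
Hypothesis mX0 : rmeasurable (@vec_borel R p) X0.
Hypothesis mE0 : rmeasurable (@vec_borel R m) E0.
Hypothesis mW : rmeasurable (@obs_borel R p m) W.
Hypothesis mZ : forall i, rmeasurable (@obs_borel R p m) (Z i).
Hypothesis indZ : forall A : 'I_n -> set (obs R p m), (forall i, obs_borel (A i)) ->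
  P (\bigcap_(i in [set: 'I_n]) (Z i @^-1` A i)) = \big[*%E/1%E]_(i < n) P (Z i @^-1` A i).
Hypothesis lawZ : forall (i : 'I_n) (A : set (obs R p m)), obs_borel A ->
  P (Z i @^-1` A) = ((1 - eps)%R%:E * P0 ((clean_obs Gamma B X0 E0) @^-1` A)
    + eps%:E * P1 (W @^-1` A))%E.

Let TO := borel_space (@obs_coord R p m).

Lemma clean_obs_measurable : measurable_fun setT (clean_obs Gamma B X0 E0 : Om0 -> TO).
Proof.
have mx i : measurable_fun setT (fun w => X0 w i 0).
  exact: (@rmeasurable_coord _ _ _ _ _ (fun (i : 'I_p) (v : 'cV[R]_p) => v i 0) X0 i mX0).
have me i : measurable_fun setT (fun w => E0 w i 0).
  exact: (@rmeasurable_coord _ _ _ _ _ (fun (i : 'I_m) (v : 'cV[R]_m) => v i 0) E0 i mE0).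
apply: measurable_fun_coords => -[i|i] /=; first exact: mx.
under eq_fun do rewrite mxE ![(_ *m _) _ _]mxE.
by apply: measurable_funD; apply: measurable_sum => j; apply: measurable_funM.
Qed.

(** Under the mixture an event of clean probability a has probability at least (1 - eps) a >= a -
    eps, which is the [eps] in the gap. The number p m + p m + p + 2 of features is at most 5 p
    m. *)
Lemma score_event (D0 : 'M[R]_(p, m)) (L s : R) :
  1 <= s -> 0 <= L -> 64 * (544 * n%:R * (5 * (p * m)%:R + s)) <= L ^+ 2 ->
  exists A : set Om, [/\ measurable A, 1 - 8 * expR (- s) <= prb P A &
    forall w, A w ->
      uniformly_close P0 Gamma B X0 E0 (fun i => Z i w) (eps + 2 * L / n%:R) D0].
Proof.
move=> s1 L0 hL; have n0 : 0 < n%:R :> R by rewrite ltr0n.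
have /andP[e0 e1] := eps_itv.
pose i0 := Ordinal n_gt0.
(* The mixture is realized as the law of one observation instead of being constructed as a
   measure. *)
have [mu hmu] := image_probability P (rmeasurable_fun (mZ i0) : measurable_fun setT (Z i0 : Om -> TO)).
have lawmu i (A : set TO) : measurable A -> P (Z i @^-1` A) = mu A.
  by move=> mA; rewrite hmu !lawZ.
set dd := (p * m + (p * m + (1 + (p + 1))))%N.
have dd0 : (0 < dd)%N by rewrite /dd; lia.
have hL' : 64 * (544 * n%:R * (dd%:R + s)) <= L ^+ 2.
  apply: le_trans hL; apply: ler_wpM2l; first exact: ler0n.
  apply: ler_wpM2l; first by apply: mulr_ge0; exact: ler0n.
  rewrite lerD2r.
  rewrite (_ : 5 * (p * m)%:R = (5 * (p * m))%:R); last by rewrite [RHS]natrM.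
  rewrite ler_nat /dd; nia.
have mZ' i (A : set TO) : measurable A -> measurable (Z i @^-1` A) by move=> mA; exact: mZ.
have [A [mA pA hA]] := halfspace_uniform_deviation n_gt0 dd0 mZ' lawmu indZ (measurable_features B D0) s1 L0 hL'.
exists A; split => // w Aw D1 D1' r1 u1 k1 D2 D2' r2 u2 k2.
have [th hth] := score_linear B D0 D1 D1' r1 u1 k1.
have [th' hth'] := score_linear B D0 D2 D2' r2 u2 k2.
have := hA w Aw th th'.
set O := _ `|` _.
have mO : measurable (O : set TO).
  by apply: measurableU; apply: measurable_lt_set; apply: measurable_vdot; exact: measurable_features.
have OE : [set w0 | score B D0 D1 D1' r1 u1 k1 (clean_obs Gamma B X0 E0 w0) < 0 \/
    score B D0 D2 D2' r2 u2 k2 (clean_obs Gamma B X0 E0 w0) < 0] = clean_obs Gamma B X0 E0 @^-1` O.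
  by apply/seteqP; split => w0; rewrite /O /= hth hth'.
have mcO : measurable (clean_obs Gamma B X0 E0 @^-1` O).
  by rewrite -[X in measurable X]setTI; exact: clean_obs_measurable.
have mWO : measurable (W @^-1` O) by exact: mW.
have muO : prb mu O = (1 - eps) * prb P0 (clean_obs Gamma B X0 E0 @^-1` O) + eps * prb P1 (W @^-1` O).
  apply: EFin_inj; rewrite -prbE// -(lawmu i0)// lawZ//.
  by rewrite [RHS]EFinD [X in _ = (X + _)%E]EFinM [X in _ = (_ + X)%E]EFinM -!prbE.
have -> : \sum_i (Z i w \in [set x | vdot th (features B D0 x) <= 0] `|` [set x | vdot th' (features B D0 x) <= 0])%:R
    = \sum_i ((score B D0 D1 D1' r1 u1 k1 (Z i w) <= 0) || (score B D0 D2 D2' r2 u2 k2 (Z i w) <= 0))%:R :> R.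
  apply: eq_bigr => i _; rewrite hth hth'; congr (nat_of_bool _)%:R.
  by apply/idP/orP; rewrite inE.
apply: le_trans; rewrite OE muO opprD addrA mulrBr.
have -> : n%:R * (2 * L / n%:R) = 2 * L by rewrite mulrC divfK// gt_eqF.
rewrite lerD2r ler_pM2l//.
have p1 := prb_le1 P0 mcO; have p0 := prb_ge0 P1 (W @^-1` O); nra.
Qed.
End ScoreEvent.

(** Here [N] stands for p m, and [q], [r] for 64 * 544 and 80 * 80. Since [N], [n * eps ^+ 2] and 1
    are all at most M n, the bracket in [L ^+ 2] is at most (5 + (r + 3) + 1 + 3) M n, whence r +
    12. *)
Lemma deviation_gap_bound (R : realType) (q r N n eps M L : R) :
  0 < q -> 0 < r -> 0 < n -> 1 <= N -> 0 <= eps -> 0 <= L ->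
  N / n <= M -> eps ^+ 2 <= M ->
  L ^+ 2 = q * n * (5 * N + ((r + 3) * N + n * eps ^+ 2 + 3)) ->
  eps + 2 * L / n <= (1 + Num.sqrt (4 * q * (r + 12))) * Num.sqrt M.
Proof.
move=> q0 r0 n0 N1 e0 L0 M1 M2 L2; rewrite [leRHS]mulrDl mul1r.
have M0 : 0 <= M by apply: le_trans M2; exact: sqr_ge0.
have Nn : N <= M * n by rewrite -ler_pdivrMr.
apply: lerD; first by rewrite -[leLHS]ger0_norm// -sqrtr_sqr ler_wsqrtr.
have qr0 : 0 <= 4 * q * (r + 12) by apply: mulr_ge0; lra.
rewrite -sqrtrM// -[leLHS]ger0_norm ?divr_ge0 ?mulr_ge0 ?(ltW n0)//.
rewrite -sqrtr_sqr ler_wsqrtr// expr_div_n exprMn L2 ler_pdivrMr ?exprn_gt0//.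
have en : n * eps ^+ 2 <= M * n by rewrite mulrC ler_wpM2r// ltW.
have rN : r * N <= r * (M * n) by rewrite ler_wpM2l// ltW.
have h1 : 5 * N + ((r + 3) * N + n * eps ^+ 2 + 3) <= (r + 12) * (M * n) by lra.
have h2 : 0 <= 4 * (q * n) by rewrite !mulr_ge0// ltW.
have := ler_wpM2l h2 h1; rewrite expr2; lra.
Qed.

Theorem theorem10 (R : realType) (c1 c2 : R) :
  0 < c1 -> 0 < c2 ->
  exists c0 C C' : R, [/\ 0 < c0, 0 < C, 0 < C' &
  forall (p m n : nat) (Sigma : 'M[R]_p) (Gamma : 'M[R]_m) (f : R -> R)
    (B : 'M[R]_(p, m)) (eps : R)
    (* a realization of P_B : X0 ~ N(0, Sigma), independent of E0 *)
    (d0 : measure_display) (Om0 : measurableType d0) (P0 : probability Om0 R)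
    (X0 : Om0 -> 'cV[R]_p) (E0 : Om0 -> 'cV[R]_m)
    (* a realization of the arbitrary contamination distribution Q *)
    (d1 : measure_display) (Om1 : measurableType d1) (P1 : probability Om1 R)
    (W : Om1 -> obs R p m)
    (* the i.i.d. sample (X_i, Y_i), i < n *)
    (d : measure_display) (Om : measurableType d) (P : probability Om R)
    (Z : 'I_n -> Om -> obs R p m),
  (0 < p)%N -> (0 < m)%N -> (0 < n)%N ->
  psd Sigma -> psd Gamma ->
  is_density f -> f 0 = 1 ->
  (forall t : R, `|t| <= c1 -> c2 <= f t) ->
  0 <= eps < 1 ->
  is_gaussian0 P0 Sigma X0 ->
  is_spherical P0 f E0 ->
  (forall (A1 : set 'cV[R]_p) (A2 : set 'cV[R]_m),
     vec_borel A1 -> vec_borel A2 ->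
     P0 (X0 @^-1` A1 `&` E0 @^-1` A2) = (P0 (X0 @^-1` A1) * P0 (E0 @^-1` A2))%E) ->
  rmeasurable (@obs_borel R p m) W ->
  (forall i, rmeasurable (@obs_borel R p m) (Z i)) ->
  (forall A : 'I_n -> set (obs R p m), (forall i, obs_borel (A i)) ->
     P (\bigcap_(i in [set: 'I_n]) (Z i @^-1` A i)) =
     \big[*%E/1%E]_(i < n) P (Z i @^-1` A i)) ->
  (forall (i : 'I_n) (A : set (obs R p m)), obs_borel A ->
     P (Z i @^-1` A) =
     ((1 - eps)%R%:E *
        P0 ((fun w => (X0 w, (B^T *m X0 w + psd_sqrt Gamma *m E0 w)%R)) @^-1` A)
      + eps%:E * P1 (W @^-1` A))%E) ->
  eps ^+ 2 + (p * m)%:R / n%:R <= c0 ->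
  exists A : set Om, [/\ measurable A,
    A `<=` [set w | forall Bh : 'M[R]_(p, m),
       is_depth_maximizer (fun i => Z i w) Bh ->
       \tr ((Bh - B)^T *m Sigma *m (Bh - B))
         <= C * opnorm Gamma * Num.max ((p * m)%:R / n%:R) (eps ^+ 2)
       /\ kappa Sigma ^+ 2 * frob2 (Bh - B)
         <= C * opnorm Gamma * Num.max ((p * m)%:R / n%:R) (eps ^+ 2)] &
    ((1 - expR (- (C' * ((p * m)%:R + n%:R * eps ^+ 2))))%:E <= P A)%E]].
Proof.
move=> c1_gt0 c2_gt0.
(* The numerals are hidden behind q and r: unfolding them makes lra and done blow up. *)
have [q q0 qE] : exists2 q : R, 0 < q & q = 64 * 544.
  by exists (64 * 544); first by apply: mulr_gt0; rewrite ltr0n.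
have [r r0 rE] : exists2 r : R, 0 < r & r = 80 * 80.
  by exists (80 * 80); first by apply: mulr_gt0; rewrite ltr0n.
have [K1 K10 K1E] : exists2 K1 : R, 0 < K1 & K1 = 1 + Num.sqrt (4 * q * (r + 12)).
  by eexists; last reflexivity; apply: ltr_pwDl; [exact: ltr01|exact: sqrtr_ge0].
have [Ce Ce0 CeE] : exists2 Ce : R, 0 < Ce & Ce = 528 * K1 / c2.
  eexists; last reflexivity; apply: divr_gt0; last exact: c2_gt0.
  by apply: mulr_gt0; [rewrite ltr0n|exact: K10].
(* The smallness condition with c0 = Cs^2 makes 33 gap / c2 at most [c1], so that the lower bound on
   the density applies up to the level used in [depth_maximizer_error]. *)
have [Cs Cs0 CsE] : exists2 Cs : R, 0 < Cs & Cs = c1 * c2 / (33 * K1).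
  by eexists; last reflexivity; apply: divr_gt0; apply: mulr_gt0.
exists (Cs ^+ 2), (Ce ^+ 2), 1; split; [exact: exprn_gt0|exact: exprn_gt0|exact: ltr01|].
move=> p m n Sigma Gamma f B eps d0 Om0 P0 X0 E0 d1 Om1 P1 W d Om P Z p_gt0 m_gt0 n_gt0
  psdS psdG df f0 fge eps_itv gX sE indXE mW mZ indZ lawZ small.
have n0 : 0 < n%:R :> R by rewrite ltr0n.
have /andP[e0 e1] := eps_itv.
set N := (p * m)%N in small *.
have N0 : (0 < N)%N by rewrite muln_gt0 p_gt0.
have NR : 1 <= N%:R :> R by rewrite ler1n.
set M := Num.max _ _.
have M1 : N%:R / n%:R <= M by rewrite le_max lexx.
have M2 : eps ^+ 2 <= M by rewrite le_max lexx orbT.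
have M0 : 0 < M by apply: lt_le_trans M1; rewrite divr_gt0// ltr0n.
have ne0 : 0 <= n%:R * eps ^+ 2 by rewrite mulr_ge0 ?sqr_ge0// ltW.
have rN : 0 < r * N%:R by apply: mulr_gt0 => //; rewrite ltr0n.
(* The share (r + 2) N pays for the cardinality of the net and 3 for the factor 8 <= exp 3; what
   remains is N + n eps^2, so the last constant can be 1. *)
have [s sE'] : exists s : R, s = (r + 3) * N%:R + n%:R * eps ^+ 2 + 3 by eexists.
have s1 : 1 <= s by rewrite sE'; lra.
have [V V0 VE] : exists2 V : R, 0 < V & V = q * n%:R * (5 * N%:R + s).
  by eexists; last reflexivity; apply: mulr_gt0; [exact: mulr_gt0|lra].
have [L L0 L2] : exists2 L : R, 0 < L & L ^+ 2 = V.
  by exists (Num.sqrt V); [rewrite sqrtr_gt0|rewrite sqr_sqrtr// ltW].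
rewrite VE in L2.
pose gap := eps + 2 * L / n%:R.
have gap0 : 0 < gap by rewrite ltr_wpDl// divr_gt0// mulr_gt0.
have gapM : gap <= K1 * Num.sqrt M.
  rewrite K1E; apply: (deviation_gap_bound (N := N%:R)) => //; first exact: ltW.
  by rewrite L2 sE'.
have gap2 : gap ^+ 2 <= K1 ^+ 2 * M.
  rewrite -[M in leRHS](@sqr_sqrtr R) ?(ltW M0)// -exprMn lerXn2r ?nnegrE ?(ltW gap0)//.
  by rewrite mulr_ge0 ?sqrtr_ge0// ltW.
have hc1 : 33 * gap / c2 <= c1.
  rewrite ler_pdivrMr//.
  have : Num.sqrt M <= Cs.
    rewrite -[leRHS]ger0_norm; last exact: ltW.
    rewrite -sqrtr_sqr ler_wsqrtr//; apply: le_trans small.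
    by rewrite ge_max lerDr lerDl sqr_ge0 divr_ge0 ?(ltW n0).
  rewrite CsE ler_pdivlMr; last exact: mulr_gt0.
  by move=> h; lra.
have [K [rep [cK net]]] := trform_net psdS p_gt0 m_gt0.
have L2' : 64 * (544 * n%:R * (5 * (p * m)%:R + s)) <= L ^+ 2.
  by rewrite L2 qE -!mulrA lexx.
have /choice[A hA] : forall k, exists A : set Om, [/\ measurable A, 1 - 8 * expR (- s) <= prb P A &
    forall w, A w -> uniformly_close P0 Gamma B X0 E0 (fun i => Z i w) gap (rep k)].
  move=> k; exact: (score_event p_gt0 m_gt0 n_gt0 eps_itv gX.1 sE.1 mW mZ indZ lawZ _ s1 (ltW L0) L2').
have mC k : measurable (~` A k) by apply: measurableC; have [] := hA k.
have pC k : prb P (~` A k) <= 8 * expR (- s).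
  by have [mA pA _] := hA k; rewrite prbC//; clear - pA; lra.
have [mU pU] := prb_union_bound mC pC.
exists (~` \big[setU/set0]_k (~` A k)); split; first exact: measurableC.
- move=> w hw Bh maxBh.
  have Aw k : A k w.
    by apply: contrapT => h; apply: hw; rewrite (bigD1 k)//=; left.
  have := depth_maximizer_error p_gt0 m_gt0 n_gt0 psdS df fge c1_gt0 c2_gt0 gX sE indXE net
    (fun k => let: And3 _ _ h := hA k in h w (Aw k)) maxBh gap0 hc1.
  have o0 := opnorm_ge0 Gamma m_gt0 => err.
  have err' : trform Sigma (Bh - B) <= Ce ^+ 2 * opnorm Gamma * M.
    apply: (le_trans err).
    have -> : (528 * gap / c2) ^+ 2 = (528 / c2) ^+ 2 * gap ^+ 2 by rewrite -exprMn mulrAC.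
    have -> : Ce ^+ 2 * opnorm Gamma * M = (528 / c2) ^+ 2 * (K1 ^+ 2 * M) * opnorm Gamma.
      by rewrite CeE [528 * K1 / c2]mulrAC exprMn; ring.
    by apply: ler_wpM2r; [exact: o0|apply: ler_wpM2l; [exact: sqr_ge0|exact: gap2]].
  rewrite trformE; split => //; apply: le_trans err'.
  exact: kappa_trform.
rewrite prbE; last exact: measurableC.
rewrite lee_fin prbC// lerD2l lerN2 mul1r; apply: (le_trans pU).
have e2 : 2 <= expR 1 :> R by have := expR_ge1Dx (1 : R); clear; lra.
have cKe : #|K|%:R <= expR ((r + 2) * N%:R) :> R.
  apply: (@le_trans _ _ (2 ^+ (80 * 80 * N + 2 * N))).
    by rewrite -natrX ler_nat; exact: cK.
  apply: (@le_trans _ _ (expR 1 ^+ (80 * 80 * N + 2 * N))).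
    apply: lerXn2r; [rewrite nnegrE; exact: ler0n|rewrite nnegrE; exact: expR_ge0|exact: e2].
  by rewrite -expRM_natl ler_expR mulr1 natrD !natrM -rE -mulrDl lexx.
have e8 : 8 <= expR 3 :> R.
  have -> : (8 : R) = 2 ^+ 3 by ring.
  have -> : expR 3 = expR 1 ^+ 3 :> R by rewrite -expRM_natl mulr1.
  by rewrite lerXn2r ?nnegrE ?expR_ge0.
have es0 : 0 <= expR (- s) by exact: expR_ge0.
apply: (@le_trans _ _ (expR ((r + 2) * N%:R) * (expR 3 * expR (- s)))).
  by apply: ler_pM; [exact: ler0n|rewrite mulr_ge0|exact: cKe|rewrite ler_wpM2r].
by rewrite -!expRD ler_expR sE'; clear - NR; lra.
Qed.
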